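(* Let $0 < \varepsilon < \frac{1}{2}$ and let $W\geq 1$ be an integer. There exists a one-pass streaming algorithm which, given a randomly-ordered stream of the weighted edges of a multi-graph $G$ having integer weights in $\{1, \ldots, W\}$ (with vertex capacities $\{b_v\}$), outputs with probability at least $1-2m^{-3}$ a $b$-matching $M$ with $\left(2 - \frac{1}{2W} + \varepsilon\right)\cdot w(M)\geq w(M_G)$, using $O(\max(|M_G|,n) \cdot \mathrm{poly}(\log(m), W, 1/\varepsilon))$ memory.
   Context: A weighted multi-graph $G=(V,E)$, $|V|=n$, $|E|=m$, has a multi-set of weighted edges $(u,v,k)$ with $u\neq v$ and integer weight $k\in\{1,\dots,W\}$; each vertex $v$ has a positive integer capacity $b_v$, and the number of edges between any two vertices $u,v$ is at most $\min(b_u,b_v)$. A $b$-matching is a multi-set of edges $M$ with at most $b_v$ edges of $M$ incident to each $v$; $w(M)$ is its total weight. $M_G$ denotes a maximum weight $b$-matching of $G$ and $|M_G|$ its number of edges. In the random-order streaming model, the edges of $G$ arrive one at a time in a single pass, in an order given by a uniformly random permutation of $E$; the algorithm may make only one pass over the stream, and memory is measured in number of stored edges/words. *)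

(* Defs.v *)
From mathcomp Require Import all_boot all_order all_fingroup all_algebra.
From mathcomp Require Import boolp reals exp.

Set Implicit Arguments.
Unset Strict Implicit.
Unset Printing Implicit Defensive.

Import Order.TTheory GRing.Theory Num.Theory.

(* An undirected weighted edge: its set of endpoints (constrained below to have
   exactly two elements) and its weight. Multisets of edges are lists, compared
   by multiplicities. *)
Definition wedge (n : nat) : Type := ({set 'I_n} * nat)%type.

Definition incident (n : nat) (v : 'I_n) (e : wedge n) : bool := v \in e.1.

Definition weight (n : nat) (M : seq (wedge n)) : nat := \sum_(e <- M) e.2.

(* The multiplicity condition bounds the number of parallel edges of all
   weights together. *)
Record wmultigraph (W n m : nat) := WMultigraph {
  cap : 'I_n -> nat;
  edges : m.-tuple (wedge n);
  cap_gt0 : forall v, 0 < cap v;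
  edges_loopless : forall e, e \in edges -> #|e.1| = 2;
  edges_weight : forall e, e \in edges -> 1 <= e.2 <= W;
  edges_mult : forall u v : 'I_n, u != v ->
    count (fun e : wedge n => e.1 == [set u; v]) edges <= minn (cap u) (cap v)
}.

Definition submultiset (T : eqType) (s1 s2 : seq T) : bool :=
  all (fun x => count_mem x s1 <= count_mem x s2) s1.

Definition is_bmatching (W n m : nat) (G : wmultigraph W n m)
    (M : seq (wedge n)) : bool :=
  submultiset M (edges G) && [forall v, count (incident v) M <= cap G v].

Definition is_max_bmatching (W n m : nat) (G : wmultigraph W n m)
    (M : seq (wedge n)) : Prop :=
  is_bmatching G M /\
  forall M' : seq (wedge n), is_bmatching G M' -> weight M' <= weight M.

(* A word holds O(log(n + m + W)) bits: enough for the name of a vertex, a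
   weight, or a counter of stream items. *)
Definition word (W n m : nat) : Type := 'I_(n + m + W).+1.

(* A deterministic one-pass algorithm for streams of m edges on n vertices.
   Everything remembered between two arrivals, including what is kept of the
   capacities, is in the list of words: [step] and [result] see nothing else
   of the instance. Space is the length of that list; the computation made
   inside one step is not charged. *)
Record stream_algo (W n m : nat) := StreamAlgo {
  init : ('I_n -> nat) -> seq (word W n m);
  step : seq (word W n m) -> wedge n -> seq (word W n m);
  result : seq (word W n m) -> seq (wedge n)
}.

Definition arrival (W n m : nat) (G : wmultigraph W n m) (s : 'S_m) :
    m.-tuple (wedge n) :=
  [tuple tnth (edges G) (s i) | i < m].

Definition memory_at (W n m : nat) (A : stream_algo W n m)
    (G : wmultigraph W n m) (s : 'S_m) (t : nat) : seq (word W n m) :=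
  foldl (step A) (init A (cap G)) (take t (arrival G s)).

Definition output (W n m : nat) (A : stream_algo W n m)
    (G : wmultigraph W n m) (s : 'S_m) : seq (wedge n) :=
  result A (memory_at A G s m).

Local Open Scope ring_scope.

Definition prob_perm (R : realType) (m : nat) (P : pred 'S_m) : R :=
  #|[set s : 'S_m | P s]|%:R / (m`!)%:R.

(* Main.v *)
(* Kept edges form an edge-degree constrained subgraph H of the bipartite double
   cover: they are oriented, out- and in-degrees are scaled by beta * b_v, and the
   two scaled degrees at a kept edge of weight k add up to less than k + 2 / beta.
   An arriving edge is inserted when one of its orientations is underfull, that
   is, when this sum is at most k - 2 / beta. Every insertion and deletion
   increases a concave quadratic potential which is O(W^2 |M_G|), so a long run of
   arrivals without insertion occurs within a small fraction of the stream; in a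
   random order, such a run leaves few underfull edges to come, and all of them
   are stored. When m is at most n times a power of the parameters, the whole
   stream is stored instead; otherwise |M_G| is large enough for concentration,
   as m <= |M_G| (2 n + 1).

   For the ratio, let M be the part of M_G after this run. Orient the edges of M
   at random, splitting each capacity b_v between the two copies of v
   accordingly; by a second moment bound the kept degrees split evenly at almost
   all vertices. Take an integral optimal dual (y, z) of the resulting bipartite
   b-matching problem and let d be the scaled degrees. On kept edges
   d_u + d_v <= y_u + y_v, hence phi (d_u - y_u) + phi (d_v - y_v) <= 0 for the odd
   increasing function phi t = sgn t * (W - 1/2) / (W - |t|), and so
   sum_v b_v d_v phi (d_v - y_v) <= 0. An edge of M which is not stored has
   d_u + d_v >= w; if it is not covered by y, its two endpoints contribute at least
   its deficit w - y_u - y_v to sum_v b_v (d_v phi (d_v - y_v) + c y_v), where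
   c = 1 - 1 / (2 W). The deficits therefore add up to at most c sum_v b_v y_v,
   which gives the ratio 1 + c. *)

Require Import Defs.
From mathcomp Require Import all_boot all_order all_fingroup all_algebra.
From mathcomp Require Import boolp reals sequences exp.
From mathcomp Require Import zify ring lra.

Set Implicit Arguments.
Unset Strict Implicit.
Unset Printing Implicit Defensive.

Import Order.TTheory GRing.Theory Num.Theory.

(** * Counting arrival orders *)

(** Neither [|M_G|] nor the number of insertions is known in advance, so no fixed run length can be
    right. The run awaited after j insertions has length about m / (N^5 (j + 1)): these lengths form
    a harmonic sum and add up to a small fraction of m however many insertions occur. The room for
    late edges grows like j + 1, so that run length times room does not depend on j, up to rounding;
    the potential bounds the final j, hence the room, in terms of [|M_G|].

    Two obstacles shape the ratio. The multiplier phi has a pole at |t| = W, so it is used with w =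
    W + xi after the degrees have been scaled down to at most W. And a kept edge with positive dual
    z may violate d_u + d_v <= y_u + y_v; its mass is at most 2 / beta and phi is at most w / xi, so
    it is charged at most 1, which its integral z pays. The 1/2 in phi comes from integrality as
    well: a positive deficit is at least 1, and in the worst case each endpoint supplies half of
    it. *)

Lemma card_ord_lt m q : q <= m -> #|[set j : 'I_m | j < q]| = q.
Proof.
move=> qm; have inj : injective (widen_ord qm).
  by move=> i j /(congr1 val) /= E; apply: val_inj.
rewrite -[RHS]card_ord -(card_imset _ inj).
apply: eq_card => j; rewrite inE; apply/idP/imsetP => [jq|[i _ ->]] /=; last exact: ltn_ord.
by exists (Ordinal jq) => //; apply: val_inj.
Qed.

Lemma card_ord_ge m q : q <= m -> #|[set j : 'I_m | q <= j]| = m - q.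
Proof.
move=> qm; have := cardsC [set j : 'I_m | j < q]; rewrite card_ord card_ord_lt // => mE.
rewrite -[in RHS]mE addKn; congr #|pred_of_set _|.
by apply/setP => j; rewrite !inE -leqNgt.
Qed.

Lemma card_bigcup_le (T I : finType) (P : pred I) (F : I -> {set T}) :
  #|\bigcup_(i | P i) F i| <= \sum_(i | P i) #|F i|.
Proof.
elim/big_rec2: _ => [|i y A _ IH]; first by rewrite cards0.
by apply: leq_trans (leq_card_setU _ _) _; rewrite leq_add2l.
Qed.

Section RandomOrder.
Variable m : nat.

Let misses (t a : nat) (Q : {set 'S_m}) (U : 'S_m -> {set 'I_m}) :=
  [set s in Q | [forall i : 'I_m, (t <= i < t + a) ==> (s i \notin U s)]].

(* Exchanging position t + a with a later one preserves the event of missing U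
   on [t, t + a); so, given this event, the edge at position t + a is uniform
   among the remaining ones, of which at least g lie in U. *)
Lemma card_misses (g t a : nat) (Q : {set 'S_m}) (U : 'S_m -> {set 'I_m}) :
  t + a <= m ->
  (forall s s' : 'S_m, (forall i : 'I_m, i < t -> s i = s' i) ->
     ((s \in Q) = (s' \in Q)) * (U s = U s')) ->
  (forall s, s \in Q -> g <= #|[set i : 'I_m | (t <= i) && (s i \in U s)]|) ->
  #|[set s in Q | [forall i : 'I_m, (t <= i < t + a) ==> (s i \notin U s)]]|
    * m ^ a <= m`! * (m - g) ^ a.
Proof.
move=> + Qpre Qg; rewrite -/(misses t a Q U); elim: a => [|a IHa] ta.
  by rewrite !expn0 !muln1 -card_Sn max_card.
have {}IHa := IHa ltac:(lia).
suff step : #|misses t a.+1 Q U| * m <= #|misses t a Q U| * (m - g).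
  rewrite !expnS mulnA; apply: (leq_trans (leq_mul step (leqnn _))).
  by rewrite mulnAC [m`! * _]mulnCA mulnC leq_mul2l IHa orbT.
have x0P : t + a < m by lia.
pose x0 := Ordinal x0P; pose r := m - (t + a).
(* No hit has occurred on [t, t + a), so the g hits promised from t on all lie from t + a on. *)
have hitP s : s \in misses t a Q U ->
    #|[set j : 'I_m | (t + a <= j) && (s j \notin U s)]| <= r - g.
  rewrite inE => /andP[sQ /forallP smiss].
  have -> : [set j : 'I_m | (t + a <= j) && (s j \notin U s)] =
    [set j : 'I_m | t + a <= j] :\: [set i : 'I_m | (t <= i) && (s i \in U s)].
    by apply/setP => j; rewrite !inE; case: (s j \in U s); lia.
  rewrite cardsD; apply: leq_sub.
    by rewrite card_ord_ge // ltnW.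
  apply: leq_trans (Qg s sQ) _; apply/subset_leq_card/subsetP => j.
  rewrite !inE => /andP[tj sU]; rewrite tj sU andbT /= andbT.
  by have := smiss j; rewrite sU tj /=; case: (ltnP j (t + a)).
have swapE (j : 'I_m) : t + a <= j ->
    #|[set s in misses t a Q U | s j \notin U s]| = #|misses t a.+1 Q U|.
  move=> taj; rewrite -(card_imset _ (@mulgI _ (tperm x0 j))); congr #|pred_of_set _|.
  have tpE s : (s \in misses t a Q U -> (tperm x0 j * s)%g \in misses t a Q U)
             * (U (tperm x0 j * s)%g = U s).
    have pre (i : 'I_m) : i < t + a -> (tperm x0 j * s)%g i = s i.
      move=> ita; rewrite permM tpermD //; apply/eqP => E; move: ita; rewrite -E /=; lia.
    have [QE UE] := Qpre (tperm x0 j * s)%g s (fun i it => pre i ltac:(lia)).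
    split=> //; rewrite !inE QE => /andP[-> /forallP smiss] /=.
    apply/forallP => i; apply/implyP => /andP[ti ita].
    by rewrite pre // UE; have := smiss i; rewrite ti ita.
  apply/setP => s; apply/imsetP/idP => [[s' + ->]|sM].
    rewrite inE => /andP[s'M s'j]; have := (tpE s').1 s'M.
    rewrite !inE => /andP[-> /forallP smiss] /=; apply/forallP => i.
    apply/implyP => /andP[ti]; rewrite addnS ltnS leq_eqVlt => /orP[/eqP ita|ita].
      have -> : i = x0 by apply/val_inj.
      by rewrite (tpE s').2 permM tpermL.
    by have := smiss i; rewrite ti ita.
  have sM' : s \in misses t a Q U.
    move: sM; rewrite !inE => /andP[-> /forallP smiss] /=; apply/forallP => i.
    by have := smiss i; case: (t <= i) => //=; case: (ltnP i (t + a)) => //= ita; rewrite addnS ltnS ltnW.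
  exists (tperm x0 j * s)%g; last by rewrite mulgA tperm2 mul1g.
  rewrite inE (tpE s).1 //= (tpE s).2 permM tpermR.
  move: sM; rewrite inE => /andP[_ /forallP/(_ x0)].
  by rewrite /= leq_addr addnS leqnn.
have card_tail : #|[set j : 'I_m | t + a <= j]| = r := card_ord_ge (ltnW x0P).
(* The pairs (s, j) with j >= t + a and s j outside U s are counted by j, where [swapE] makes all
   contributions equal, and by s, where [hitP] bounds them. *)
have dbl : #|misses t a.+1 Q U| * r <= #|misses t a Q U| * (r - g).
  rewrite -[X in _ <= X]sum_nat_const.
  apply: (@leq_trans (\sum_(s in misses t a Q U)
     #|[set j : 'I_m | (t + a <= j) && (s j \notin U s)]|)); last by apply: leq_sum => s /hitP.
  rewrite mulnC -card_tail -sum_nat_const.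
  rewrite (eq_bigr (fun j => \sum_(s in misses t a Q U | s j \notin U s) 1)); last first.
    move=> j; rewrite inE => /swapE <-; rewrite -sum1_card; apply: eq_bigl => s.
    by rewrite !inE.
  rewrite (exchange_big_dep (mem (misses t a Q U))) /=; last by move=> ? ? _ /andP[].
  apply: leq_sum => s sM; rewrite -[X in _ <= X]sum1_card.
  by apply/eq_leq/eq_bigl => j; rewrite sM /= !inE.
have r0 : 0 < r by rewrite /r; lia.
have rm : r <= m by rewrite /r; lia.
have [rg|gr] := leqP r g.
  have : #|misses t a.+1 Q U| * r <= 0 by rewrite (leq_trans dbl) // (_ : r - g = 0) ?muln0 //; lia.
  by rewrite leqn0 muln_eq0 => /orP[/eqP ->|]; [rewrite mul0n|lia].
rewrite -(leq_pmul2r r0); apply: leq_trans (_ : #|misses t a Q U| * (r - g) * m <= _).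
  by rewrite mulnAC leq_mul2r dbl orbT.
by rewrite -!mulnA leq_mul2l; apply/orP; right; rewrite !mulnBl; nia.
Qed.

Let early (q : nat) (L : {set 'I_m}) : {set 'S_m} :=
  [set s : 'S_m | [forall i : 'I_m, (s i \in L) ==> (i < q)]].

(** Sampling without replacement: once c elements of [L] are early, the position of a further one is
    uniform among the m - c left, q - c of them early, and (q - c) / (m - c) <= q / m. *)
Lemma card_early_all (q c : nat) (L : {set 'I_m}) : q <= m -> #|L| = c ->
  #|[set s : 'S_m | [forall i : 'I_m, (s i \in L) ==> (i < q)]]| * m ^ c
    <= m`! * q ^ c.
Proof.
move=> qm; rewrite -/(early q L); elim: c L => [|c IHc] L cL.
  by rewrite !expn0 !muln1 -card_Sn max_card.
have [x xL] : exists x, x \in L by apply/card_gt0P; rewrite cL.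
pose L' := L :\ x; have cL' : #|L'| = c by move: (cardsD1 x L); rewrite xL cL => -[].
have {}IHc := IHc L' cL'.
have earlyU y s : (s \in early q (y |: L')) = (s \in early q L') && ((s^-1)%g y < q).
  rewrite !inE; apply/forallP/andP => [sP|[/forallP sP yq] i].
    split; last by have := sP ((s^-1)%g y); rewrite permKV !inE eqxx.
    by apply/forallP => i; have := sP i; rewrite !inE; case: (_ && _) => //; rewrite orbT.
  rewrite !inE; apply/implyP => /orP[/eqP E|siL']; first by rewrite -E permK in yq.
  by have := sP i; rewrite !inE siL'.
have swapE y : y \notin L' -> #|early q (y |: L')| = #|early q L|.
  move=> yL'; rewrite -(card_imset _ (@mulIg _ (tperm x y))); congr #|pred_of_set _|.
  have xL' : x \notin L' by rewrite !inE eqxx.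
  have sub u v s : u \notin L' -> v \notin L' ->
      s \in early q (u |: L') -> (s * tperm u v)%g \in early q (v |: L').
    move=> uL' vL'; rewrite [s \in _]inE [_ \in early _ (v |: _)]inE => /forallP sP.
    apply/forallP => i; have := sP i; rewrite permM !in_setU1.
    case: tpermP => [->|->|/eqP/negPf -> /eqP/negPf ->]; rewrite ?eqxx //.
    by rewrite (negPf uL') (negPf vL') eq_sym.
  apply/setP => s; rewrite -(setD1K xL) -/L'; apply/imsetP/idP => [[s' s'P ->]|sP].
    by rewrite tpermC; apply: sub.
  exists (s * tperm x y)%g; first exact: sub.
  by rewrite -mulgA tperm2 mulg1.
have cm : c < m by have := max_card L; rewrite card_ord cL.
have dbl : #|early q L| * (m - c) <= #|early q L'| * (q - c).
  have cC : #|~: L'| = m - c by have := cardsC L'; rewrite card_ord cL'; lia.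
  rewrite mulnC -cC -!sum_nat_const.
  rewrite (eq_bigr (fun y => \sum_(s in early q L' | (s^-1)%g y < q) 1)); last first.
    move=> y; rewrite inE => /swapE <-; rewrite -sum1_card; apply: eq_bigl => s.
    exact: earlyU.
  rewrite (exchange_big_dep (mem (early q L'))) /=; last by move=> ? ? _ /andP[].
  apply: leq_sum => s sM; rewrite sum1dep_card.
  rewrite -(card_imset _ (@perm_inj _ (s^-1)%g)).
  have -> : q - c = #|[set j : 'I_m | j < q] :\: [set (s^-1)%g y | y in L']|.
    rewrite cardsDS ?card_ord_lt ?card_imset ?cL' //; first exact: perm_inj.
    apply/subsetP => _ /imsetP[y yL' ->]; rewrite inE.
    by have := sM; rewrite inE => /forallP/(_ ((s^-1)%g y)); rewrite permKV yL'.
  apply/subset_leq_card/subsetP => _ /imsetP[y + ->].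
  rewrite inE in_setC => /andP[yL' /andP[_ yq]].
  by rewrite in_setD inE yq andbT mem_imset //; exact: perm_inj.
suff step : #|early q L| * m <= #|early q L'| * q.
  rewrite !expnS mulnA; apply: leq_trans (leq_mul step (leqnn _)) _.
  by rewrite mulnAC [m`! * _]mulnCA mulnC leq_mul2l IHc orbT.
have mc0 : 0 < m - c by lia.
rewrite -(leq_pmul2r mc0) mulnAC; apply: leq_trans (leq_mul dbl (leqnn m)) _.
by rewrite -!mulnA leq_mul2l; apply/orP; right; rewrite mulnBl mulnBr; nia.
Qed.

(** Union bound over the c-subsets of [K]: if at least c elements of [K] are early, some c-subset is
    early as a whole. *)
Lemma card_early (q c : nat) (K : {set 'I_m}) : q <= m ->
  #|[set s : 'S_m | c <= #|[set i : 'I_m | (i < q) && (s i \in K)]|]| * m ^ c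
    <= 'C(#|K|, c) * (m`! * q ^ c).
Proof.
move=> qm; rewrite -cards_draws -[X in _ <= X]sum_nat_const.
apply: leq_trans (_ : \sum_(L in [set A : {set 'I_m} | (A \subset K) && (#|A| == c)])
   #|early q L| * m ^ c <= _); last first.
  by apply: leq_sum => L; rewrite inE => /andP[_ /eqP]; apply: card_early_all.
rewrite -big_distrl leq_mul2r; apply/orP; right.
apply: leq_trans (_ : #|\bigcup_(L in [set A : {set 'I_m} | (A \subset K) && (#|A| == c)])
   early q L| <= _); last exact: card_bigcup_le.
apply/subset_leq_card/subsetP => s; rewrite inE => cs.
have := cs; rewrite -(card_imset _ (@perm_inj _ s)) => {}cs.
have [L LK cL] : exists2 L : {set 'I_m}, L \subset [set s i | i in [set i : 'I_m | (i < q) && (s i \in K)]] & #|L| = c.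
  have : 0 < #|[set A : {set 'I_m} | (A \subset [set s i | i in [set i : 'I_m | (i < q) && (s i \in K)]]) && (#|A| == c)]|.
    by rewrite cards_draws bin_gt0.
  by case/card_gt0P => L; rewrite inE => /andP[? /eqP ?]; exists L.
apply/bigcupP; exists L; rewrite !inE.
  rewrite cL eqxx andbT; apply/subsetP => y /(subsetP LK)/imsetP[i + ->].
  by rewrite inE => /andP[].
apply/forallP => i; apply/implyP => /(subsetP LK); rewrite mem_imset; last exact: perm_inj.
by rewrite inE => /andP[].
Qed.

End RandomOrder.

(** * Numerical estimates *)

Lemma leq_ffact_expn n k : n ^_ k <= n ^ k.
Proof.
elim: k => [|k IHk]; first by rewrite ffactn0.
by rewrite ffactnSr expnSr leq_mul // leq_subr.
Qed.

Lemma leq_expn_ffact n k : (n - k) ^ k <= n ^_ k.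
Proof.
elim: k n => [|k IHk] [|n]; rewrite ?ffactn0 //; first by rewrite sub0n exp0n.
by rewrite ffactnS subSS expnS leq_mul // (leq_trans (leq_subr k n)).
Qed.

(** A weak Stirling bound: c^c is at most the falling factorial 'C(2c, c) * c!, and 'C(2c, c) <=
    4^c. *)
Lemma expnn_le_fact c : c ^ c <= 4 ^ c * c`!.
Proof.
have bin_le : 'C(c + c, c) <= 4 ^ c.
  have -> : 4 ^ c = 2 ^ (c + c) by rewrite addnn -mul2n expnM.
  have lt : c < (c + c).+1 by rewrite ltnS leq_addr.
  by rewrite -[2]/(1 + 1) expnDn (bigD1 (Ordinal lt)) //= !exp1n !muln1 leq_addr.
apply: leq_trans (leq_mul bin_le (leqnn _)); rewrite bin_ffact.
by rewrite -{1}(addnK c c) leq_expn_ffact.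
Qed.

(** Of mu elements, mu * q / m <= c / 8 are early on average. As 'C(mu, c) <= (4 * mu / c)^c, the
    union bound is at most 2^-c <= m^-3. *)
Lemma early_tail mu q m N c : 0 < c -> 3 * N <= c -> m <= 2 ^ N -> 8 * mu * q <= c * m ->
  'C(mu, c) * q ^ c * m ^ 3 <= m ^ c.
Proof.
move=> c0 Nc mN qc; have cc0 : 0 < c ^ c by rewrite expn_gt0 c0.
rewrite -(leq_pmul2r cc0).
have binc : 'C(mu, c) * c ^ c <= (4 * mu) ^ c.
  apply: leq_trans (leq_mul (leqnn _) (expnn_le_fact c)) _.
  by rewrite mulnCA bin_ffact expnMn leq_mul // leq_ffact_expn.
have m3 : m ^ 3 <= 2 ^ c.
  apply: (@leq_trans ((2 ^ N) ^ 3)); first by rewrite leq_exp2r.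
  by rewrite -expnM leq_exp2l // mulnC.
apply: leq_trans (_ : (4 * mu) ^ c * q ^ c * 2 ^ c <= _).
  have -> : 'C(mu, c) * q ^ c * m ^ 3 * c ^ c = 'C(mu, c) * c ^ c * q ^ c * m ^ 3 by ring.
  by rewrite !leq_mul.
rewrite -!expnMn; apply: leq_trans (_ : (c * m) ^ c <= _); last by rewrite mulnC.
by rewrite leq_exp2r //; lia.
Qed.

(** A harmonic sum in dyadic blocks: each doubling of the range adds at most x. *)
Lemma sum_divn_pow2 x L : \sum_(i < 2 ^ L) x %/ i.+1 <= x * L.+1.
Proof.
elim: L => [|L IHL]; first by rewrite expn0 big_ord1 divn1 muln1.
rewrite expnS mul2n -addnn big_split_ord /= mulnS addnC leq_add //.
apply: leq_trans (_ : \sum_(i < 2 ^ L) x %/ 2 ^ L <= _).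
  by apply: leq_sum => i _; rewrite leq_div2l ?expn_gt0 // -addnS leq_addr.
by rewrite sum_nat_const card_ord mulnC leq_trunc_div.
Qed.

(** Terms beyond x vanish, so the bound does not depend on [k], which will be one more than the
    number of insertions. *)
Lemma sum_divn_le x L k : x < 2 ^ L -> \sum_(i < k) x %/ i.+1 <= x * L.+1.
Proof.
move=> xL; apply: leq_trans (sum_divn_pow2 x L).
apply: leq_trans (_ : \sum_(i < 2 ^ L + k) x %/ i.+1 <= _).
  by rewrite addnC big_split_ord /= leq_addr.
rewrite big_split_ord /= [X in _ + X]big1 ?addn0 // => i _.
by rewrite divn_small // (leq_trans xL) // -addnS leq_addr.
Qed.

(** (1 - g / m)^a <= exp (- a g / m) <= exp (- 5 N) <= m^-5, as m <= 2^N <= e^N. The exponent 5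
    leaves m^-3 after a union bound over m^2 events. *)
Lemma miss_tail (R : realType) (m g a N : nat) : 0 < a -> m <= 2 ^ N -> 5 * N * m <= a * g ->
  (m - g) ^ a * m ^ 5 <= m ^ a.
Proof.
move=> a0 mN ag.
have [->|m0] := posnP m; first by rewrite sub0n muln0.
have [mg|gm] := leqP m g.
  by rewrite (_ : m - g = 0) ?exp0n //; apply/eqP; rewrite subn_eq0.
rewrite -(ler_nat R) natrM !natrX natrB; last exact: ltnW.
have mR : (0 < m%:R :> R)%R by rewrite ltr0n.
have m0' : (m%:R != 0 :> R)%R by rewrite gt_eqF.
set x : R := (g%:R / m%:R)%R.
have -> : (m%:R - g%:R = m%:R * (1 - x))%R by rewrite /x; field.
rewrite exprMn -mulrA -[leRHS]mulr1 ler_wpM2l ?exprn_ge0 ?ler0n //.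
have x1 : (0 <= 1 - x)%R by rewrite subr_ge0 ler_pdivrMr // mul1r ler_nat ltnW.
have ex : ((1 - x) ^+ a <= expR (- (5 * N)%:R))%R.
  apply: (@le_trans _ _ (expR (- x) ^+ a)%R).
    by rewrite lerXn2r ?nnegrE ?expR_ge0 // expR_ge1Dx.
  rewrite -expRM_natl ler_expR mulrN lerN2 /x mulrA ler_pdivlMr // -!natrM ler_nat.
  exact: ag.
have em : (m%:R ^+ 5 <= expR (5 * N)%:R :> R)%R.
  rewrite natrM expRM_natl lerXn2r ?nnegrE ?expR_ge0 ?ler0n //.
  apply: (@le_trans _ _ (2 ^+ N)%R); first by rewrite -natrX ler_nat.
  rewrite -[(N%:R)%R]mulr1 expRM_natl lerXn2r ?nnegrE ?expR_ge0 //.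
  by have := expR_ge1Dx (1 : R).
apply: le_trans (ler_pM _ _ ex em) _; rewrite ?exprn_ge0 ?ler0n //.
by rewrite expRN mulVf // gt_eqF // expR_gt0.
Qed.

(** * Integral duality for bipartite b-matchings *)

Local Open Scope ring_scope.

(** Integrality replaces compactness: circulations do not form a finite type, but a bounded integral
    objective attains its maximum. *)
Lemma ex_max_int (T : Type) (P : T -> Prop) (F : T -> int) (B : int) :
  (exists x, P x) -> (forall x, P x -> F x <= B) ->
  exists2 x, P x & forall y, P y -> F y <= F x.
Proof.
move=> [x0 Px0] leB.
pose Q n := `[< exists2 x, P x & B - F x = Posz n >].
have exQ : exists n, Q n.
  exists `|B - F x0|%N; apply/asboolP; exists x0 => //.
  by rewrite gez0_abs // subr_ge0 leB.
case: (ex_minnP exQ) => n /asboolP[x Px Fx] nmin; exists x => // y Py.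
have /nmin : Q `|B - F y|%N.
  by apply/asboolP; exists y => //; rewrite gez0_abs // subr_ge0 leB.
by have := leB _ Py; lia.
Qed.

Section Circulation.
Variables (V A : finType) (src dst : A -> V) (u : A -> nat) (w : A -> int).

Definition is_circulation (f : A -> int) :=
  (forall a, 0 <= f a <= (u a)%:Z) /\
  (forall v, \sum_(a | src a == v) f a = \sum_(a | dst a == v) f a).

Definition circ_weight (f : A -> int) : int := \sum_a w a * f a.

Lemma ex_max_circulation : exists2 f, is_circulation f &
  forall g, is_circulation g -> circ_weight g <= circ_weight f.
Proof.
apply: (@ex_max_int _ _ _ (\sum_a `|w a| * (u a)%:Z)).
  exists (fun=> 0); split => [a|v]; first by rewrite lexx.
  by rewrite !big1.
move=> f [fu _]; apply: ler_sum => a _; have := fu a => /andP[f0 fu'].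
apply: le_trans (ler_norm _) _; rewrite normrM ler_wpM2l //.
by rewrite ger0_norm.
Qed.

Variable f : A -> int.
Hypothesis fC : is_circulation f.
Hypothesis fmax : forall g, is_circulation g -> circ_weight g <= circ_weight f.

(* Residual arc (a, true) pushes one more unit through a, (a, false) takes one back. *)
Let ok (r : A * bool) := if r.2 then f r.1 < (u r.1)%:Z else 0 < f r.1.
Let rs (r : A * bool) := if r.2 then src r.1 else dst r.1.
Let rd (r : A * bool) := if r.2 then dst r.1 else src r.1.
Let sg (r : A * bool) : int := if r.2 then 1 else -1.
Let gain (r : A * bool) := sg r * w r.1.
Let cost (p : seq (A * bool)) := \sum_(r <- p) gain r.

Fixpoint walk (x : V) (p : seq (A * bool)) (y : V) : bool :=
  if p is r :: p' then [&& ok r, rs r == x & walk (rd r) p' y] else x == y.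

Lemma walk_cat x p q y : walk x (p ++ q) y <-> exists2 z, walk x p z & walk z q y.
Proof.
elim: p x => [|r p IHp] x /=.
  by split=> [|[z /eqP->]] //; exists x.
split=> [/and3P[-> -> /IHp[z pz qz]]|[z /and3P[-> -> pz] qz]]; first by exists z.
by apply/IHp; exists z.
Qed.

Let net (v : V) (r : A * bool) : int := (rd r == v)%:Z - (rs r == v)%:Z.

Lemma walk_net v x p y : walk x p y ->
  \sum_(r <- p) net v r = (y == v)%:Z - (x == v)%:Z.
Proof.
elim: p x => [|r p IHp] x /=; first by move=> /eqP ->; rewrite big_nil subrr.
move=> /and3P[_ /eqP <- /IHp E]; rewrite big_cons E /net; lia.
Qed.

Lemma walk_ok x p y r : walk x p y -> r \in p -> ok r.
Proof.
elim: p x => //= s p IHp x /and3P[oks _ /IHp IH].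
by rewrite inE => /orP[/eqP -> //|/IH].
Qed.

(** Pushing one unit around the cycle keeps a circulation and changes its weight by [cost p], so
    optimality forbids a gain. An arc taken in both directions cancels out. *)
Lemma cycle_cost_le0 x p : walk x p x -> uniq (map rs p) -> cost p <= 0.
Proof.
move=> wp /map_uniq up.
pose g a := f a + \sum_(r <- p) (r.1 == a)%:Z * sg r.
have sumE a : \sum_(r <- p) (r.1 == a)%:Z * sg r
    = ((a, true) \in p)%:Z - ((a, false) \in p)%:Z.
  elim: p up {wp g} => [|[b c] p IHp] /=; first by rewrite big_nil.
  move=> /andP[bp /IHp E]; rewrite big_cons E !inE /= !xpair_eqE.
  have [ba|ab] := eqVneq b a; last by rewrite mul0r add0r.
  by case: c bp; rewrite ba => /negPf bp; rewrite /sg /= bp; case: (_ \in p).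
have gC : is_circulation g.
  case: fC => fu fcons; split => [a|v].
    rewrite /g sumE; have := fu a.
    have : (a, true) \in p -> f a < (u a)%:Z by move=> /(walk_ok wp).
    have : (a, false) \in p -> 0 < f a by move=> /(walk_ok wp).
    case: ((a, true) \in p); case: ((a, false) \in p) => /= Hf Ht.
    - by move: (Hf isT) (Ht isT); lia.
    - by move: (Ht isT); lia.
    - by move: (Hf isT); lia.
    - by lia.
  rewrite /g !big_split /= fcons; congr (_ + _); apply/eqP; rewrite eq_sym -subr_eq0.
  have side (e : A -> V) : \sum_(a | e a == v) \sum_(r <- p) (r.1 == a)%:Z * sg r
      = \sum_(r <- p) (e r.1 == v)%:Z * sg r.
    rewrite exchange_big; apply: eq_bigr => r _ /=; rewrite big_mkcond /=.
    rewrite (bigD1 r.1) //= eqxx big1 ?addr0 => [|a ar]; first by case: (_ == _); rewrite ?mul0r.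
    by rewrite [r.1 == a]eq_sym (negPf ar) mul0r if_same.
  rewrite !side -sumrB -[X in _ == X](subrr (x == v)%:Z) -(walk_net v wp).
  by apply/eqP/eq_bigr => -[a []] _; rewrite /net /sg /= ?mulr1 // !mulrN1 opprK addrC.
have := fmax gC; rewrite /circ_weight /g.
under eq_bigr do rewrite mulrDr; rewrite big_split /= gerDl.
under eq_bigr do rewrite big_distrr /=.
rewrite exchange_big /= /cost; congr (_ <= _); apply: eq_bigr => r _.
rewrite (bigD1 r.1) //= eqxx mul1r big1 ?addr0 /gain 1?mulrC // => a ar.
by rewrite [r.1 == a]eq_sym (negPf ar) mul0r mulr0.
Qed.

Let simple p y := uniq (rcons (map rs p) y).

(** [pi y] is the largest cost of a simple residual walk ending at y, from any start. Prolonging a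
    best walk by r gives a simple walk or closes a cycle, and cutting the cycle off loses nothing by
    [cycle_cost_le0]. *)
Lemma ex_potential : exists pi : V -> int,
  forall r, ok r -> pi (rs r) + gain r <= pi (rd r).
Proof.
pose B : int := \sum_(a : A) `|w a|.
have gainB r : gain r <= B.
  apply: le_trans (_ : `|w r.1| <= _).
    by rewrite /gain /sg; case: r.2; [rewrite mul1r | rewrite mulN1r -normrN]; exact: ler_norm.
  by rewrite /B (bigD1 r.1) //= lerDl sumr_ge0.
have B0 : 0 <= B by rewrite sumr_ge0.
pose best y c := (exists2 p, (exists x, walk x p y) /\ simple p y & cost p = c) /\
  forall x p, walk x p y -> simple p y -> cost p <= c.
have exbest y : exists c, best y c.
  have [||p [[x wp] sp] pmax] := @ex_max_int _
    (fun p => (exists x, walk x p y) /\ simple p y) cost (B *+ #|V|).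
  - by exists [::]; split; [exists y; rewrite /=|].
  - move=> p [_ sp]; apply: le_trans (ler_sum _ (fun r _ => gainB r)) _.
    rewrite big_const_seq count_predT iter_addr_0; apply: ler_wpMn2l => //.
    have := card_uniqP sp; rewrite size_rcons size_map => E.
    by apply: ltnW; rewrite -E max_card.
  exists (cost p); split; first by exists p => //; split=> //; exists x.
  by move=> x' p' wp' sp'; apply: pmax; split=> //; exists x'.
have [pi piP] := choice exbest.
exists pi => r okr; have [[p [[x wp] sp] <-] _] := piP (rs r).
have [_ pimax] := piP (rd r).
have wr : walk (rs r) [:: r] (rd r) by rewrite /= okr !eqxx.
have -> : cost p + gain r = cost (rcons p r) by rewrite /cost -cats1 big_cat big_seq1.
have wpr : walk x (rcons p r) (rd r).
  by rewrite -cats1; apply/walk_cat; exists (rs r).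
have [|nsimp] := boolP (rd r \in map rs (rcons p r)); last first.
  apply: (pimax x) => //; rewrite /simple map_rcons rcons_uniq.
  by rewrite -map_rcons nsimp map_rcons.
move=> /(nthP (rs r)) [i]; rewrite size_map => isz iE.
move: (wpr); rewrite -(cat_take_drop i (rcons p r)) => /walk_cat[z w1 w2].
have zE : z = rd r.
  move: w2; rewrite (drop_nth r isz) /= => /and3P[_ /eqP <- _].
  by rewrite -iE (nth_map r).
rewrite /cost big_cat /=; apply: le_trans (_ : cost (take i (rcons p r)) <= _).
  rewrite gerDl; apply: (@cycle_cost_le0 (rd r)); first by rewrite -{1}zE.
  by rewrite map_drop drop_uniq // map_rcons.
rewrite zE in w1; apply: pimax w1 _.
rewrite /simple rcons_uniq map_take take_uniq ?map_rcons // andbT.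
move: sp; rewrite /simple -map_rcons => sp.
move: isz; rewrite -(size_map rs) => isz.
move: sp; rewrite -{1}(cat_take_drop i (map rs (rcons p r))) cat_uniq.
move=> /and3P[_ /hasPn dis _]; apply/negP => yt.
have : rd r \in drop i (map rs (rcons p r)).
  by rewrite (drop_nth (rs r) isz) iE inE eqxx.
by move=> /dis /negP; apply.
Qed.

(** Complementary slackness: for the potential of [ex_potential], arcs of positive reduced gain are
    saturated and arcs of negative reduced gain carry nothing. Conservation cancels the potential
    terms. *)
Lemma circulation_dual : exists pi : V -> int,
  circ_weight f = \sum_a (u a)%:Z * Num.max 0 (w a + pi (src a) - pi (dst a)).
Proof.
have [pi piP] := ex_potential; exists pi; rewrite /circ_weight.
have [fu fcons] := fC.
have -> : \sum_a w a * f a = \sum_a (w a + pi (src a) - pi (dst a)) * f a.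
  under [RHS]eq_bigr do rewrite mulrBl mulrDl.
  rewrite sumrB big_split /= -addrA -[LHS]addr0; congr (_ + _).
  apply/esym/eqP; rewrite subr_eq0; apply/eqP.
  have side (e : A -> V) : \sum_a pi (e a) * f a = \sum_v pi v * \sum_(a | e a == v) f a.
    rewrite (partition_big e predT) //=; apply: eq_bigr => v _.
    by rewrite big_distrr /=; apply: eq_bigr => a /eqP ->.
  by rewrite !side; apply: eq_bigr => v _; rewrite fcons.
apply: eq_bigr => a _; have /andP[f0 fua] := fu a.
have := piP (a, true); have := piP (a, false).
rewrite /ok /gain /sg /rs /rd /= => H0 H1.
have [h|h] := ltrP 0 (w a + pi (src a) - pi (dst a)).
  have -> : f a = u a by apply/eqP; rewrite eq_le fua leNgt; apply/negP => /H1; lia.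
  by rewrite mulrC.
rewrite mulr0; have [-> //|fa0] := eqVneq (f a) 0; first by rewrite mulr0.
have := H0; rewrite lt_def fa0 f0 => /(_ isT) h'.
by rewrite (_ : w a + _ - _ = 0) ?mul0r //; lia.
Qed.

End Circulation.

(** A bipartite b-matching is a circulation through None, a left copy, a right copy and back to
    None; the duals [yL], [yR], [z] are the positive parts of the reduced gains of the three kinds
    of arcs. *)
Lemma bipartite_bmatching_dual (V E : finType) (l r : E -> V)
    (capL capR : V -> nat) (avail : pred E) (k : E -> nat) (W : nat) :
  (forall e, k e <= W)%N ->
  exists (S : {set E}) (yL yR : V -> nat) (z : E -> nat),
  [/\ (forall e, e \in S -> avail e) /\
      (forall v, #|[set e in S | l e == v]| <= capL v /\
                 #|[set e in S | r e == v]| <= capR v)%N,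
      (forall v, yL v <= W /\ yR v <= W)%N,
      (forall e, avail e -> k e <= yL (l e) + yR (r e) + z e)%N &
      (\sum_v capL v * yL v + \sum_v capR v * yR v + \sum_(e | avail e) z e
        <= \sum_(e in S) k e)%N].
Proof.
move=> kW.
pose arc : finType := ((V + V) + E)%type.
(* None is both the source and the sink. *)
pose node : finType := option (V + V)%type.
pose src (a : arc) : node :=
  match a with inl (inl _) => None | inl (inr v) => Some (inr v)
  | inr e => Some (inl (l e)) end.
pose dst (a : arc) : node :=
  match a with inl (inl v) => Some (inl v) | inl (inr _) => None
  | inr e => Some (inr (r e)) end.
pose u (a : arc) : nat :=
  match a with inl (inl v) => capL v | inl (inr v) => capR v
  | inr e => avail e end.
pose w (a : arc) : int := if a is inr e then (k e)%:Z else 0.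
have [f fC fmax] := ex_max_circulation src dst u w.
have [pi fpi] := circulation_dual fC fmax.
have [fu fcons] := fC.
have f01 e : f (inr e) = (f (inr e) == 1)%:Z.
  by have := fu (inr e); rewrite /=; case: (avail e); case: eqP; lia.
pose S := [set e | f (inr e) == 1].
have cardS (P : pred E) : (#|[set e in S | P e]|)%:Z = \sum_(e | P e) f (inr e).
  rewrite -sum1_card (eq_bigl (fun e => P e && (f (inr e) == 1))); last first.
    by move=> e; rewrite !inE andbC.
  rewrite big_mkcondr /= -[Posz _]natz natr_sum; apply: eq_bigr => e _.
  by have := f01 e; case: eqP.
pose qL v : int := Num.max 0 (pi None - pi (Some (inl v))).
pose qR v : int := Num.max 0 (pi (Some (inr v)) - pi None).
(* Cutting the duals at [W] keeps them feasible, since [k e <= W], and does not raise their cost;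
   the multiplier needs bounded duals. *)
pose yL v := minn W `|qL v|%N; pose yR v := minn W `|qR v|%N.
pose qE e : int := Num.max 0 ((k e)%:Z + pi (Some (inl (l e))) - pi (Some (inr (r e)))).
pose z e := `|qE e|%N.
exists S, yL, yR, z; split.
- split=> [e|v].
    by rewrite inE => /eqP fe; have := fu (inr e); rewrite fe /=; case: (avail e).
  split; rewrite -lez_nat cardS.
    have <- : \sum_(a | src a == Some (inl v)) f a = \sum_(e | l e == v) f (inr e).
      by rewrite big_sumType /= big_pred0 ?add0r // => -[].
    rewrite fcons (big_pred1 (inl (inl v))) => [|[[]|]] //.
    by have /andP[] := fu (inl (inl v)).
  have <- : \sum_(a | dst a == Some (inr v)) f a = \sum_(e | r e == v) f (inr e).
    by rewrite big_sumType /= big_pred0 ?add0r // => -[].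
  rewrite -fcons (big_pred1 (inl (inr v))) => [|[[]|]] //.
  by have /andP[] := fu (inl (inr v)).
- by move=> v; rewrite !geq_minl.
- move=> e _; have := kW e; rewrite /yL /yR /z /qL /qR /qE; lia.
have capM (c y y' : nat) : (y <= y')%N -> (c * y <= c * y')%N by move=> h; rewrite leq_mul2l h orbT.
apply: (@leq_trans (\sum_v capL v * `|qL v|
   + \sum_v capR v * `|qR v|
   + \sum_(e | avail e) z e)%N).
  rewrite leq_add2r leq_add //; apply: leq_sum => v _; apply: capM; exact: geq_minr.
rewrite -lez_nat !PoszD.
have sumZ (T : finType) (P : pred T) (F : T -> nat) :
    (\sum_(i | P i) F i)%N%:Z = \sum_(i | P i) (F i)%:Z.
  by rewrite -[LHS]natz natr_sum; apply: eq_bigr => i _; rewrite natz.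
have maxZ (x y : int) : y = Num.max 0 x -> `|y|%N%:Z = Num.max 0 x by lia.
rewrite le_eqVlt; apply/orP; left; apply/eqP; rewrite !sumZ; apply: etrans (_ : circ_weight w f = _).
  rewrite fpi !big_sumType /=; congr (_ + _ + _).
  - by apply: eq_bigr => v _; rewrite PoszM (maxZ _ _ (erefl _)) add0r.
  - by apply: eq_bigr => v _; rewrite PoszM (maxZ _ _ (erefl _)) add0r.
  rewrite big_mkcond; apply: eq_bigr => e _; rewrite /z (maxZ _ _ (erefl _)).
  by case: (avail e); rewrite ?mul1r ?mul0r.
rewrite /circ_weight !big_sumType /= big1 ?add0r => [|v _]; last by rewrite mul0r.
rewrite big1 ?add0r => [|v _]; last by rewrite mul0r.
rewrite [RHS]big_mkcond; apply: eq_bigr => e _; rewrite inE.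
by have := f01 e; case: eqP => _ ->; rewrite ?mulr1 ?mulr0.
Qed.

(** * The charging inequality *)

Section Multiplier.
Variables (R : realFieldType) (w : R).

(* The tight case: vertices with d = 1 / 2, y = 0 facing vertices with
   d = w - 1 / 2, y = w; both get multiplier of absolute value 1. *)
Definition multiplier (z : R) : R := Num.sg z * ((w - 1 / 2) / (w - `|z|)).

Lemma multiplier_pos (z : R) : 0 < z -> multiplier z = (w - 1 / 2) / (w - z).
Proof. by move=> z0; rewrite /multiplier gtr0_sg // gtr0_norm // mul1r. Qed.

Lemma multiplierN (z : R) : multiplier (- z) = - multiplier z.
Proof. by rewrite /multiplier sgrN normrN mulNr. Qed.

Lemma multiplier_ge0 (z : R) : 1 <= w -> 0 <= z < w -> 0 <= multiplier z.
Proof.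
move=> w1 /andP[z0 zw]; rewrite /multiplier ger0_norm // mulr_ge0 ?sgr_ge0 //.
by apply: divr_ge0; lra.
Qed.

(** [multiplier] is odd, and increasing between its poles. *)
Lemma multiplier_le0D (a b : R) : 1 <= w -> `|a| < w -> `|b| < w -> a + b <= 0 ->
  multiplier a + multiplier b <= 0.
Proof.
move=> w1; wlog ab : a b / a <= b => [H aw bw ab0|].
  have [/H|/ltW/H] := leP a b; first exact.
  by rewrite addrC [multiplier a + _]addrC; apply.
rewrite !ltr_norml => /andP[aw aw'] /andP[bw bw'] ab0.
rewrite -[a]opprK multiplierN addrC subr_le0.
have [b0|b0] := lerP b 0.
  apply: (@le_trans _ _ 0); last by apply: multiplier_ge0; lra.
  by rewrite -[b]opprK multiplierN oppr_le0 multiplier_ge0 //; lra.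
rewrite !multiplier_pos; [|lra..].
rewrite ler_wpM2l ?lef_pV2 ?posrE; lra.
Qed.

Lemma multiplier_le (xi z : R) : 1 <= w -> 0 < xi -> `|z| <= w - xi -> multiplier z <= w / xi.
Proof.
move=> w1 xi0; rewrite ler_norml => /andP[zw zw'].
have wxi : 0 <= w / xi by apply: divr_ge0; lra.
have [z0|z0] := lerP z 0.
  apply: le_trans wxi; rewrite -[z]opprK multiplierN oppr_le0 multiplier_ge0 //; lra.
rewrite multiplier_pos // ler_pM ?invr_ge0 ?lef_pV2 ?posrE; lra.
Qed.

Let c := 1 - (2 * w)^-1.

(** The case at stake is d < y, where d / (w - y + d) <= y / w because the cross difference is (y -
    d) (w - y). Near equality for d close to y dictates c = (w - 1/2) / w. *)
Lemma vertex_charge_ge0 (d y : R) : 1 <= w -> 0 <= d < w -> 0 <= y < w ->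
  0 <= d * multiplier (d - y) + c * y.
Proof.
move=> w1 /andP[d0 dw] /andP[y0 yw].
have c0 : 0 <= c by rewrite /c subr_ge0 invf_le1; lra.
have cy0 : 0 <= c * y by rewrite mulr_ge0.
have [dy|dy] := lerP y d.
  by rewrite addr_ge0 // mulr_ge0 // multiplier_ge0 //; lra.
rewrite -opprB multiplierN multiplier_pos; last lra.
have -> : c * y = (w - 1 / 2) * (y / w) by rewrite /c; field; lra.
rewrite mulrN mulrCA addrC subr_ge0 ler_wpM2l; [|lra|].
  by [].
rewrite ler_pdivrMr; last lra.
rewrite mulrAC ler_pdivlMr; last lra.
nra.
Qed.

(** With z = d - y, the charge is at least z (w - 1/2) / (w - z), a convex function with value 1/2
    at z = 1/2. The first bound is its tangent there; the second holds as the factor of z is at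
    least 1 from 1/2 on. *)
Lemma vertex_charge_ge (d y : R) : 1 <= w -> 0 <= y -> y < d < w ->
  1 / 2 + w / (w - 1 / 2) * (d - y - 1 / 2) <= d * multiplier (d - y) + c * y
  /\ (1 / 2 <= d - y -> d - y <= d * multiplier (d - y) + c * y).
Proof.
move=> w1 y0 /andP[yd dw].
have c0 : 0 <= c by rewrite /c subr_ge0 invf_le1; lra.
have cy0 : 0 <= c * y by rewrite mulr_ge0.
rewrite multiplier_pos; last lra.
set z := d - y.
have zw : 0 < w - z by rewrite /z; lra.
have z0 : 0 < z by rewrite /z; lra.
have q0 : 0 <= (w - 1 / 2) / (w - z) by apply: divr_ge0; lra.
have dz : z * ((w - 1 / 2) / (w - z)) <= d * ((w - 1 / 2) / (w - z)) + c * y.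
  by apply: le_trans (_ : d * ((w - 1 / 2) / (w - z)) <= _); rewrite ?lerDl // ler_wpM2r // /z; lra.
split=> [|z12]; apply: le_trans dz.
  rewrite -subr_ge0.
  have -> : z * ((w - 1 / 2) / (w - z)) - (1 / 2 + w / (w - 1 / 2) * (z - 1 / 2)) =
    w * (z - 1 / 2) ^+ 2 / ((w - z) * (w - 1 / 2)) by field; lra.
  by apply: divr_ge0; [apply: mulr_ge0; [lra|exact: sqr_ge0] | apply: mulr_ge0; lra].
by rewrite ler_peMr ?ler_pdivlMr; lra.
Qed.

(** If only one endpoint has d > y, then d - y >= x / 2 >= 1/2 there. If both do, the tangents add
    up to 1 + q (s - 1) with q in [1, 2]; for s < 1 this is at least 2 s - 1, and 1 <= x
    concludes. *)
Lemma edge_charge (th x d1 y1 d2 y2 : R) : 1 <= w -> 0 <= th <= 1 / 2 -> 1 <= x ->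
  0 <= d1 < w -> 0 <= y1 < w -> 0 <= d2 < w -> 0 <= y2 < w ->
  (1 - th) * x <= d1 + d2 - y1 - y2 ->
  (1 - 2 * th) * x <=
    (d1 * multiplier (d1 - y1) + c * y1) + (d2 * multiplier (d2 - y2) + c * y2).
Proof.
move=> w1 th01 x1 d1w y1w d2w y2w sx.
have g1 := vertex_charge_ge0 w1 d1w y1w; have g2 := vertex_charge_ge0 w1 d2w y2w.
have thx : 0 <= th * x by apply: mulr_ge0; lra.
have xth : x * (1 / 2) <= (1 - th) * x by rewrite mulrC ler_wpM2r //; lra.
have [yd1|yd1] := ltrP y1 d1; have [yd2|yd2] := ltrP y2 d2; first last.
- lra.
- have [_] : _ /\ _ := @vertex_charge_ge d2 y2 w1 ltac:(lra) ltac:(lra).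
  by move=> /(_ ltac:(lra)); lra.
- have [_] : _ /\ _ := @vertex_charge_ge d1 y1 w1 ltac:(lra) ltac:(lra).
  by move=> /(_ ltac:(lra)); lra.
have [h1 _] : _ /\ _ := @vertex_charge_ge d1 y1 w1 ltac:(lra) ltac:(lra).
have [h2 _] : _ /\ _ := @vertex_charge_ge d2 y2 w1 ltac:(lra) ltac:(lra).
apply: le_trans (lerD h1 h2).
have q1 : 1 <= w / (w - 1 / 2) by rewrite ler_pdivlMr; lra.
have q2 : w / (w - 1 / 2) <= 2 by rewrite ler_pdivrMr; lra.
set q := w / (w - 1 / 2) in q1 q2 *.
have -> : 1 / 2 + q * (d1 - y1 - 1 / 2) + (1 / 2 + q * (d2 - y2 - 1 / 2)) =
  1 + q * (d1 + d2 - y1 - y2 - 1) by field.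
set s := d1 + d2 - y1 - y2 in sx *.
have [s1|s1] := lerP 1 s.
  have : 1 * (s - 1) <= q * (s - 1) by rewrite ler_wpM2r; lra.
  lra.
have : 2 * (s - 1) <= q * (s - 1) by rewrite ler_wnM2r; lra.
lra.
Qed.

End Multiplier.

(** The vertex charges, weighted by capacity, dominate the deficits because [J] uses v at most [c v]
    times. Rewritten as a sum over [I], their multiplier part is nonpositive on easy edges and at
    most m i * 2 w / xi <= 1 on hard ones. *)
Lemma gap_le_cover (R : realFieldType) (X I J : finType) (w xi th : R)
    (c d y : X -> R) (m : I -> R) (l r : I -> X) (hard : pred I)
    (P : pred J) (a b : J -> X) (x : J -> R) :
  1 <= w -> 0 < xi -> 0 <= th <= 1 / 2 ->
  (forall v, 0 <= c v) ->
  (forall v, 0 <= d v <= w - xi) -> (forall v, 0 <= y v <= w - xi) ->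
  (forall i, 0 <= m i) ->
  (forall v, \sum_(i | l i == v) m i + \sum_(i | r i == v) m i = c v * d v) ->
  (forall i, ~~ hard i -> 0 < m i -> d (l i) + d (r i) <= y (l i) + y (r i)) ->
  (forall i, hard i -> m i <= xi / (2 * w)) ->
  (forall v, \sum_(j | P j && (a j == v)) 1 + \sum_(j | P j && (b j == v)) 1 <= c v) ->
  (forall j, P j -> 1 <= x j) ->
  (forall j, P j -> (1 - th) * x j <= d (a j) + d (b j) - y (a j) - y (b j)) ->
  (1 - 2 * th) * \sum_(j | P j) x j <=
    (1 - (2 * w)^-1) * \sum_v c v * y v + \sum_(i | hard i) 1.
Proof.
move=> w1 xi0 th01 c0 dP yP m0 mE easy_le hard_le load x1 gap.
pose f v := multiplier w (d v - y v).
pose g v := d v * f v + (1 - (2 * w)^-1) * y v.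
have dw v : 0 <= d v < w by have := dP v; lra.
have yw v : 0 <= y v < w by have := yP v; lra.
have g0 v : 0 <= g v by apply: vertex_charge_ge0.
have side (e : J -> X) : \sum_(j | P j) g (e j) = \sum_v g v * \sum_(j | P j && (e j == v)) 1.
  rewrite (partition_big e predT) //=; apply: eq_bigr => v _.
  by rewrite big_distrr /=; apply: eq_bigr => j /andP[_ /eqP ->]; rewrite mulr1.
apply: (@le_trans _ _ (\sum_v c v * g v)).
  apply: (@le_trans _ _ (\sum_(j | P j) (g (a j) + g (b j)))).
    rewrite big_distrr /=; apply: ler_sum => j Pj.
    by apply: (edge_charge w1 th01) => //; [exact: x1|exact: gap].
  rewrite big_split /= !side -big_split; apply: ler_sum => v _ /=.
  by rewrite -mulrDr mulrC ler_wpM2r.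
have sideI (e : I -> X) : \sum_v f v * \sum_(i | e i == v) m i = \sum_i m i * f (e i).
  rewrite [RHS](partition_big e predT) //=; apply: eq_bigr => v _.
  by rewrite big_distrr /=; apply: eq_bigr => i /eqP ->; rewrite mulrC.
have -> : \sum_v c v * g v = \sum_i m i * (f (l i) + f (r i)) + (1 - (2 * w)^-1) * \sum_v c v * y v.
  under [in RHS]eq_bigr do rewrite mulrDr.
  rewrite [in RHS]big_split /= -!sideI -big_split /= big_distrr -big_split /=.
  by apply: eq_bigr => v _; rewrite -mulrDr mE /g; ring.
rewrite addrC lerD2l big_mkcond /= [X in _ <= X]big_mkcond /=; apply: ler_sum => i _.
have dyw v : `|d v - y v| <= w - xi by rewrite ler_norml; have := dP v; have := yP v; lra.
have dyw' v : `|d v - y v| < w by apply: le_lt_trans (dyw v) _; lra.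
case: ifPn => [hi|ei].
  have fw v : f v <= w / xi by apply: multiplier_le.
  apply: (@le_trans _ _ (m i * (w / xi + w / xi))); first by rewrite ler_wpM2l ?lerD.
  have : m i * (w / xi + w / xi) <= xi / (2 * w) * (w / xi + w / xi).
    by rewrite ler_wpM2r ?hard_le // addr_ge0 // divr_ge0; lra.
  move/le_trans; apply; rewrite le_eqVlt; apply/orP; left; apply/eqP; field; lra.
have [->|mi] := eqVneq (m i) 0; first by rewrite mul0r.
have mi0 : 0 < m i by rewrite lt_def mi m0.
rewrite pmulr_rle0 //; apply: multiplier_le0D => //.
by have := easy_le i ei mi0; lra.
Qed.

(** * Random orientation *)

(** Distinct signs are orthogonal: flipping one coin negates their product. *)
Lemma rademacher_second_moment (R : realFieldType) (T : finType) (a : T -> R) :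
  \sum_(s : {ffun T -> bool}) (\sum_x a x * (-1) ^+ s x) ^+ 2
    = #|{: {ffun T -> bool}}|%:R * \sum_x a x ^+ 2.
Proof.
pose flip x (s : {ffun T -> bool}) := [ffun y => if y == x then ~~ s y else s y].
have flipK x : involutive (flip x).
  by move=> s; apply/ffunP => y; rewrite !ffunE; case: eqP => // _; rewrite negbK.
have orth x y : x != y -> \sum_(s : {ffun T -> bool}) (-1) ^+ s x * (-1) ^+ s y = 0 :> R.
  move=> xy; set S := \sum_s _.
  suff : S = - S by move=> E; lra.
  rewrite {1}/S (reindex_inj (inv_inj (flipK x))) -sumrN; apply: eq_bigr => s _.
  by rewrite !ffunE eqxx eq_sym (negPf xy) signrN mulNr.
transitivity (\sum_x \sum_y a x * a y * \sum_(s : {ffun T -> bool}) (-1) ^+ s x * (-1) ^+ s y).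
  under eq_bigr => s _.
    rewrite expr2 big_distrl /=; under eq_bigr do rewrite big_distrr /=.
    over.
  rewrite exchange_big /=; apply: eq_bigr => x _.
  rewrite exchange_big /=; apply: eq_bigr => y _.
  by rewrite big_distrr /=; apply: eq_bigr => s _; ring.
rewrite big_distrr; apply: eq_bigr => x _ /=.
rewrite (bigD1 x) //= [X in _ + X]big1 => [|y yx]; last by rewrite orth ?mulr0 // eq_sym.
rewrite addr0 (eq_bigr (fun=> 1)) => [|s _]; last by rewrite -signr_addb addbb.
by rewrite sumr_const; ring.
Qed.

Lemma exists_le_mean (R : realFieldType) (T : finType) (F : T -> R) (c : R) :
  (0 < #|T|)%N -> \sum_x F x <= #|T|%:R * c -> exists x, F x <= c.
Proof.
move=> /card_gt0P[x0 _] sumF.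
have [/existsP//|/existsPn H] := boolP [exists x, F x <= c].
suff : #|T|%:R * c < \sum_x F x by rewrite ltNge sumF.
rewrite mulr_natl -sumr_const; apply: ltr_sum => [|x _]; last by rewrite ltNge H.
by apply/hasP; exists x0 => //; rewrite mem_index_enum.
Qed.

Section RandomOrientation.
Variables (R : realFieldType) (V J : finType) (b : V -> nat) (p q : J -> V).
Hypothesis b_gt0 : forall v, (0 < b v)%N.
Hypothesis load : forall v, (#|[set j | p j == v]| + #|[set j | q j == v]| <= b v)%N.

(* The coins: the edge j is oriented from p j to q j if its coin is true; the
   capacity of v which no edge uses goes to one side, as the coin of v says. *)
Definition coins := {ffun J + V -> bool}.

Definition rest v := (b v - (#|[set j | p j == v]| + #|[set j | q j == v]|))%N.

Definition capL (s : coins) v := (#|[set j | (p j == v) && s (inl j)]|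
   + #|[set j | (q j == v) && ~~ s (inl j)]| + s (inr v) * rest v)%N.
Definition capR (s : coins) v := (#|[set j | (p j == v) && ~~ s (inl j)]|
   + #|[set j | (q j == v) && s (inl j)]| + ~~ s (inr v) * rest v)%N.

Lemma capLR s v : (capL s v + capR s v = b v)%N.
Proof.
have split_card (P Q : pred J) :
    (#|[set j | P j && Q j]| + #|[set j | P j && ~~ Q j]| = #|[set j | P j]|)%N.
  rewrite -[RHS](cardsID [set j | Q j]); congr (_ + _)%N.
    by apply: eq_card => j; rewrite !inE.
  by apply: eq_card => j; rewrite !inE andbC.
have := split_card (fun j => p j == v) (fun j => s (inl j)).
have := split_card (fun j => q j == v) (fun j => s (inl j)).
have := load v; rewrite /capL /capR /rest; case: (s (inr v)) => /=; lia.
Qed.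

Definition bias (s : coins) v : R := ((capL s v)%:R - (capR s v)%:R) / (b v)%:R.

(** The biases behave as if uncorrelated with variance at most 1: an edge coin moves its endpoints
    in opposite directions, so for nonnegative [c] the cross terms help. At one vertex, deg + rest^2
    <= (deg + rest)^2 = b^2. *)
Lemma sum_bias_sqr (c : V -> R) : (forall v, 0 <= c v) ->
  \sum_s (\sum_v c v * bias s v) ^+ 2 <= #|{: coins}|%:R * \sum_v c v ^+ 2.
Proof.
move=> c0; pose al v := c v / (b v)%:R.
have al0 v : 0 <= al v by rewrite divr_ge0.
pose a (x : J + V) : R :=
  match x with inl j => al (q j) - al (p j) | inr v => - (al v * (rest v)%:R) end.
have biasE s : \sum_v c v * bias s v = \sum_x a x * (-1) ^+ s x.
  rewrite big_sumType /=.
  pose cnt v : R := \sum_(j | q j == v) (-1) ^+ s (inl j) - \sum_(j | p j == v) (-1) ^+ s (inl j)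
     - (rest v)%:R * (-1) ^+ s (inr v).
  have cardE (e : J -> V) v :
     \sum_(j | e j == v) (-1) ^+ s (inl j) =
      (#|[set j | (e j == v) && ~~ s (inl j)]|)%:R - (#|[set j | (e j == v) && s (inl j)]|)%:R :> R.
    rewrite -!sum1_card !natr_sum.
    rewrite [X in _ = X - _](eq_bigl (fun j => (e j == v) && ~~ s (inl j))) => [|j]; last by rewrite inE.
    rewrite [X in _ = _ - X](eq_bigl (fun j => (e j == v) && s (inl j))) => [|j]; last by rewrite inE.
    rewrite !big_mkcondr -sumrB; apply: eq_bigr => j _.
    by case: (s (inl j)); rewrite ?expr1 ?expr0 ?subr0 ?sub0r.
  have cntE v : (capL s v)%:R - (capR s v)%:R = cnt v.
    rewrite /cnt !cardE /capL /capR !natrD !natrM.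
    by case: (s (inr v)) => /=; rewrite ?expr1 ?expr0; ring.
  have side (e : J -> V) :
     \sum_v al v * \sum_(j | e j == v) (-1) ^+ s (inl j) = \sum_j al (e j) * (-1) ^+ s (inl j).
    rewrite [RHS](partition_big e predT) //=; apply: eq_bigr => v _.
    by rewrite big_distrr /=; apply: eq_bigr => j /eqP ->.
  under [X in _ = X + _]eq_bigr do rewrite mulrBl.
  rewrite sumrB -!side -sumrB -big_split; apply: eq_bigr => v _ /=.
  by rewrite /bias cntE /cnt /al; ring.
under eq_bigr do rewrite biasE.
rewrite rademacher_second_moment ler_wpM2l // big_sumType /=.
apply: (@le_trans _ _ (\sum_j (al (p j) ^+ 2 + al (q j) ^+ 2) + \sum_v al v ^+ 2 * (rest v)%:R ^+ 2)).
  apply: lerD; last by apply: ler_sum => v _; rewrite sqrrN exprMn.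
  apply: ler_sum => j _ /=.
  by rewrite sqrrB mulr2n; have : 0 <= al (q j) * al (p j) := mulr_ge0 (al0 _) (al0 _); lra.
have side (e : J -> V) :
   \sum_j al (e j) ^+ 2 = \sum_v al v ^+ 2 * (#|[set j | e j == v]|)%:R.
  rewrite (partition_big e predT) //=; apply: eq_bigr => v _.
  rewrite -sum1_card natr_sum big_distrr /=; apply: eq_big => [j|j /eqP ->]; first by rewrite inE.
  by rewrite mulr1.
rewrite big_split /= !side -!big_split; apply: ler_sum => v _ /=.
rewrite -!mulrDr -natrX -!natrD.
have -> : c v ^+ 2 = al v ^+ 2 * ((b v) ^ 2)%:R.
  by rewrite natrX -exprMn /al divfK // pnatr_eq0 -lt0n.
by rewrite ler_wpM2l ?sqr_ge0 // ler_nat; have := load v; rewrite /rest; nia.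
Qed.

End RandomOrientation.

(** * Degrees on the two sides of the split capacities *)

Section SideDegree.
Variables (R : realFieldType) (V I : finType) (b own oth : V -> nat) (be : R).
Variables (e e' : I -> V) (g g' : pred V).

(** The product form lets one mass serve both sides: dividing the load of a copy by its capacity
    [own] leaves 2 / (be * b) times the opposite shares [oth / b], whose typical value 1/2 gives
    back the unsplit degree. The factors [g] and [g'] drop badly split vertices, so that the upper
    bound holds everywhere. *)
Definition mass (i : I) : R :=
  2 / be * ((own (e i))%:R / (b (e i))%:R) * ((oth (e' i))%:R / (b (e' i))%:R)
    * (g (e i))%:R * (g' (e' i))%:R.

Definition side_degree (v : V) : R := (\sum_(i | e i == v) mass i) / (own v)%:R.

(** The degree before any vertex is dropped; [bad_share] bounds what dropping neighbours removes. *)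
Definition mean_share (v : V) : R :=
  (\sum_(i | e i == v) 2 * ((oth (e' i))%:R / (b (e' i))%:R)) / (be * (b v)%:R).

Definition bad_share (v : V) : R :=
  (\sum_(i | e i == v) 2 * (~~ g' (e' i))%:R) / (be * (b v)%:R).

Lemma mass_ge0 i : 0 <= be -> 0 <= mass i.
Proof. by move=> be0; rewrite /mass !mulr_ge0 ?invr_ge0 ?ler0n. Qed.

Lemma sum_mass v : \sum_(i | e i == v) mass i = (own v)%:R * side_degree v.
Proof.
have [ov|ov] := eqVneq (own v)%:R (0 : R); last by rewrite mulrC divfK.
by rewrite ov mul0r big1 // => i /eqP ei; rewrite /mass ei ov mul0r mulr0 !mul0r.
Qed.

Lemma side_degree_ge0 v : 0 <= be -> 0 <= side_degree v.
Proof. by move=> be0; rewrite divr_ge0 // sumr_ge0 // => i _; apply: mass_ge0. Qed.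

Lemma side_degreeE v : own v != 0%N -> side_degree v =
  (g v)%:R * ((\sum_(i | e i == v) 2 * ((oth (e' i))%:R / (b (e' i))%:R) * (g' (e' i))%:R)
    / (be * (b v)%:R)).
Proof.
move=> ov; have ov' : (own v)%:R != 0 :> R by rewrite pnatr_eq0.
rewrite /side_degree !big_distrl /= big_distrr; apply: eq_bigr => i /eqP ei.
rewrite /mass ei /= invfM; move: be^-1 (b v)%:R^-1 (_ / (b (e' i))%:R) => x y z; by field.
Qed.

Lemma side_degree_le v : 0 <= be -> side_degree v <= (g v)%:R * mean_share v.
Proof.
move=> be0; have ms0 : 0 <= mean_share v.
  by rewrite divr_ge0 ?mulr_ge0 // sumr_ge0 // => i _; rewrite !mulr_ge0 ?invr_ge0.
have [ov|ov] := eqVneq (own v) 0%N; first by rewrite /side_degree ov invr0 mulr0 mulr_ge0.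
rewrite side_degreeE // ler_wpM2l // ler_wpM2r ?invr_ge0 ?mulr_ge0 //.
apply: ler_sum => i _; case: (g' _); rewrite ?mulr1 ?mulr0 //.
by rewrite !mulr_ge0 ?invr_ge0.
Qed.

Lemma side_degree_ge v : 0 <= be -> (forall v, oth v <= b v)%N -> own v != 0%N -> g v ->
  mean_share v - bad_share v <= side_degree v.
Proof.
move=> be0 ob ov gv; rewrite side_degreeE // gv mul1r /mean_share /bad_share -mulrBl.
rewrite ler_wpM2r ?invr_ge0 ?mulr_ge0 // -sumrB; apply: ler_sum => i _.
have le1 : (oth (e' i))%:R / (b (e' i))%:R <= 1 :> R.
  have [->|bi] := eqVneq (b (e' i)) 0%N; first by rewrite invr0 mulr0.
  by rewrite ler_pdivrMr ?ltr0n ?lt0n // mul1r ler_nat.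
by case: (g' _) => /=; rewrite ?mulr1 ?mulr0; lra.
Qed.

End SideDegree.

(** * Concentration of the split degrees *)

Section Orientation.
Variables (R : realFieldType) (V I J : finType) (b : V -> nat) (p q : J -> V).
Variables (be eta D : R).
Hypothesis b_gt0 : forall v, (0 < b v)%N.
Hypothesis load : forall v, (#|[set j | p j == v]| + #|[set j | q j == v]| <= b v)%N.
Hypothesis be_gt0 : 0 < be.
Hypothesis eta_gt0 : 0 < eta.

Let bias := @bias R V J b p q.
Let N : R := #|{: coins V J}|%:R.

Let bR_gt0 v : 0 < (b v)%:R :> R. Proof. by rewrite ltr0n. Qed.

Definition degree (e : I -> V) (v : V) : R := (#|[set i | e i == v]|)%:R / (be * (b v)%:R).

Lemma degreeE e v : degree e v = (\sum_(i | e i == v) 1) / (be * (b v)%:R).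
Proof.
by rewrite /degree -sum1_card natr_sum; congr (_ / _); apply: eq_bigl => i; rewrite inE.
Qed.

Lemma degree_ge0 e v : 0 <= degree e v.
Proof. by rewrite divr_ge0 // mulr_ge0 // ltW. Qed.

(** As capL + capR = b, a share 2 * oth / b is 1 plus or minus a bias; so this is, up to sign, the
    difference of [mean_share] and [degree]. *)
Definition deviation (e e' : I -> V) (s : coins V J) (v : V) : R :=
  (\sum_(i | e i == v) bias s (e' i)) / (be * (b v)%:R).

(** The coefficient of a neighbour is its multiplicity over be * b v, at most 1 / be by the bound on
    parallel edges; hence the squares sum to at most degree / be. *)
Lemma sum_deviation_sqr e e' v :
  (forall v', #|[set i | (e i == v) && (e' i == v')]| <= b v)%N ->
  \sum_s deviation e e' s v ^+ 2 <= N * (degree e v / be).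
Proof.
move=> mult; pose c v' : R := (#|[set i | (e i == v) && (e' i == v')]|)%:R / (be * (b v)%:R).
have bb0 : 0 < be * (b v)%:R by rewrite mulr_gt0.
have c0 v' : 0 <= c v' by rewrite divr_ge0 // ltW.
have devE s : deviation e e' s v = \sum_v' c v' * bias s v'.
  rewrite /deviation (partition_big e' predT) //= big_distrl; apply: eq_bigr => v' _ /=.
  rewrite /c -sum1_card natr_sum !big_distrl /=; apply: eq_big => [i|i /andP[_ /eqP ->]].
    by rewrite inE.
  by rewrite mulrC mul1r.
under eq_bigr do rewrite devE.
apply: le_trans (sum_bias_sqr b_gt0 load c0) _.
rewrite ler_wpM2l // degreeE (partition_big e' predT) //= 2!big_distrl /=.
apply: ler_sum => v' _; have -> : (\sum_(i | (e i == v) && (e' i == v')) 1) / (be * (b v)%:R) = c v' :> R.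
  rewrite /c -sum1_card natr_sum; congr (_ / _).
  by apply: eq_bigl => i; rewrite inE.
rewrite expr2 ler_wpM2l // /c ler_pdivrMr // mulrA mulVf ?gt_eqF // mul1r ler_nat.
exact: mult.
Qed.

Definition good (e e' : I -> V) (s : coins V J) : pred V := fun v => `|deviation e e' s v| <= eta.

(** Chebyshev's inequality, before averaging over the coins. *)
Lemma bad_le e e' s v : (~~ good e e' s v)%:R <= deviation e e' s v ^+ 2 / eta ^+ 2.
Proof.
rewrite /good; case: (lerP `|deviation e e' s v|) => [_|dev] /=.
  by rewrite divr_ge0 ?sqr_ge0.
by rewrite ler_pdivlMr ?exprn_gt0 // mul1r -[leRHS]real_normK ?num_real // ler_pXn2r ?nnegrE // ltW.
Qed.

Definition loss (e e' : I -> V) (s : coins V J) (v : V) : R :=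
  (\sum_(i | e i == v) 2 * (~~ good e' e s (e' i))%:R) / (be * (b v)%:R).

Lemma sum_loss e e' v : (forall v v', #|[set i | (e i == v) && (e' i == v')]| <= b v')%N ->
  (forall v, degree e v <= D) -> (forall v, degree e' v <= D) ->
  \sum_s loss e e' s v <= N * (2 * D ^+ 2 / (be * eta ^+ 2)).
Proof.
move=> mult eD e'D.
have bad v' : \sum_s (~~ good e' e s v')%:R <= N * (D / (be * eta ^+ 2)).
  apply: le_trans (ler_sum _ (fun s _ => bad_le e' e s v')) _.
  rewrite -mulr_suml ler_pdivrMr ?exprn_gt0 //.
  apply: le_trans (@sum_deviation_sqr e' e v' _) _ => [u|].
    by apply: leq_trans (mult u v'); apply/subset_leq_card/subsetP => i; rewrite !inE andbC.
  have -> : N * (D / (be * eta ^+ 2)) * eta ^+ 2 = N * (D / be).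
    by field; rewrite !gt_eqF.
  by rewrite ler_wpM2l // ler_wpM2r ?invr_ge0 // ltW.
have D0 : 0 <= D := le_trans (degree_ge0 e v) (eD v).
rewrite /loss -mulr_suml exchange_big /=.
apply: (@le_trans _ _ ((\sum_(i | e i == v) 2 * (N * (D / (be * eta ^+ 2)))) / (be * (b v)%:R))).
  rewrite ler_wpM2r ?invr_ge0 ?mulr_ge0 ?(ltW be_gt0) //.
  by apply: ler_sum => i _; rewrite -mulr_sumr ler_wpM2l.
have -> : (\sum_(i | e i == v) 2 * (N * (D / (be * eta ^+ 2)))) / (be * (b v)%:R) =
    degree e v * (2 * (N * (D / (be * eta ^+ 2)))).
  rewrite degreeE mulrAC; congr (_ / _); rewrite big_distrl /=.
  by apply: eq_bigr => i _; rewrite mul1r.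
have -> : N * (2 * D ^+ 2 / (be * eta ^+ 2)) = D * (2 * (N * (D / (be * eta ^+ 2)))).
  by field; rewrite !gt_eqF.
by rewrite ler_wpM2r // !mulr_ge0 // ?invr_ge0 ?mulr_ge0 ?exprn_ge0 // ltW.
Qed.

(* At a vertex of damage less than 1, both kept degrees split evenly up to eta,
   and edges to badly split vertices account for at most eta of them. *)
Definition damage (src dst : I -> V) (s : coins V J) (v : V) : R :=
  deviation src dst s v ^+ 2 / eta ^+ 2 + deviation dst src s v ^+ 2 / eta ^+ 2
    + loss src dst s v / eta + loss dst src s v / eta.

(** Twice a bound on the mean damage of a vertex, as an edge has two endpoints: each squared
    deviation contributes D / (be * eta^2) and each loss 2 * D^2 / (be * eta^3). *)
Definition damage_rate : R := 4 * D / (be * eta ^+ 2) * (1 + 2 * D / eta).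

Lemma exists_coins (src dst : I -> V) (l : J -> R) :
  (forall v v', #|[set i | (src i == v) && (dst i == v')]| <= minn (b v) (b v'))%N ->
  (forall v, degree src v <= D) -> (forall v, degree dst v <= D) ->
  (forall j, 0 <= l j) ->
  exists s, \sum_j l j * (damage src dst s (p j) + damage src dst s (q j))
    <= damage_rate * \sum_j l j.
Proof.
move=> mult srcD dstD l0.
have multl e e' : (e = src /\ e' = dst) \/ (e = dst /\ e' = src) -> forall v v',
    (#|[set i | (e i == v) && (e' i == v')]| <= minn (b v) (b v'))%N.
  move=> [[-> ->]|[-> ->]] v v' //; rewrite minnC; apply: leq_trans (mult v' v).
  by apply/subset_leq_card/subsetP => i; rewrite !inE andbC.
have damageE v : \sum_s damage src dst s v <= N * (damage_rate / 2).
  have dev e e' : (e = src /\ e' = dst) \/ (e = dst /\ e' = src) -> degree e v <= D ->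
      \sum_s deviation e e' s v ^+ 2 / eta ^+ 2 <= N * (D / (be * eta ^+ 2)).
    move=> ee eD; rewrite -mulr_suml ler_pdivrMr ?exprn_gt0 //.
    apply: le_trans (@sum_deviation_sqr e e' v _) _ => [u|].
      by apply: leq_trans (multl _ _ ee v u) _; exact: geq_minl.
    have -> : N * (D / (be * eta ^+ 2)) * eta ^+ 2 = N * (D / be).
      by field; rewrite !gt_eqF.
    by rewrite ler_wpM2l // ler_wpM2r ?invr_ge0 // ltW.
  have los e e' : (e = src /\ e' = dst) \/ (e = dst /\ e' = src) ->
      (forall v, degree e v <= D) -> (forall v, degree e' v <= D) ->
      \sum_s loss e e' s v / eta <= N * (2 * D ^+ 2 / (be * eta ^+ 3)).
    move=> ee eD e'D; rewrite -mulr_suml ler_pdivrMr //.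
    apply: le_trans (@sum_loss e e' v _ eD e'D) _ => [u u'|].
      by apply: leq_trans (multl _ _ ee u u') _; exact: geq_minr.
    rewrite le_eqVlt; apply/orP; left; apply/eqP; field; rewrite !gt_eqF //.
  rewrite /damage !big_split /=.
  have := lerD (lerD (lerD (dev src dst (or_introl (conj erefl erefl)) (srcD v))
    (dev dst src (or_intror (conj erefl erefl)) (dstD v)))
    (los src dst (or_introl (conj erefl erefl)) srcD dstD))
    (los dst src (or_intror (conj erefl erefl)) dstD srcD).
  move/le_trans; apply; rewrite le_eqVlt; apply/orP; left; apply/eqP.
  rewrite /damage_rate; field; rewrite !gt_eqF //.
apply: exists_le_mean; first by apply/card_gt0P; exists [ffun=> true].
rewrite exchange_big /= -/N big_distrr big_distrr /=; apply: ler_sum => j _.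
have -> : N * (damage_rate * l j) = l j * (N * damage_rate) by ring.
rewrite -mulr_sumr big_split /= ler_wpM2l //.
by have := damageE (p j); have := damageE (q j); lra.
Qed.

End Orientation.

(** * Approximation by bounded-degree subgraphs *)

(** [S] is the vertex part of the dual cost, [Z1] and [Z2] its edge parts on [J] and [I], [X] the
    total deficit, [H] the number of hard edges, [B] the weight of the unstored edges with damaged
    endpoints, [G] the rest of the target weight [L], and [T] the primal value. *)
Lemma combine_bounds (R : realFieldType) (th K ci S Z1 Z2 X H G B L Y T : R) :
  0 <= 1 - ci -> 0 <= th <= 1 / 2 -> 0 <= Z1 -> 0 <= S -> 0 <= Z2 ->
  (1 - 2 * th) * X <= (1 - ci) * S + H -> H <= Z2 -> G <= Y + Z1 + X -> Y <= S ->
  S + Z1 + Z2 <= T -> B <= K * L -> L = G + B ->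
  (1 - 2 * th) * (1 - K) * L <= (2 - ci) * T.
Proof.
move=> ci1 th01 Z10 S0 Z20 key HZ GYZ YS SZT BK LGB.
have h1 : (1 - 2 * th) * ((1 - K) * L) <= (1 - 2 * th) * (S + Z1 + X).
  by rewrite ler_wpM2l; lra.
have h2 : (1 - ci) * S <= (1 - ci) * T by rewrite ler_wpM2l; lra.
have : 0 <= th * (S + Z1) by rewrite mulr_ge0; lra.
by rewrite -mulrA; lra.
Qed.

(** [I] indexes the kept edges, [J] the matching to be approximated, [gap] its edges that are not
    stored. The capacities of the two copies of v add up to [b v], so a bipartite b-matching of the
    copies is one of the original. The oriented [J] respects these capacities too, and the duals of
    the available edges are tested against it. *)
Lemma robust_bmatching (R : realFieldType) (V I J : finType) (b : V -> nat)
    (src dst : I -> V) (k : I -> nat) (p q : J -> V) (l : J -> nat)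
    (gap : pred J) (W : nat) (be eta xi th : R) :
  (forall v, 0 < b v)%N ->
  (forall v, #|[set j | p j == v]| + #|[set j | q j == v]| <= b v)%N ->
  (forall v v', #|[set i | (src i == v) && (dst i == v')]| <= minn (b v) (b v'))%N ->
  (forall i, 1 <= k i <= W)%N -> (forall j, 1 <= l j <= W)%N -> (0 < W)%N ->
  0 < be -> 0 < eta -> 0 < xi ->
  2 / be <= xi / (2 * (W%:R + xi)) ->
  2 / be + 4 * eta + W%:R * (2 / be + 2 * eta) <= th <= 1 / 2 ->
  (forall i, degree b be src (src i) + degree b be dst (dst i) <= (k i)%:R + 2 / be) ->
  (forall j, gap j ->
     (l j)%:R - 2 / be <= degree b be src (p j) + degree b be dst (q j) /\
     (l j)%:R - 2 / be <= degree b be src (q j) + degree b be dst (p j)) ->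
  exists (A : {set I}) (B : {set J}),
  [/\ forall j, j \in B -> ~~ gap j,
      forall v, (#|[set i in A | src i == v]| + #|[set i in A | dst i == v]|
        + #|[set j in B | p j == v]| + #|[set j in B | q j == v]| <= b v)%N &
      (1 - 2 * th) * (1 - damage_rate be eta (W%:R + 2 / be)) * (\sum_j l j)%:R <=
      (2 - (2 * (W%:R + xi))^-1) * (\sum_(i in A) k i + \sum_(j in B) l j)%:R].
Proof.
move=> b0 load mult kW lW W0 be0 eta0 xi0 be_xi thP Hle Hgap.
have W1 : 1 <= W%:R :> R by rewrite ler1n.
have ibe0 : 0 < 2 / be by apply: divr_gt0.
have Wd0 : 0 <= W%:R * (2 / be + 2 * eta) by rewrite mulr_ge0 //; lra.
set D : R := W%:R + 2 / be.
have degD (e : I -> V) : (forall i, degree b be e (e i) <= D) -> forall v, degree b be e v <= D.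
  move=> eD v; have [i /eqP <-|noi] := pickP (fun i => e i == v); first exact: eD.
  rewrite /degree (_ : [set i | e i == v] = set0) ?cards0 ?mul0r; last first.
    by apply/setP => i; rewrite !inE noi.
  by rewrite /D; lra.
have kR i : (k i)%:R <= W%:R :> R by rewrite ler_nat; case/andP: (kW i).
have deg0 e v := @degree_ge0 R V I b be be0 e v.
have srcD := degD src (fun i => ltac:(have := Hle i; have := kR i; have := deg0 dst (dst i); rewrite /D; lra)).
have dstD := degD dst (fun i => ltac:(have := Hle i; have := kR i; have := deg0 src (src i); rewrite /D; lra)).
have th01 : 0 <= th <= 1 / 2 by have := thP; lra.
have [s sP] := exists_coins b0 load be0 eta0 mult srcD dstD (fun j => ler0n R (l j)).
set K := damage_rate be eta D in sP *.
pose le (j : J) := if s (inl j) then p j else q j.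
pose re (j : J) := if s (inl j) then q j else p j.
pose cL := capL b p q s; pose cR := capR b p q s.
pose gL := good b p q be eta src dst s; pose gR := good b p q be eta dst src s.
have leC (P : pred J) v : (#|[set j | P j && (le j == v)]| <= cL v)%N.
  rewrite /cL /capL -cardsUI; apply: leq_trans (leq_addr _ _); apply: leq_trans (leq_addr _ _).
  apply/subset_leq_card/subsetP => j; rewrite !inE /le; case: (s (inl j)) => /andP[_ ->] //=.
  by rewrite orbT.
have reC (P : pred J) v : (#|[set j | P j && (re j == v)]| <= cR v)%N.
  rewrite /cR /capR -cardsUI; apply: leq_trans (leq_addr _ _); apply: leq_trans (leq_addr _ _).
  apply/subset_leq_card/subsetP => j; rewrite !inE /re; case: (s (inl j)) => /andP[_ ->] //=.
  by rewrite orbT.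
pose E : finType := (I + J)%type.
pose el (e : E) := match e with inl i => src i | inr j => le j end.
pose er (e : E) := match e with inl i => dst i | inr j => re j end.
pose av (e : E) := match e with inl _ => true | inr j => ~~ gap j end.
pose ke (e : E) := match e with inl i => k i | inr j => l j end.
have keW e : (ke e <= W)%N by case: e => [i|j]; [case/andP: (kW i)|case/andP: (lW j)].
have [S [yL [yR [z [[Sav Sload] yW dual opt]]]]] :=
  bipartite_bmatching_dual el er cL cR av keW.
exists [set i | inl i \in S], [set j | inr j \in S]; split.
- by move=> j; rewrite inE => /Sav.
- move=> v; rewrite -(capLR load s v) -/cL -/cR.
  have [Sl Sr] := Sload v.
  have cardE (f : E -> V) : (#|[set e in S | f e == v]| =
      #|[set i in [set i | inl i \in S] | f (inl i) == v]|
      + #|[set j in [set j | inr j \in S] | f (inr j) == v]|)%N.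
    rewrite -!sum1_card (eq_bigl (fun e => (e \in S) && (f e == v))) => [|e]; last by rewrite inE.
    by rewrite big_sumType /=; congr (_ + _)%N; apply: eq_bigl => e; rewrite !inE.
  move: Sl Sr; rewrite !cardE /=; set A := [set i | inl i \in S]; set B := [set j | inr j \in S].
  have cardB (Q : pred J) : #|[set j in B | Q j]| = (\sum_(j in B) Q j)%N.
    rewrite -sum1_card (eq_bigl (fun j => (j \in B) && Q j)) => [|j]; last by rewrite inE.
    by rewrite big_mkcondr; apply: eq_bigr => j _; case: (Q j).
  have : (#|[set j in B | p j == v]| + #|[set j in B | q j == v]| =
      #|[set j in B | le j == v]| + #|[set j in B | re j == v]|)%N.
    rewrite !cardB -!big_split; apply: eq_bigr => j _ /=.
    by rewrite /le /re; case: (s (inl j)) => //; rewrite addnC.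
  by clear; lia.
have -> : (\sum_(i in [set i | inl i \in S]) k i + \sum_(j in [set j | inr j \in S]) l j
   = \sum_(e in S) ke e)%N.
  rewrite big_sumType /=; congr (_ + _)%N; apply: eq_bigl => i; rewrite inE //.
set T : nat := (\sum_(e in S) ke e)%N in opt *.
pose dL v := side_degree b cL cR be src dst gL gR v.
pose dR v := side_degree b cR cL be dst src gR gL v.
pose ok j := damage b p q be eta src dst s (p j) + damage b p q be eta src dst s (q j) < 1.
have gLle v : mean_share b cR be src dst v = degree b be src v - deviation b p q be src dst s v.
  rewrite degreeE /deviation -mulrBl -sumrB; congr (_ / _); apply: eq_bigr => i _.
  rewrite /bias -/cL -/cR; have := capLR load s (dst i); rewrite -/cL -/cR => bE.
  have : (b (dst i))%:R != 0 :> R by rewrite pnatr_eq0 -lt0n.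
  by rewrite -bE natrD; move: (cL _)%:R (cR _)%:R => u v' uv; field.
have gRle v : mean_share b cL be dst src v = degree b be dst v + deviation b p q be dst src s v.
  rewrite degreeE /deviation -mulrDl -big_split; congr (_ / _); apply: eq_bigr => i _ /=.
  rewrite /bias -/cL -/cR; have := capLR load s (src i); rewrite -/cL -/cR => bE.
  have : (b (src i))%:R != 0 :> R by rewrite pnatr_eq0 -lt0n.
  by rewrite -bE natrD; move: (cL _)%:R (cR _)%:R => u v' uv; field.
have dLle v : dL v <= (gL v)%:R * (degree b be src v + eta).
  apply: le_trans (side_degree_le _ _ _ _ _ _ _ _ (ltW be0)) _.
  rewrite gLle; case: (boolP (gL v)) => [|_]; last by rewrite !mul0r.
  by rewrite /gL /good ler_norml !mul1r; lra.
have dRle v : dR v <= (gR v)%:R * (degree b be dst v + eta).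
  apply: le_trans (side_degree_le _ _ _ _ _ _ _ _ (ltW be0)) _.
  rewrite gRle; case: (boolP (gR v)) => [|_]; last by rewrite !mul0r.
  by rewrite /gR /good ler_norml !mul1r; lra.
have [lossL0 lossR0] : (forall v, 0 <= loss b p q be eta src dst s v) /\
    (forall v, 0 <= loss b p q be eta dst src s v).
  by split=> v; rewrite divr_ge0 ?mulr_ge0 ?(ltW be0) // sumr_ge0 // => i _; rewrite mulr_ge0.
have devP (e e' : I -> V) v : 0 <= deviation b p q be e e' s v ^+ 2 / eta ^+ 2.
  by rewrite divr_ge0 ?sqr_ge0.
have ratP (x : R) : 0 <= x -> 0 <= x / eta by move=> x0; rewrite divr_ge0 // ltW.
have dam0 v : 0 <= damage b p q be eta src dst s v.
  by rewrite /damage !addr_ge0 ?ratP.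
have damP v : damage b p q be eta src dst s v < 1 ->
    [/\ gL v, gR v, loss b p q be eta src dst s v <= eta & loss b p q be eta dst src s v <= eta].
  have goodP (e e' : I -> V) : deviation b p q be e e' s v ^+ 2 / eta ^+ 2 < 1 -> good b p q be eta e e' s v.
    by move=> h; have := bad_le b p q be eta0 e e' s v; case: good => //= h'; lra.
  have lossP (x : R) : x / eta < 1 -> x <= eta by rewrite ltr_pdivrMr // mul1r => /ltW.
  rewrite /damage => h.
  have h1 := devP src dst v; have h2 := devP dst src v.
  have h3 := ratP _ (lossL0 v); have h4 := ratP _ (lossR0 v).
  by split; [apply: goodP|apply: goodP|apply: lossP|apply: lossP];
    move: h h1 h2 h3 h4; clear; lra.
have okP j : ok j -> damage b p q be eta src dst s (p j) < 1 /\
    damage b p q be eta src dst s (q j) < 1.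
  by rewrite /ok; have := dam0 (p j); have := dam0 (q j); lra.
have cLb v : (cL v <= b v)%N by rewrite -(capLR load s v) leq_addr.
have cRb v : (cR v <= b v)%N by rewrite -(capLR load s v) leq_addl.
have dLge j : ok j -> degree b be src (le j) - 2 * eta <= dL (le j).
  move=> /okP[pP qP].
  have [gl gr ll lr] : [/\ gL (le j), gR (le j), loss b p q be eta src dst s (le j) <= eta &
    loss b p q be eta dst src s (le j) <= eta] by apply: damP; rewrite /le; case: ifP.
  have cj : cL (le j) != 0%N.
    rewrite -lt0n; apply: leq_trans (leC predT (le j)); apply/card_gt0P; exists j.
    by rewrite inE /= eqxx.
  apply: le_trans (side_degree_ge _ _ _ (ltW be0) cRb cj gl); rewrite gLle.
  by move: gl; rewrite /gL /good ler_norml -/gR => gl; rewrite /bad_share; move: ll; rewrite /loss; lra.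
have dRge j : ok j -> degree b be dst (re j) - 2 * eta <= dR (re j).
  move=> /okP[pP qP].
  have [gl gr ll lr] : [/\ gL (re j), gR (re j), loss b p q be eta src dst s (re j) <= eta &
    loss b p q be eta dst src s (re j) <= eta] by apply: damP; rewrite /re; case: ifP.
  have cj : cR (re j) != 0%N.
    rewrite -lt0n; apply: leq_trans (reC predT (re j)); apply/card_gt0P; exists j.
    by rewrite inE /= eqxx.
  apply: le_trans (side_degree_ge _ _ _ (ltW be0) cLb cj gr); rewrite gRle.
  by move: gr; rewrite /gR /good ler_norml => gr; rewrite /bad_share; move: lr; rewrite /loss; lra.
(* On a kept edge of weight k the side degrees add up to at most k + 2 / be + 2 * eta <= k * sc,
   because 1 <= k. Dividing by [sc] restores the bound k and brings every degree to at most [W]. *)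
pose sc := 1 + (2 / be + 2 * eta).
have sc0 : 0 < sc by rewrite /sc; lra.
pose X : finType := (V + V)%type.
pose c (x : X) : R := match x with inl v => (cL v)%:R | inr v => (cR v)%:R end.
pose d (x : X) : R := match x with inl v => dL v / sc | inr v => dR v / sc end.
pose y (x : X) : R := match x with inl v => (yL v)%:R | inr v => (yR v)%:R end.
pose m i := mass b cL cR be src dst gL gR i / sc.
pose hard i := (0 < z (inl i))%N.
pose P j := [&& gap j, ok j & (yL (le j) + yR (re j) < l j)%N].
pose x j : R := (l j)%:R - (yL (le j))%:R - (yR (re j))%:R.
have scale_le (e : I -> V) v : degree b be e v <= D -> (degree b be e v + eta) / sc <= W%:R.
  by move=> eD; rewrite ler_pdivrMr // /sc; move: eD; rewrite /D; nra.
have key : (1 - 2 * th) * \sum_(j | P j) x j <=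
   (1 - (2 * (W%:R + xi))^-1) * \sum_v c v * y v + \sum_(i | hard i) 1.
  apply: (@gap_le_cover R X I J (W%:R + xi) xi th c d y m
    (fun i => inl (src i)) (fun i => inr (dst i)) hard P
    (fun j => inl (le j)) (fun j => inr (re j)) x) => //.
  - lra.
  - by case=> v /=.
  - case=> v /=; rewrite addrK divr_ge0 ?side_degree_ge0 ?(ltW sc0) ?(ltW be0) //=.
      apply: (le_trans _ (scale_le _ _ (srcD v))); rewrite ler_wpM2r ?invr_ge0 ?(ltW sc0) //.
      apply: le_trans (dLle v) _; rewrite ler_piMl ?lern1 ?leq_b1 //.
      by have := deg0 src v; lra.
    apply: (le_trans _ (scale_le _ _ (dstD v))); rewrite ler_wpM2r ?invr_ge0 ?(ltW sc0) //.
    apply: le_trans (dRle v) _; rewrite ler_piMl ?lern1 ?leq_b1 //.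
    by have := deg0 dst v; lra.
  - by case=> v /=; rewrite addrK ler0n ler_nat; case: (yW v).
  - by move=> i; rewrite /m divr_ge0 ?mass_ge0 // ltW.
  - case=> v /=.
      rewrite [X in _ + X]big_pred0 ?addr0 // -mulr_suml.
      rewrite (eq_bigl (fun i => src i == v)) // sum_mass mulrA //.
    rewrite [X in X + _]big_pred0 ?add0r // -mulr_suml.
    rewrite (eq_bigl (fun i => dst i == v)) //.
    have -> : \sum_(i | dst i == v) mass b cL cR be src dst gL gR i =
        \sum_(i | dst i == v) mass b cR cL be dst src gR gL i.
      by apply: eq_bigr => i _; rewrite /mass; ring.
    by rewrite sum_mass mulrA.
  - move=> i ezi _ /=; rewrite -mulrDl ler_pdivrMr //.
    move: (dual (inl i) isT); rewrite /= (eqP (_ : z (inl i) == 0%N)) ?addn0; last by move: ezi; rewrite /hard lt0n negbK.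
    rewrite -(ler_nat R) natrD => ky.
    apply: le_trans (_ : (k i)%:R * sc <= _); last by rewrite ler_wpM2r // ltW.
    have k1 : 1 <= (k i)%:R :> R by rewrite ler1n; case/andP: (kW i).
    have := Hle i; have := dLle (src i); have := dRle (dst i).
    have gb (g : bool) (t : R) : 0 <= t -> g%:R * t <= t by move=> t0; rewrite ler_piMl ?lern1 ?leq_b1.
    have := gb (gL (src i)) (degree b be src (src i) + eta) (addr_ge0 (deg0 _ _) (ltW eta0)).
    have := gb (gR (dst i)) (degree b be dst (dst i) + eta) (addr_ge0 (deg0 _ _) (ltW eta0)).
    have : 0 <= ((k i)%:R - 1) * (2 / be + 2 * eta).
      by apply: mulr_ge0; move: k1 ibe0 eta0; clear; lra.
    by rewrite /sc; clear; lra.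
  - move=> i _; rewrite /m; apply: (le_trans _ be_xi); rewrite ler_pdivrMr //.
    apply: le_trans (_ : 2 / be * 1 <= _); last by rewrite ler_wpM2l ?(ltW ibe0) // /sc; lra.
    have frac u v : (u v <= b v)%N -> 0 <= ((u v)%:R / (b v)%:R : R) <= 1.
      by move=> uv; rewrite divr_ge0 //= ler_pdivrMr ?ltr0n // mul1r ler_nat.
    have bool01 (g : bool) : 0 <= (g%:R : R) <= 1 by case: g; rewrite ?lexx ?ler01.
    have mul01 (t u : R) : 0 <= t <= 1 -> 0 <= u <= 1 -> 0 <= t * u <= 1.
      by move=> /andP[t0 t1] /andP[u0 u1]; rewrite mulr_ge0 //= mulr_ile1.
    rewrite /mass; move: (2 / be) ibe0 => t ibe0; rewrite -!mulrA ler_wpM2l ?(ltW ibe0) //.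
    have := mul01 _ _ (frac cL _ (cLb (src i))) (mul01 _ _ (frac cR _ (cRb (dst i)))
      (mul01 _ _ (bool01 (gL (src i))) (bool01 (gR (dst i))))).
    by rewrite -!mulrA => /andP[].
  - have sum1 (Q : pred J) : \sum_(j | Q j) 1 = (#|[set j | Q j]|)%:R :> R.
      by rewrite -sum1_card natr_sum; apply: eq_bigl => j; rewrite inE.
    case=> v /=.
      rewrite [X in _ + X]big_pred0 ?addr0 => [|j]; last by rewrite andbF.
      by rewrite sum1 ler_nat; apply: leC.
    rewrite [X in X + _]big_pred0 ?add0r => [|j]; last by rewrite andbF.
    by rewrite sum1 ler_nat; apply: reC.
  - move=> j /and3P[_ _]; rewrite /x -(ler_nat R) -natr1 natrD; clear; lra.
  - move=> j /and3P[gj okj yl] /=.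
    have [g1 g2] := Hgap j gj.
    have dl := dLge j okj; have dr := dRge j okj.
    have lj : 1 <= ((l j)%:R : R) <= W%:R by rewrite ler1n ler_nat; case/andP: (lW j) => -> ->.
    have gap' : (l j)%:R - (2 / be + 4 * eta) <= dL (le j) + dR (re j).
      by move: dl dr g1 g2; rewrite /le /re; case: (s (inl j)); clear; lra.
    have xj1 : 1 <= x j by move: yl; rewrite /x -(ler_nat R) -natr1 natrD; clear; lra.
    have th0 : 0 <= th by case/andP: th01.
    (* Dividing by [sc] costs at most W * (2 / be + 2 * eta), which [th] includes; as 1 <= x j, a
       loss of th is at most th * x j. *)
    suff : (l j)%:R - th <= (dL (le j) + dR (re j)) / sc.
      have : th * 1 <= th * x j by rewrite ler_wpM2l.
      by rewrite mulrDl /x; clear; lra.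
    rewrite ler_pdivlMr //; apply: (le_trans _ gap').
    have : (l j)%:R * (2 / be + 2 * eta) <= W%:R * (2 / be + 2 * eta).
      by apply: ler_wpM2r; [move: ibe0 eta0; clear; lra|case/andP: lj].
    have : 0 <= th * (2 / be + 2 * eta).
      by apply: mulr_ge0 => //; move: ibe0 eta0; clear; lra.
    by move: thP; rewrite /sc; clear; lra.
have yE : \sum_v c v * y v = (\sum_v cL v * yL v + \sum_v cR v * yR v)%:R.
  by rewrite big_sumType /= natrD !natr_sum; congr (_ + _); apply: eq_bigr => v _; rewrite natrM.
pose Q j := ~~ gap j || ok j.
have cover_le : \sum_(j | Q j) ((yL (le j))%:R + (yR (re j))%:R) <= \sum_v c v * y v.
  have side (e : J -> V) (f : V -> nat) :
      \sum_(j | Q j) (f (e j))%:R = \sum_v (#|[set j | Q j && (e j == v)]| * f v)%:R :> R.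
    rewrite (partition_big e predT) //=; apply: eq_bigr => v _.
    rewrite -sum_nat_cond_const natr_sum.
    by apply: eq_bigr => j /andP[_ /eqP ->].
  rewrite yE big_split /= !side natrD !natr_sum.
  by apply: lerD; apply: ler_sum => v _; rewrite ler_nat leq_mul2r ?leC ?reC orbT.
have split_le : \sum_(j | Q j) (l j)%:R <= \sum_(j | Q j) ((yL (le j))%:R + (yR (re j))%:R)
    + \sum_(j | ~~ gap j) (z (inr j))%:R + \sum_(j | P j) x j.
  rewrite !(big_mkcond Q) (big_mkcond (predC gap)) (big_mkcond P) -!big_split /=.
  apply: ler_sum => j _; rewrite /Q /P /x.
  have := dual (inr j); rewrite /=; case: (gap j) => /= [_|/(_ isT)]; last first.
    by rewrite addr0 -!natrD ler_nat.
  case: (ok j) => //=; rewrite ?addr0 //.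
  case: ltnP => /= [_ | yl]; last by rewrite addr0 -natrD ler_nat.
  lra.
have bad_le : \sum_(j | ~~ Q j) (l j)%:R <= K * (\sum_j l j)%:R.
  rewrite natr_sum; apply: le_trans sP; rewrite big_mkcond /=; apply: ler_sum => j _.
  case: ifP => [|_]; last by rewrite mulr_ge0 // addr_ge0.
  rewrite /Q negb_or => /andP[_]; rewrite /ok -leNgt => ge1.
  by rewrite ler_peMr.
have hard_le : \sum_(i | hard i) 1 <= \sum_i (z (inl i))%:R :> R.
  rewrite big_mkcond /=; apply: ler_sum => i _; rewrite /hard.
  by case: ifP => [|_]; rewrite ?ler1n // ler0n.
have {}opt : \sum_v c v * y v + \sum_(j | ~~ gap j) (z (inr j))%:R + \sum_i (z (inl i))%:R <= T%:R.
  rewrite yE -!natr_sum -!natrD ler_nat; apply: leq_trans opt.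
  by rewrite leq_eqVlt big_sumType /= -!addnA [X in (_ + (_ + X))%N]addnC eqxx.
have tot : (\sum_j l j)%:R = \sum_(j | Q j) (l j)%:R + \sum_(j | ~~ Q j) (l j)%:R :> R.
  by rewrite natr_sum (bigID Q).
apply: (combine_bounds _ _ _ _ _ key hard_le split_le cover_le opt bad_le tot).
- by rewrite subr_ge0 invf_le1; move: W1 xi0; clear; lra.
- exact: th01.
- by rewrite sumr_ge0.
- by rewrite sumr_ge0 // => v _; rewrite mulr_ge0 //; case: v.
- by rewrite sumr_ge0.
Qed.

(** * The streaming algorithm *)

Definition oedge (n : nat) : Type := ('I_n * 'I_n * nat)%type.

Definition unorient (n : nat) (o : oedge n) : wedge n := ([set o.1.1; o.1.2], o.2).

Definition orientations (n : nat) (e : wedge n) : seq (oedge n) :=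
  [seq o <- [seq (x, e.2) | x : 'I_n * 'I_n] | unorient o == e].

Lemma mem_orientations n (e : wedge n) o : (o \in orientations e) = (unorient o == e).
Proof.
rewrite mem_filter; case: eqP => //= <-; apply/mapP; exists o.1; first exact: mem_enum.
by case: o.
Qed.

(** * Degree constraints and the potential *)

Section Degrees.
Variables (R : realFieldType) (n : nat) (b : 'I_n -> nat) (beta : nat).
Implicit Types (H : seq (oedge n)) (o : oedge n).

Definition out_deg H v : R := (count (fun o => o.1.1 == v) H)%:R / (beta%:R * (b v)%:R).
Definition in_deg H v : R := (count (fun o => o.1.2 == v) H)%:R / (beta%:R * (b v)%:R).
Definition edge_deg H o : R := out_deg H o.1.1 + in_deg H o.1.2.
Definition underfull H o := edge_deg H o <= o.2%:R - 2 / beta%:R.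
Definition overfull H o := o.2%:R + 2 / beta%:R <= edge_deg H o.

Definition pick_underfull H (e : wedge n) : option (oedge n) :=
  ohead [seq o <- orientations e | underfull H o].

Fixpoint trim (fuel : nat) H :=
  if fuel is f.+1 then
    if ohead [seq o <- H | overfull H o] is Some o then trim f (rem o H) else H
  else H.

(** The fuel exceeds the length of [o :: H] and every round deletes an edge, so trimming stops only
    when nothing is overfull. *)
Definition insert o H := trim (size H).+2 (o :: H).

Definition potential H : R := (\sum_(o <- H) o.2)%:R / beta%:R
  - (\sum_v (b v)%:R * out_deg H v ^+ 2) / 2 - (\sum_v (b v)%:R * in_deg H v ^+ 2) / 2.

Lemma pick_underfullP H e o : pick_underfull H e = Some o ->
  unorient o = e /\ underfull H o.
Proof.
rewrite /pick_underfull; case E: [seq o <- _ | _] => [|o' s] //= [<-].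
have : o' \in [seq o <- orientations e | underfull H o] by rewrite E mem_head.
by rewrite mem_filter mem_orientations => /andP[uf /eqP].
Qed.

Hypothesis b_gt0 : forall v, (0 < b v)%N.
Hypothesis beta_gt0 : (0 < beta)%N.

Lemma perm_deg H H' : perm_eq H H' ->
  (out_deg H =1 out_deg H') * (in_deg H =1 in_deg H') * (potential H = potential H').
Proof.
move=> HH; have [oE iE] : (out_deg H =1 out_deg H') /\ (in_deg H =1 in_deg H').
  by split=> v; rewrite /out_deg /in_deg (seq.permP HH).
split; first by split.
rewrite /potential (perm_big _ HH); congr (_ - _ / _ - _ / _); apply: eq_bigr => v _.
  by rewrite oE.
by rewrite iE.
Qed.

Lemma deg_cons o H v :
  (out_deg (o :: H) v = out_deg H v + (o.1.1 == v)%:R / (beta%:R * (b v)%:R)) *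
  (in_deg (o :: H) v = in_deg H v + (o.1.2 == v)%:R / (beta%:R * (b v)%:R)).
Proof. by rewrite /out_deg /in_deg /= !natrD !mulrDl; split; rewrite addrC. Qed.

(** The gain is 1 / beta times the slack of the edge minus a second-order term of at most 1 / beta.
    Thresholds at distance 2 / beta from the weight therefore leave beta^-2 per insertion or
    deletion. *)
Lemma potential_cons o H : let g := (b o.1.1)%:R^-1 + (b o.1.2)%:R^-1 in
  potential (o :: H) = potential H + (o.2%:R - edge_deg H o - g / (2 * beta%:R)) / beta%:R.
Proof.
move=> g; have be0 : beta%:R != 0 :> R by rewrite pnatr_eq0 -lt0n.
have b0 v : (b v)%:R != 0 :> R by rewrite pnatr_eq0 -lt0n.
have sqE (d d' : 'I_n -> R) u : (forall v, d' v = d v + (u == v)%:R / (beta%:R * (b v)%:R)) ->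
  \sum_v (b v)%:R * d' v ^+ 2 = \sum_v (b v)%:R * d v ^+ 2
    + (2 * d u + (b u)%:R^-1 / beta%:R) / beta%:R.
  move=> dE; rewrite (bigD1 u) //= [in RHS](bigD1 u) //= dE eqxx.
  rewrite (eq_bigr (fun v => (b v)%:R * d v ^+ 2)) => [|v vu]; last first.
    by rewrite dE eq_sym (negPf vu) mul0r addr0.
  move: (\sum_(_ | _) _) => S; rewrite mulr1n; move: (d u) => du; move: (b u)%:R (b0 u) => bu bu0.
  by field; rewrite be0 bu0.
rewrite /potential big_cons natrD.
rewrite (sqE _ _ _ (fun v => (deg_cons o H v).1)) (sqE _ _ _ (fun v => (deg_cons o H v).2)).
by rewrite /g /edge_deg; field; rewrite be0 !b0.
Qed.

Let inv_le1 v : 0 <= ((b v)%:R^-1 : R) <= 1.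
Proof. by rewrite invr_ge0 ler0n /= invf_le1 ?ler1n ?ltr0n b_gt0. Qed.

Lemma potential_insert o H : underfull H o ->
  potential H + beta%:R ^- 2 <= potential (o :: H).
Proof.
rewrite /underfull potential_cons => uf; rewrite lerD2l expr2 invfM.
have be0 : 0 < beta%:R :> R by rewrite ltr0n.
rewrite ler_wpM2r ?invr_ge0 ?ler0n //.
have h1 := inv_le1 o.1.1; have h2 := inv_le1 o.1.2.
have -> : ((b o.1.1)%:R^-1 + (b o.1.2)%:R^-1) / (2 * beta%:R) =
  ((b o.1.1)%:R^-1 + (b o.1.2)%:R^-1) / 2 * beta%:R^-1 :> R by move: (b o.1.1)%:R^-1 (b o.1.2)%:R^-1 => x y; field; rewrite gt_eqF.
have : ((b o.1.1)%:R^-1 + (b o.1.2)%:R^-1) / 2 * beta%:R^-1 <= 1 * beta%:R^-1 :> R.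
  by rewrite ler_wpM2r ?invr_ge0 ?ler0n //; lra.
by lra.
Qed.

Lemma potential_remove o H : o \in H -> overfull H o ->
  potential H + beta%:R ^- 2 <= potential (rem o H).
Proof.
move=> oH; have HE := perm_deg (perm_to_rem oH).
rewrite /overfull /edge_deg !HE !deg_cons !eqxx potential_cons => ov.
have be0 : 0 < beta%:R :> R by rewrite ltr0n.
have b0 v : (b v)%:R != 0 :> R by rewrite pnatr_eq0 -lt0n.
have h1 := inv_le1 o.1.1; have h2 := inv_le1 o.1.2.
set H' := rem o H in ov *; set P := potential H'.
have key : beta%:R ^- 2 <= (edge_deg H' o + ((b o.1.1)%:R^-1 + (b o.1.2)%:R^-1) / (2 * beta%:R) - o.2%:R) / beta%:R.
  rewrite expr2 invfM ler_wpM2r ?invr_ge0 ?ler0n //.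
  have e1 v : 1 / (beta%:R * (b v)%:R) = (b v)%:R^-1 * beta%:R^-1 :> R by field; rewrite b0 lt0r_neq0.
  rewrite !e1 in ov.
  have -> : ((b o.1.1)%:R^-1 + (b o.1.2)%:R^-1) / (2 * beta%:R) =
    ((b o.1.1)%:R^-1 * beta%:R^-1 + (b o.1.2)%:R^-1 * beta%:R^-1) / 2 :> R by move: (b o.1.1)%:R^-1 (b o.1.2)%:R^-1 => x y; field; rewrite gt_eqF.
  have q v : (b v)%:R^-1 * beta%:R^-1 <= 1 * beta%:R^-1 :> R.
    by rewrite ler_wpM2r ?invr_ge0 ?ler0n //; case/andP: (inv_le1 v).
  have := q o.1.1; have := q o.1.2; move: ov; rewrite /edge_deg; lra.
apply: le_trans (lerD (lexx _) key) _.
by rewrite -addrA -mulrDl le_eqVlt; apply/orP; left; apply/eqP; ring.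
Qed.

Lemma trimP fuel H : let H' := trim fuel H in
  [/\ (size H < fuel)%N -> all (fun o => ~~ overfull H' o) H',
      potential H <= potential H' & subseq H' H].
Proof.
elim: fuel H => [|f IHf] H /=; first by split.
case E: [seq o <- H | overfull H o] => [|o s] /=.
  split=> // _; apply/allP => o oH; apply/negP => ov.
  have : o \in [seq o <- H | overfull H o] by rewrite mem_filter ov.
  by rewrite E.
have : o \in [seq o <- H | overfull H o] by rewrite E mem_head.
rewrite mem_filter => /andP[ov oH]; have [h1 h2 h3] := IHf (rem o H); split.
- by move=> sz; apply: h1; rewrite size_rem //; case: (H) oH sz.
- apply: le_trans h2; apply: le_trans (potential_remove oH ov).
  by rewrite lerDl invr_ge0 exprn_ge0.
- exact: subseq_trans h3 (rem_subseq _ _).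
Qed.

Lemma insertP o H : underfull H o -> let H' := insert o H in
  [/\ all (fun o => ~~ overfull H' o) H', potential H + beta%:R ^- 2 <= potential H' &
      subseq H' (o :: H)].
Proof.
move=> uf; have [h1 h2 h3] := trimP (size H).+2 (o :: H); split=> //.
  exact: h1.
exact: le_trans (potential_insert uf) h2.
Qed.

End Degrees.

(** [st_mods] counts insertions and [st_wait] the arrivals since the last one; once [st_late] holds,
    [st_kept] is frozen and underfull arrivals go to [st_extra]. *)
Record state (n : nat) := State {
  st_cap : {ffun 'I_n -> nat};
  st_late : bool;
  st_mods : nat;
  st_wait : nat;
  st_kept : seq (oedge n);
  st_extra : seq (oedge n)
}.

(** * The two phases and their invariants *)

Section Algorithm.
Variables (R : realFieldType) (n beta : nat) (alpha gamma : nat -> nat).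
Variables (start_late : bool).

Definition start (cap : {ffun 'I_n -> nat}) : state n :=
  State cap (start_late || (alpha 0 == 0)) 0 0 [::] [::].

(** [alpha] is the patience and [gamma] the room, indexed by the number of insertions. Truncating
    the late edges at [gamma j] makes the memory bound hold for every order; only the ratio is left
    to chance. *)
Definition advance (st : state n) (e : wedge n) : state n :=
  let: State cap late j c H U := st in
  let o := pick_underfull R cap beta H e in
  if late then
    State cap true j c H (if o is Some o then take (gamma j) (rcons U o) else U)
  else if o is Some o then State cap (alpha j.+1 == 0) j.+1 0 (insert R cap beta o H) U
  else State cap (alpha j <= c.+1)%N j c.+1 H U.

Variable cap : {ffun 'I_n -> nat}.
Hypothesis cap_gt0 : forall v, (0 < cap v)%N.
Hypothesis beta_gt0 : (0 < beta)%N.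

Let run (l : seq (wedge n)) := foldl advance (start cap) l.

(** [l0] reaches up to the last insertion, [l1] is the run without underfull edges since then, [l2]
    the late phase. The wait before an insertion is shorter than [alpha i], so together with the
    insertion it takes at most [alpha i] arrivals. *)
Definition history (l : seq (wedge n)) (st : state n) :=
  exists l0 l1 l2,
  [/\ l = l0 ++ l1 ++ l2,
      size l1 = st_wait st /\
        all (fun e => pick_underfull R cap beta (st_kept st) e == None) l1,
      st_kept (run l0) = st_kept st /\ st_mods (run l0) = st_mods st,
      (size l0 <= \sum_(i < st_mods st) alpha i)%N &
      if st_late st then
        (st_wait st = alpha (st_mods st) \/ start_late /\ l0 ++ l1 = [::]) /\
        (start_late -> l0 ++ l1 = [::]) /\
        (st_extra st = take (gamma (st_mods st))
           (pmap (pick_underfull R cap beta (st_kept st)) l2))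
      else [/\ l2 = [::], st_extra st = [::], ~~ start_late & (st_wait st < alpha (st_mods st))%N]].

Lemma run_cap l : st_cap (run l) = cap.
Proof.
elim/last_ind: l => [|l e IHl] //; rewrite /run foldl_rcons -/(run l).
by case: (run l) IHl => cp [] j c H U /=; case: (pick_underfull R cp beta H e).
Qed.

Lemma take_rcons_take (T : Type) g (s : seq T) x :
  take g (rcons (take g s) x) = take g (rcons s x).
Proof.
have [gs|sg] := leqP g (size s); last by rewrite (take_oversize (ltnW sg)).
have gt : (g <= size (take g s))%N by rewrite size_takel.
by rewrite -!cats1 (takel_cat _ gs) (takel_cat _ gt) -take_min minnn.
Qed.

Lemma run_history l : history l (run l).
Proof.
elim/last_ind: l => [|l e [l0 [l1 [l2 [lE [l1s l1u] [kE mE] l0s IH]]]]].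
  exists [::], [::], [::]; rewrite /run /= /start; split => //=.
  case: eqP => a0; rewrite ?orbT ?orbF.
    by split=> //; left.
  by case: start_late; split=> //; [right|lia].
have runE : run (rcons l e) = advance (run l) e by rewrite /run foldl_rcons.
have cE := run_cap l.
move: (run l) runE cE l1s l1u kE mE l0s IH => [cp late j c H U] /= runE cE l1s l1u kE mE l0s.
rewrite cE in runE; case: late runE => runE [].
  move=> stop [sl UE]; exists l0, l1, (rcons l2 e); rewrite runE /=; split=> //.
    by rewrite lE -!cats1 -!catA.
  split=> //; split=> //; rewrite UE -cats1 pmap_cat /=; case: (pick_underfull R cap beta H e) => [o|] /=; last by rewrite cats0.
  by rewrite take_rcons_take cats1.
move=> l2E UE nsl cj; rewrite l2E cats0 in lE; rewrite UE in runE.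
case oE: (pick_underfull R cap beta H e) runE => [o|] runE.
  exists (rcons l e), [::], [::]; rewrite runE /= cats0; split=> //.
  - by rewrite big_ord_recr /= size_rcons lE size_cat l1s -addnS leq_add.
  - case: eqP => [a0|a0]; split=> //; [by left|by split=> // sl; rewrite sl in nsl|lia].
exists l0, (rcons l1 e), [::]; rewrite runE /= cats0; split=> //.
- by rewrite lE rcons_cat.
- by rewrite size_rcons l1s all_rcons l1u oE.
- case: ltnP => ac; split=> //; first by left; lia.
  by split=> // sl; rewrite sl in nsl.
Qed.

Lemma run_kept l : let: st := run l in let: H := st_kept st in
  [/\ all (fun o => ~~ overfull R cap beta H o) H,
      (st_mods st)%:R * beta%:R ^- 2 <= potential R cap beta H,
      forall x, (count_mem x [seq unorient o | o <- H] <= count_mem x l)%N,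
      (size H <= size l)%N &
      (st_mods st <= size l)%N /\ (st_wait st <= size l)%N].
Proof.
elim/last_ind: l => [|l e].
  split=> //=; rewrite /potential !big_nil mul0r.
  rewrite !big1 ?mul0r ?subr0 // => v _; rewrite /out_deg /in_deg /= mul0r expr0n mulr0 //.
have runE : run (rcons l e) = advance (run l) e by rewrite /run foldl_rcons.
have cE := run_cap l; rewrite runE size_rcons.
have cnt x : (count_mem x l <= count_mem x (rcons l e))%N.
  by rewrite -cats1 count_cat leq_addr.
move: (run l) cE => [cp late j c H U] /= ->.
case=> ov pot cH sH [jl cl].
have keep : [/\ all (fun o => ~~ overfull R cap beta H o) H,
      j%:R * beta%:R ^- 2 <= potential R cap beta H,
      forall x, (count_mem x [seq unorient o | o <- H] <= count_mem x (rcons l e))%N &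
      (size H <= (size l).+1)%N].
  by split=> // [x|]; [apply: leq_trans (cH x) (cnt x)|lia].
case: keep => k1 k2 k3 k4.
case: late; first by split=> //=; lia.
case oE: (pick_underfull R cap beta H e) => [o|] /=; last by split=> //; lia.
have [oe uf] := pick_underfullP oE.
have [i1 i2 i3] := insertP cap_gt0 beta_gt0 uf; split=> //.
- by apply: le_trans i2; rewrite -natr1 mulrDl mul1r lerD2r.
- move=> x; apply: leq_trans (leq_count_subseq _ (map_subseq (@unorient n) i3)) _.
  by rewrite -cats1 count_cat /= oe addn0 addnC leq_add2r.
- by apply: leq_trans (size_subseq i3) _; rewrite /= ltnS.
Qed.

End Algorithm.

Local Close Scope ring_scope.

(** * The state as a list of words *)

Section Encoding.
Variables (n m W : nat).

Definition code_edge (o : oedge n) : seq nat := [:: o.1.1 : nat; o.1.2 : nat; o.2].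

Fixpoint decode_edges (s : seq nat) : seq (oedge n) :=
  if s is x :: y :: k :: s' then
    if (insub x, insub y) is (Some u, Some v) then (u, v, k) :: decode_edges s'
    else decode_edges s'
  else [::].

Definition code (st : state n) : seq nat :=
  [seq st_cap st v | v <- enum 'I_n]
  ++ [:: nat_of_bool (st_late st); st_mods st; st_wait st; size (st_kept st)]
  ++ flatten [seq code_edge o | o <- st_kept st ++ st_extra st].

Definition decode (s : seq nat) : state n :=
  let t := drop n s in let es := decode_edges (drop 4 t) in
  State [ffun v : 'I_n => nth 0 s v] (nth 0 t 0 == 1) (nth 0 t 1) (nth 0 t 2)
    (take (nth 0 t 3) es) (drop (nth 0 t 3) es).

Lemma decode_edgesK s : decode_edges (flatten [seq code_edge o | o <- s]) = s.
Proof. by elim: s => [|[[u v] k] s IHs] //=; rewrite !valK IHs. Qed.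

Lemma codeK : cancel code decode.
Proof.
case=> cap late j c H U; rewrite /decode /code /=.
have sz : size [seq cap v | v <- enum 'I_n] = n by rewrite size_map size_enum_ord.
rewrite drop_size_cat // -/(map _ _) /= drop0 decode_edgesK.
rewrite take_size_cat // drop_size_cat //; congr State; last by case: late.
apply/ffunP => v; rewrite ffunE nth_cat sz ltn_ord.
by rewrite (nth_map v) ?size_enum_ord // nth_ord_enum.
Qed.

Lemma size_code st :
  size (code st) = n + 4 + 3 * (size (st_kept st) + size (st_extra st)).
Proof.
rewrite /code !size_cat size_map size_enum_ord /= size_flatten /shape -map_comp.
rewrite (eq_map (_ : _ =1 fun=> 3)) // -size_cat addnA; congr (_ + _).
by elim: (_ ++ _) => //= o s ->; rewrite mulnS.
Qed.

Definition to_words (s : seq nat) : seq (word W n m) := [seq inord x | x <- s].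
Definition of_words (s : seq (word W n m)) : seq nat := [seq val x | x <- s].

Lemma to_wordsK s : all (fun x => x <= n + m + W) s -> of_words (to_words s) = s.
Proof.
move=> /allP sP; rewrite /of_words /to_words -map_comp -[RHS]map_id.
by apply/eq_in_map => x /sP xle; rewrite /= inordK.
Qed.

Lemma code_words (st : state n) : 0 < W ->
  (forall v, st_cap st v <= n + m + W) -> st_mods st <= m -> st_wait st <= m ->
  size (st_kept st) <= m -> all (fun o => o.2 <= W) (st_kept st ++ st_extra st) ->
  all (fun x => x <= n + m + W) (code st).
Proof.
have le_m x : x <= m -> x <= n + m + W by lia.
move=> W0 capm jm cm Hm /allP wW; rewrite /code !all_cat; apply/and3P; split.
- by apply/allP => x /mapP[v _ ->].
- rewrite /= andbT; apply/and4P; split; try exact: le_m.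
  by case: (st_late st) => //=; rewrite addnC ltn_addr.
apply/allP => x /flatten_mapP[[[u v] k] oH]; have := wW _ oH; rewrite /= !inE => kW.
have un := ltn_ord u; have vn := ltn_ord v.
by clear -kW un vn; move=> /or3P[] /eqP -> /=; lia.
Qed.

End Encoding.

(** * Optimal extraction from the stored edges *)

Section BestMatching.
Variables (n : nat) (cap : 'I_n -> nat).

Definition respects (M : seq (wedge n)) := [forall v, count (incident v) M <= cap v].

(** Exhaustive search over sublists; the default mask selects nothing and so meets every
    capacity. *)
Definition best_bmatching (L : seq (wedge n)) : seq (wedge n) :=
  let mk := arg_max [tuple of nseq (size L) false]
    (fun mk : (size L).-tuple bool => respects (mask mk L))
    (fun mk : (size L).-tuple bool => weight (mask mk L)) in
  mask mk L.

Lemma best_bmatchingP L : [/\ subseq (best_bmatching L) L, respects (best_bmatching L) &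
  forall M, subseq M L -> respects M -> weight M <= weight (best_bmatching L)].
Proof.
rewrite /best_bmatching; case: arg_maxnP => [|mk mkP mkmax].
  by rewrite /= mask_false; apply/forallP.
split=> //; first exact: mask_subseq.
move=> _ /subseqP[mk' smk' ->] ok; have smk : size mk' == size L by rewrite smk'.
exact: (mkmax (Tuple smk)).
Qed.

End BestMatching.

(** * Bounds in terms of a maximum b-matching *)

Lemma leq_size_count (T : eqType) (s1 s2 : seq T) :
  (forall x, count_mem x s1 <= count_mem x s2) -> size s1 <= size s2.
Proof.
by move=> /count_subseqP[s ss /perm_size ->]; exact: size_subseq.
Qed.

Lemma submultisetP (T : eqType) (s1 s2 : seq T) :
  reflect (forall x, count_mem x s1 <= count_mem x s2) (submultiset s1 s2).
Proof.
apply: (iffP allP) => [H x|H x _]; last exact: H.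
by have [/H //|/count_memPn ->] := boolP (x \in s1).
Qed.

Section MaximumMatching.
Variables (W n m : nat) (G : wmultigraph W n m) (MG : seq (wedge n)).
Hypothesis MGmax : is_max_bmatching G MG.

Definition saturated := [set v | count (incident v) MG == cap G v].

Lemma count_incident_le L v :
  (forall x, count_mem x L <= count_mem x (edges G)) ->
  forall u, u != v -> count (fun e : wedge n => e.1 == [set v; u]) L <= cap G v.
Proof.
move=> /count_subseqP[s ss /seq.permP/(_ (fun e => e.1 == _)) LE] u uv; rewrite LE.
apply: leq_trans (leq_count_subseq _ ss) _; apply: leq_trans (edges_mult G _) _.
  by rewrite eq_sym.
exact: geq_minl.
Qed.

(** Otherwise a further copy of [x] could be added to [MG], and weights are positive. *)
Lemma spare_edge x : count_mem x MG < count_mem x (edges G) ->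
  exists2 v, v \in x.1 & v \in saturated.
Proof.
move=> spare; case: MGmax => /andP[/submultisetP sub /forallP caps] best.
have xG : x \in edges G by rewrite -has_pred1 has_count; exact: leq_ltn_trans (leq0n _) spare.
have [/existsP[v /andP[]]|/existsPn unsat] := boolP [exists v, (v \in x.1) && (v \in saturated)].
  by move=> ? ?; exists v.
have /best : is_bmatching G (x :: MG).
  apply/andP; split.
    apply/submultisetP => y /=; have [<-|xy] := eqVneq x y; last by rewrite add0n.
    by rewrite add1n.
  apply/forallP => v /=; have := unsat v; rewrite inE negb_and.
  have := caps v; rewrite leq_eqVlt /incident; case: (v \in x.1) => /=; last first.
    by rewrite add0n -leq_eqVlt.
  by case: eqP => //= _; rewrite add1n.
rewrite /weight big_cons leqNgt -[X in X < _]add0n ltn_add2r.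
by case/andP: (edges_weight xG) => ->.
Qed.

(** An edge without saturated endpoint has all its copies in [MG]; the others are counted at a
    saturated endpoint. *)
Lemma size_le_saturated L : (forall x, count_mem x L <= count_mem x (edges G)) ->
  size L <= size MG + \sum_(v in saturated) count (incident v) L.
Proof.
move=> LG; pose t (e : wedge n) := [exists v, (v \in e.1) && (v \in saturated)].
rewrite -(count_predC t L) addnC; apply: leq_add.
  rewrite -size_filter; apply: leq_size_count => x; rewrite count_filter.
  have [tx|ntx] := boolP (t x).
    rewrite (@eq_count _ _ pred0) ?count_pred0 // => y /=.
    by case: eqP => //= ->; rewrite tx.
  rewrite (@eq_count _ _ (pred1 x)) => [|y /=]; last by case: eqP => //= ->.
  apply: leq_trans (LG x) _; rewrite leqNgt; apply/negP => /spare_edge[v vx vs].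
  by move/existsP: ntx; apply; exists v; rewrite vx.
elim: (L) => [|e s IHs] /=; first by rewrite big1.
rewrite big_split /= leq_add //; case: (boolP (t e)) => // /existsP[v /andP[ve vs]].
by rewrite (bigD1 v) //= /incident ve.
Qed.

Lemma sum_count_incident (L : seq (wedge n)) : (forall e, e \in L -> #|e.1| = 2) ->
  \sum_v count (incident v) L = 2 * size L.
Proof.
elim: L => [|e s IHs] L2 /=; first by rewrite big1.
rewrite big_split /= IHs => [|x xs]; last by apply: L2; rewrite inE xs orbT.
rewrite mulnS; congr (_ + _); rewrite -(L2 e) ?mem_head // -sum1_card [RHS]big_mkcond.
by apply: eq_bigr => v _; rewrite /incident; case: (v \in _).
Qed.

Lemma sum_cap_saturated : \sum_(v in saturated) cap G v <= 2 * size MG.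
Proof.
rewrite -(@sum_count_incident MG) => [|e eM]; last first.
  apply: (@edges_loopless _ _ _ G); case: MGmax => /andP[/submultisetP sub _] _.
  rewrite -has_pred1 has_count; apply: leq_trans (sub e).
  by rewrite -has_count has_pred1.
rewrite big_mkcond /=; apply: leq_sum => v _; rewrite inE.
by case: eqP => // ->.
Qed.

(** A saturated vertex v has at most n neighbours and at most [cap G v] parallel edges to each. *)
Lemma edges_le : m <= size MG * (2 * n + 1).
Proof.
have := @size_le_saturated (edges G) (fun=> leqnn _); rewrite size_tuple => /leq_trans; apply.
rewrite mulnDr muln1 addnC leq_add2r; apply: leq_trans (_ : \sum_(v in saturated) n * cap G v <= _).
  apply: leq_sum => v _; rewrite mulnC -[X in _ * X]card_ord mulnC -sum_nat_const.
  apply: leq_trans (_ : \sum_u count (fun e : wedge n => (u != v) && (e.1 == [set v; u])) (edges G) <= _).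
    suff gen (L : seq (wedge n)) : {subset L <= edges G} -> count (incident v) L <=
        \sum_u count (fun e : wedge n => (u != v) && (e.1 == [set v; u])) L by apply: gen.
    elim: L => [|e s IHs] sG /=; first by rewrite big1.
    rewrite big_split /=; apply: leq_add; last first.
      by apply: IHs => y ys; apply: sG; rewrite inE ys orbT.
    rewrite /incident; case: (boolP (v \in e.1)) => // ve.
    have e2 := edges_loopless (sG e (mem_head _ _)).
    have /cards2P[x [y [xy eE]]] : #|e.1| == 2 by rewrite e2.
    move: ve; rewrite eE !inE => /orP[/eqP vx|/eqP vy].
      by rewrite (bigD1 y) //= vx eq_sym xy eqxx.
    by rewrite (bigD1 x) //= vy xy setUC eqxx.
  apply: leq_sum => u _; have [->|uv] /= := eqVneq u v; first by rewrite count_pred0.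
  exact: count_incident_le (fun=> leqnn _) _ uv.
rewrite -big_distrr /=; apply: leq_trans (leq_mul (leqnn n) sum_cap_saturated) _.
by rewrite mulnCA [size MG * _]mulnCA [n * _]mulnC.
Qed.

Section Kept.
Local Open Scope ring_scope.
Variables (R : realFieldType) (beta : nat) (H : seq (oedge n)).
Hypothesis beta_gt0 : (0 < beta)%N.
Hypothesis HG : forall x, (count_mem x [seq unorient o | o <- H] <= count_mem x (edges G))%N.

Let mu : R := (size MG)%:R.
Let oc v : R := (count (fun o => o.1.1 == v) H)%:R.
Let ic v : R := (count (fun o => o.1.2 == v) H)%:R.

Lemma size_kept_le : (size H)%:R <= mu + \sum_(v in saturated) (oc v + ic v).
Proof.
have := size_le_saturated HG; rewrite size_map -(ler_nat R) natrD natr_sum => /le_trans; apply.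
rewrite lerD2l; apply: ler_sum => v _; rewrite -natrD ler_nat count_map.
elim: (H) => //= o s IHs; rewrite /= /incident !inE /=.
rewrite addnACA leq_add // [v == _]eq_sym [v == o.1.2]eq_sym.
by case: (_ == v); case: (_ == v).
Qed.

Lemma kept_weight o : o \in H -> (1 <= o.2 <= W)%N.
Proof.
move=> oH; apply: (@edges_weight _ _ _ G (unorient o)).
rewrite -has_pred1 has_count; apply: leq_trans (HG (unorient o)).
by rewrite -has_count has_pred1 map_f.
Qed.

Hypothesis W_gt0 : (0 < W)%N.

(** Weights are charged to saturated vertices, where W * d - d^2 / 2 <= W^2 / 2 absorbs the degree
    d, however large. As the saturated capacities add up to at most 2 * mu, out- and in-degrees
    contribute W^2 * mu each. *)
Lemma potential_le : potential R (cap G) beta H <= 3 * W%:R ^+ 2 * mu.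
Proof.
have be0 : 1 <= beta%:R :> R by rewrite ler1n.
have W1 : 1 <= W%:R :> R by rewrite ler1n.
have mu0 : 0 <= mu by rewrite ler0n.
have capr v : 1 <= (cap G v)%:R :> R by rewrite ler1n cap_gt0.
have ocE v : oc v = beta%:R * ((cap G v)%:R * out_deg R (cap G) beta H v).
  by rewrite /out_deg /oc; field; have := capr v; lra.
have icE v : ic v = beta%:R * ((cap G v)%:R * in_deg R (cap G) beta H v).
  by rewrite /in_deg /ic; field; have := capr v; lra.
have sumW : (\sum_(o <- H) o.2)%:R <= W%:R * (size H)%:R :> R.
  rewrite -natrM ler_nat mulnC -sum1_size big_distrl /=.
  rewrite big_seq [X in (_ <= X)%N]big_seq; apply: leq_sum => o /kept_weight /andP[_].
  by rewrite mul1n.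
have main : (\sum_(o <- H) o.2)%:R / beta%:R <= W%:R * mu +
    \sum_(v in saturated) W%:R * ((cap G v)%:R * out_deg R (cap G) beta H v
      + (cap G v)%:R * in_deg R (cap G) beta H v).
  rewrite ler_pdivrMr; last lra.
  apply: le_trans sumW _; apply: le_trans (ler_wpM2l (ler0n _ W) size_kept_le) _.
  rewrite mulrDr mulrDl lerD //; first by rewrite ler_peMr // mulr_ge0 // ler0n.
  rewrite big_distrr big_distrl /=; apply: ler_sum => v _.
  by rewrite ocE icE le_eqVlt; apply/orP; left; apply/eqP; ring.
have quad (d : 'I_n -> R) : \sum_(v in saturated) W%:R * ((cap G v)%:R * d v)
    - (\sum_v (cap G v)%:R * d v ^+ 2) / 2 <= W%:R ^+ 2 * mu.
  apply: le_trans (_ : \sum_(v in saturated) ((cap G v)%:R * W%:R ^+ 2 / 2) <= _).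
    rewrite lerBlDr; apply: le_trans (_ : \sum_(v in saturated) ((cap G v)%:R * W%:R ^+ 2 / 2)
       + (\sum_(v in saturated) (cap G v)%:R * d v ^+ 2) / 2 <= _); last first.
      rewrite lerD2l ler_wpM2r ?invr_ge0 ?ler0n // [X in _ <= X](bigID (mem saturated)) /=.
      by rewrite lerDl sumr_ge0 // => v _; rewrite mulr_ge0 ?ler0n ?sqr_ge0.
    rewrite big_distrl -big_split /=; apply: ler_sum => v _.
    have := sqr_ge0 (W%:R - d v); have := capr v.
    move: (cap G v)%:R => c c1 sq; rewrite -subr_ge0.
    have -> : c * W%:R ^+ 2 / 2 + c * d v ^+ 2 / 2 - W%:R * (c * d v) = c / 2 * (W%:R - d v) ^+ 2.
      by field.
    by rewrite mulr_ge0 //; lra.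
  rewrite -!mulr_suml -natr_sum mulrAC mulrC ler_wpM2l ?sqr_ge0 //.
  by rewrite ler_pdivrMr // mulrC /mu -natrM ler_nat sum_cap_saturated.
have := quad (out_deg R (cap G) beta H); have := quad (in_deg R (cap G) beta H).
have : W%:R * mu <= W%:R ^+ 2 * mu by rewrite ler_wpM2r // expr2 ler_peMr //; lra.
rewrite /potential; move: main; rewrite (eq_bigr _ (fun v _ => mulrDr _ _ _)) big_split /=.
lra.
Qed.

Hypothesis no_over : all (fun o => ~~ overfull R (cap G) beta H o) H.

Lemma deg_le v : out_deg R (cap G) beta H v <= W%:R + 2 / beta%:R /\
  in_deg R (cap G) beta H v <= W%:R + 2 / beta%:R.
Proof.
have be0 : 0 <= 2 / beta%:R :> R by rewrite divr_ge0 ?ler0n.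
have dge0 u : 0 <= out_deg R (cap G) beta H u /\ 0 <= in_deg R (cap G) beta H u.
  by split; rewrite divr_ge0 ?mulr_ge0 ?ler0n.
have Hle o : o \in H -> edge_deg R (cap G) beta H o <= W%:R + 2 / beta%:R.
  move=> oH; have := allP no_over o oH; rewrite /overfull -ltNge => /ltW /le_trans; apply.
  by rewrite lerD2r ler_nat; case/andP: (kept_weight oH).
have WW : 0 <= W%:R :> R by rewrite ler0n.
split.
  have [/hasP[o oH /eqP <-]|no] := boolP (has (fun o => o.1.1 == v) H).
    by have := Hle o oH; have [_] := dge0 o.1.2; rewrite /edge_deg; lra.
  by rewrite /out_deg; move: no; rewrite has_count -eqn0Ngt => /eqP ->; rewrite mul0r; lra.
have [/hasP[o oH /eqP <-]|no] := boolP (has (fun o => o.1.2 == v) H).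
  by have := Hle o oH; have [] := dge0 o.1.1; rewrite /edge_deg; lra.
by rewrite /in_deg; move: no; rewrite has_count -eqn0Ngt => /eqP ->; rewrite mul0r; lra.
Qed.

Lemma size_kept : (size H)%:R <= (1 + 4 * (beta%:R * W%:R + 2)) * mu.
Proof.
have be1 : 1 <= beta%:R :> R by rewrite ler1n.
have capr v : 1 <= (cap G v)%:R :> R by rewrite ler1n cap_gt0.
apply: le_trans size_kept_le _; rewrite mulrDl mul1r lerD2l.
apply: le_trans (_ : \sum_(v in saturated) (2 * (beta%:R * W%:R + 2)) * (cap G v)%:R <= _).
  apply: ler_sum => v _; have [] := deg_le v; rewrite /out_deg /in_deg -/(oc v) -/(ic v).
  have c0 : 0 < beta%:R * (cap G v)%:R :> R by rewrite mulr_gt0; have := capr v; lra.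
  rewrite !ler_pdivrMr //.
  have -> : (W%:R + 2 / beta%:R) * (beta%:R * (cap G v)%:R) = (beta%:R * W%:R + 2) * (cap G v)%:R :> R.
    by field; lra.
  by lra.
rewrite -mulr_sumr -natr_sum.
have -> : 4 * (beta%:R * W%:R + 2) * mu = 2 * (beta%:R * W%:R + 2) * (2 * mu) by ring.
rewrite ler_wpM2l //.
  by rewrite mulr_ge0 ?ler0n // addr_ge0 ?mulr_ge0 ?ler0n.
by rewrite /mu -natrM ler_nat sum_cap_saturated.
Qed.

End Kept.

End MaximumMatching.

(** * Late edges *)

Section Subsequences.
Variables (T : eqType) (s : seq T).

(** Indexing by positions turns equal edges of a multiset into distinct elements of a finite
    type. *)
Definition nth_ord (i : 'I_(size s)) : T := tnth (in_tuple s) i.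
Definition sub_at (A : {set 'I_(size s)}) : seq T := [seq nth_ord i | i <- enum A].

Lemma mem_nth_ord i : nth_ord i \in s.
Proof. by rewrite -[s in _ \in s]/(tval (in_tuple s)) mem_tnth. Qed.

Lemma sub_at_subseq A : subseq (sub_at A) s.
Proof.
have sE : [seq nth_ord i | i <- enum 'I_(size s)] = s := map_tnth_enum (in_tuple s).
rewrite -[X in subseq _ X]sE; apply: map_subseq; rewrite [X in subseq _ X]enumT.
exact: filter_subseq.
Qed.

Lemma card_nth_ord (P : pred T) : #|[set i | P (nth_ord i)]| = count P s.
Proof.
rewrite -sum1_card -[in RHS]sum1_count (big_tnth _ _ s) /=.
by apply: eq_bigl => i; rewrite inE.
Qed.

Lemma count_sub_at A (P : pred T) : count P (sub_at A) = #|[set i in A | P (nth_ord i)]|.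
Proof.
rewrite -sum1_card -sum1_count /sub_at big_map big_enum_cond.
by apply: eq_bigl => i; rewrite inE.
Qed.

End Subsequences.

Section LateMatching.
Local Open Scope ring_scope.
Variables (R : realFieldType) (W n m : nat) (G : wmultigraph W n m) (beta : nat).
Variables (H : seq (oedge n)) (post ML : seq (wedge n)).

Let pick := pick_underfull R (cap G) beta H.

Lemma pick_underfull_None e o : pick e = None -> unorient o = e ->
  o.2%:R - 2 / beta%:R <= edge_deg R (cap G) beta H o.
Proof.
rewrite /pick /pick_underfull => none oe; rewrite leNgt; apply/negP => lt.
have : o \in [seq o <- orientations e | underfull R (cap G) beta H o].
  by rewrite mem_filter mem_orientations oe eqxx /underfull ltW.
by case: [seq _ <- _ | _] none.
Qed.

(** [robust_bmatching] on the positions of [H] and [ML]. An edge that is not picked has no underfull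
    orientation, so the lower degree bound holds for both orientations, whichever the coin
    chooses. *)
Lemma late_matching (eta xi th : R) :
  (0 < W)%N -> (0 < beta)%N -> 0 < eta -> 0 < xi ->
  2 / beta%:R <= xi / (2 * (W%:R + xi)) ->
  2 / beta%:R + 4 * eta + W%:R * (2 / beta%:R + 2 * eta) <= th <= 1 / 2 ->
  (forall x, count_mem x [seq unorient o | o <- H] <= count_mem x (edges G))%N ->
  all (fun o => ~~ overfull R (cap G) beta H o) H ->
  subseq ML post -> {subset ML <= edges G} -> respects (cap G) ML ->
  exists M, [/\ subseq M ([seq unorient o | o <- H] ++ [seq unorient o | o <- pmap pick post]),
    respects (cap G) M &
    (1 - 2 * th) * (1 - damage_rate beta%:R eta (W%:R + 2 / beta%:R)) * (weight ML)%:R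
      <= (2 - (2 * (W%:R + xi))^-1) * (weight M)%:R].
Proof.
move=> W0 beta0 eta0 xi0 be_xi thP HG no_over subML MLG /forallP MLcap.
pose I := 'I_(size H); pose J := 'I_(size ML).
have HinG o : o \in H -> unorient o \in edges G.
  move=> oH; rewrite -has_pred1 has_count; apply: leq_trans (HG (unorient o)).
  by rewrite -has_count has_pred1 map_f.
have [f fE] : exists f : J -> oedge n, forall j, unorient (f j) = nth_ord j.
  apply: (@fin_all_exists J (fun=> oedge n) (fun j o => unorient o = nth_ord j)) => j.
  have /eqP/cards2P[u [v [uv E]]] := edges_loopless (MLG _ (mem_nth_ord j)).
  by exists (u, v, (nth_ord j).2); rewrite /unorient /= -E -surjective_pairing.
have f_inc j v : incident v (nth_ord j) = ((f j).1.1 == v) || ((f j).1.2 == v).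
  by rewrite -fE /incident !inE ![v == _]eq_sym.
have f_neq j : (f j).1.1 != (f j).1.2.
  have := edges_loopless (MLG _ (mem_nth_ord j)); rewrite -fE /= cards2.
  by case: eqVneq.
pose gap (j : J) := pick (nth_ord j) == None.
have f_load (P : pred J) v : (#|[set j | P j && ((f j).1.1 == v)]| + #|[set j | P j && ((f j).1.2 == v)]|
    = #|[set j | P j && incident v (nth_ord j)]|)%N.
  rewrite -cardsUI (_ : _ :&: _ = set0) ?cards0 ?addn0; last first.
    apply/setP => j; rewrite !inE; apply/negP => /andP[/andP[_ /eqP h1] /andP[_ /eqP h2]].
    by have := f_neq j; rewrite h1 h2 eqxx.
  by apply: eq_card => j; rewrite !inE f_inc andb_orr.
have degE (e : oedge n -> 'I_n) v : degree (cap G) beta%:R (fun i : I => e (nth_ord i)) v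
    = (count (fun o => e o == v) H)%:R / (beta%:R * (cap G v)%:R) :> R.
  by rewrite /degree -card_nth_ord.
have load v : (#|[set j | (f j).1.1 == v]| + #|[set j | (f j).1.2 == v]| <= cap G v)%N.
  by have := f_load predT v; rewrite /= card_nth_ord => ->; exact: MLcap.
have mult v v' : (#|[set i : I | ((nth_ord i).1.1 == v) && ((nth_ord i).1.2 == v')]|
    <= minn (cap G v) (cap G v'))%N.
  rewrite (@card_nth_ord _ H (fun o : oedge n => (o.1.1 == v) && (o.1.2 == v'))).
  have [<-|vv'] := eqVneq v v'.
    rewrite (@eq_in_count _ _ pred0) ?count_pred0 // => o /HinG/edges_loopless /=.
    by rewrite cards2; case: eqVneq => //= o12 _; apply/negP => /andP[/eqP <- /eqP E]; rewrite E eqxx in o12.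
  apply: leq_trans (edges_mult G vv').
  have /count_subseqP[s ss /seq.permP/(_ (fun e : wedge n => e.1 == [set v; v'])) sE] := HG.
  apply: leq_trans (leq_count_subseq _ ss); rewrite -sE count_map.
  by apply: sub_count => o /= /andP[/eqP -> /eqP ->].
have kW (i : I) : (1 <= (nth_ord i).2 <= W)%N.
  exact: (@edges_weight _ _ _ G _ (HinG _ (mem_nth_ord i))).
have lW (j : J) : (1 <= (nth_ord j).2 <= W)%N.
  exact: (@edges_weight _ _ _ G _ (MLG _ (mem_nth_ord j))).
have be0 : 0 < beta%:R :> R by rewrite ltr0n.
have Hle (i : I) : degree (cap G) beta%:R (fun i : I => (nth_ord i).1.1) (nth_ord i).1.1
    + degree (cap G) beta%:R (fun i : I => (nth_ord i).1.2) (nth_ord i).1.2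
    <= (nth_ord i).2%:R + 2 / beta%:R :> R.
  rewrite (degE (fun o => o.1.1)) (degE (fun o => o.1.2)).
  by have := allP no_over _ (mem_nth_ord i); rewrite /overfull -ltNge => /ltW.
have Hgap (j : J) : gap j -> forall o, unorient o = nth_ord j ->
    (nth_ord j).2%:R - 2 / beta%:R <=
    degree (cap G) beta%:R (fun i : I => (nth_ord i).1.1) o.1.1
    + degree (cap G) beta%:R (fun i : I => (nth_ord i).1.2) o.1.2 :> R.
  move=> /eqP gj o oE; have := pick_underfull_None gj oE.
  by rewrite (degE (fun o => o.1.1)) (degE (fun o => o.1.2)) -oE.
have Hgap2 (j : J) : gap j ->
    (nth_ord j).2%:R - 2 / beta%:R <=
    degree (cap G) beta%:R (fun i : I => (nth_ord i).1.1) (f j).1.1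
    + degree (cap G) beta%:R (fun i : I => (nth_ord i).1.2) (f j).1.2 :> R /\
    (nth_ord j).2%:R - 2 / beta%:R <=
    degree (cap G) beta%:R (fun i : I => (nth_ord i).1.1) (f j).1.2
    + degree (cap G) beta%:R (fun i : I => (nth_ord i).1.2) (f j).1.1 :> R.
  move=> gj; split; first exact: Hgap.
  apply: (Hgap j gj ((f j).1.2, (f j).1.1, (f j).2)).
  by rewrite -fE /unorient /= setUC.
have [A [B [Bgap AB wAB]]] := robust_bmatching (@cap_gt0 _ _ _ G) load mult kW lW W0 be0
  eta0 xi0 be_xi thP Hle Hgap2.
have Bpick : all (fun e => pick e != None) (sub_at B).
  by apply/allP => e /mapP[j]; rewrite mem_enum => /Bgap gj ->.
have extraE : [seq unorient o | o <- pmap pick post] = [seq e <- post | pick e != None].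
  elim: (post) => //= e s IHs; case E: (pick e) => [o|] //=.
  by rewrite IHs; have [-> _] := pick_underfullP E.
exists ([seq unorient o | o <- sub_at A] ++ sub_at B); split.
- apply: cat_subseq; first exact/map_subseq/sub_at_subseq.
  by rewrite extraE subseq_filter Bpick (subseq_trans (sub_at_subseq B)).
- apply/forallP => v; apply: leq_trans (AB v).
  rewrite count_cat count_map -!addnA addnA leq_add //; last first.
    by rewrite (f_load (mem B)) count_sub_at.
  rewrite -(count_sub_at A (fun o : oedge n => o.1.1 == v)) -(count_sub_at A (fun o : oedge n => o.1.2 == v)).
  elim: (sub_at A) => //= o s IHs; rewrite /incident !inE /=.
  rewrite addnACA leq_add // ![v == _]eq_sym.
  by case: (_ == v); case: (_ == v).
have -> : weight ML = (\sum_(j : J) (nth_ord j).2)%N.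
  by rewrite /weight (big_tnth _ _ ML).
rewrite (_ : weight _ = (\sum_(i in A) (nth_ord i).2 + \sum_(j in B) (nth_ord j).2)%N) //.
by rewrite /weight big_cat /= big_map /sub_at !big_map !big_enum.
Qed.

End LateMatching.

(** * Failure events *)

Section Capped.
Variables (W n m : nat) (G : wmultigraph W n m).

(* Degrees never exceed m, so truncating keeps the same b-matchings; m.+1 rather
   than m keeps the capacities positive when m = 0. *)
Definition truncate (cap : 'I_n -> nat) : {ffun 'I_n -> nat} := [ffun v => minn (cap v) m.+1].

Lemma truncate_gt0 v : 0 < truncate (cap G) v.
Proof. by rewrite ffunE leq_min cap_gt0. Qed.

Lemma truncate_mult (u v : 'I_n) : u != v ->
  count (fun e : wedge n => e.1 == [set u; v]) (edges G)
    <= minn (truncate (cap G) u) (truncate (cap G) v).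
Proof.
move=> uv; have cm : count (fun e : wedge n => e.1 == [set u; v]) (edges G) <= m.+1.
  by apply: leq_trans (count_size _ _) _; rewrite size_tuple.
by rewrite !ffunE !leq_min cm !andbT -leq_min edges_mult.
Qed.

Definition capped : wmultigraph W n m :=
  WMultigraph truncate_gt0 (@edges_loopless _ _ _ G) (@edges_weight _ _ _ G) truncate_mult.

Lemma capped_bmatching M : is_bmatching capped M = is_bmatching G M.
Proof.
rewrite /is_bmatching /=; case: submultisetP => //= sub.
apply: eq_forallb => v; rewrite ffunE leq_min andb_idr // => _.
rewrite leqW // (leq_trans (count_size _ _)) // -[X in _ <= X](size_tuple (edges G)).
exact: leq_size_count.
Qed.

Lemma capped_max M : is_max_bmatching G M -> is_max_bmatching capped M.
Proof.
by move=> [MG best]; split=> [|M']; rewrite capped_bmatching //; exact: best.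
Qed.

End Capped.

(** Here x = 1 / N, be = N^13, eta = x^3 and xi = th = x. With D of order at most N, the damage rate
    is dominated by D^2 / (be * eta^3), of order x^(13 - 2 - 9) = x^2; and W * eta <= x^2 leaves
    room below th. *)
Lemma numeric_conditions (R : realFieldType) (x w : R) : (0 < x <= 1 / 100 -> 0 <= w -> w * x <= 1 ->
  [/\ 2 * x ^+ 13 <= x / (2 * (w + x)),
      2 * x ^+ 13 + 4 * x ^+ 3 + w * (2 * x ^+ 13 + 2 * x ^+ 3) <= x &
      damage_rate (x ^- 13) (x ^+ 3) (w + 2 * x ^+ 13) <= x])%R.
Proof.
move=> /andP[x0 x1] w0 wx.
have xk k : (0 <= x ^+ k <= 1)%R by rewrite exprn_ge0 ?(ltW x0) // exprn_ile1 ?(ltW x0) //; lra.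
have wxk k : (0 <= w * x ^+ k.+1 <= x ^+ k)%R.
  rewrite mulr_ge0 ?exprn_ge0 ?(ltW x0) //= exprS mulrA ler_piMl //.
  by rewrite exprn_ge0 // ltW.
have step k : (x ^+ k.+1 <= x ^+ k / 100)%R.
  by rewrite exprSr ler_wpM2l ?exprn_ge0 ?(ltW x0) //; lra.
have le1 k : (x ^+ k.+1 <= x)%R by rewrite exprS ler_piMr ?(ltW x0) //; case/andP: (xk k).
split.
- rewrite ler_pdivlMr; last by rewrite mulr_gt0 // ltr_wpDl.
  have := wxk 12; have := step 13; have := step 11; have := le1 10.
  have -> : (2 * x ^+ 13 * (2 * (w + x)) = 4 * (w * x ^+ 13) + 4 * x ^+ 14)%R by ring.
  have := le1 12; lra.
- have := wxk 12; have := wxk 2; have := le1 11; have := le1 1; have := le1 10.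
  have := step 1; have := step 2; have := step 11; have := step 12.
  have -> : (w * (2 * x ^+ 13 + 2 * x ^+ 3) = 2 * (w * x ^+ 13) + 2 * (w * x ^+ 3))%R by ring.
  rewrite expr1; lra.
have D0 : (0 <= w + 2 * x ^+ 13)%R by rewrite addr_ge0 // mulr_ge0 //; case/andP: (xk 13).
have Dx : ((w + 2 * x ^+ 13) * x <= 2)%R.
  by have := le1 13; rewrite mulrDl -mulrA -exprSr; lra.
rewrite /damage_rate; move: (w + _)%R D0 Dx => D D0 Dx.
have -> : (4 * D / (x ^- 13 * x ^+ 3 ^+ 2) * (1 + 2 * D / x ^+ 3) =
  4 * (D * x) * x ^+ 6 + 8 * ((D * x) * (D * x)) * x ^+ 2)%R.
  by field; rewrite gt_eqF.
have h1 : (4 * (D * x) * x ^+ 6 <= 8 * x ^+ 6)%R by rewrite ler_wpM2r ?exprn_ge0 ?(ltW x0) //; lra.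
have h2 : (8 * ((D * x) * (D * x)) * x ^+ 2 <= 32 * x ^+ 2)%R.
  rewrite ler_wpM2r ?exprn_ge0 ?(ltW x0) //.
  have : (D * x * (D * x) <= 2 * 2)%R by rewrite ler_pM // mulr_ge0 // ltW.
  lra.
have := step 5; have := le1 4; have := step 1; rewrite expr1; lra.
Qed.

(** The sources of loss are 2 x from [th], x from badly split vertices, and x from the edges of the
    optimum that arrive before the run ends. *)
Lemma combine_losses (R : realFieldType) (x K w e r : R) : (0 < x <= 1 / 100 -> K <= x -> 0 <= w -> e <= x * w ->
  r = w - e -> (1 - 4 * x) * w <= (1 - 2 * x) * (1 - K) * r)%R.
Proof.
move=> /andP[x0 x1] Kx w0 ew ->.
have h1 : ((1 - x) * w <= w - e)%R by lra.
have xw : (0 <= (1 - x) * w)%R by rewrite mulr_ge0 //; lra.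
apply: (@le_trans _ _ ((1 - 2 * x) * (1 - x) * ((1 - x) * w)))%R.
  rewrite mulrA ler_wpM2r //; have : (0 <= x ^+ 2 * (1 - x))%R by rewrite mulr_ge0 ?sqr_ge0 //; lra.
  have : (0 <= x ^+ 2)%R by exact: sqr_ge0.
  rewrite expr2; nra.
apply: ler_pM => //; first by rewrite mulr_ge0; lra.
by rewrite ler_wpM2l; lra.
Qed.

(** * Parameters, memory and failure probabilities *)

Section Stream.
Variables (R : realType) (W n m N : nat) (G : wmultigraph W n m) (MG : seq (wedge n)).

(* One parameter N dominates W, 1 / eps and log m; all others are powers of it, up
   to numerical factors. *)
Definition kept_scale := N ^ 13.
Definition wait_scale := N ^ 5.
Definition store_all := m <= n * N ^ 5.
Definition patience j := m %/ (wait_scale * j.+1).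
(** Unless everything is stored, room times patience is at least 5 * N * m when the patience is
    positive, rounding down costing a factor of at most 2; when the patience is 0, the room exceeds
    m. *)
Definition extra_room j := if store_all then m else 10 * N * wait_scale * j.+1.

Hypothesis N100 : 100 <= N.
Hypothesis W_gt0 : 0 < W.
Hypothesis WN : W <= N.
Hypothesis mN : m < 2 ^ N.
Hypothesis MGmax : is_max_bmatching G MG.

Let cp := truncate m (cap G).
Let run l := foldl (advance R kept_scale patience extra_room) (start patience store_all cp) l.
Let Gc := capped G.
Let MGc : is_max_bmatching Gc MG := capped_max MGmax.
Let mu := size MG.

Let N0 : 0 < N. Proof. by apply: leq_trans N100. Qed.
Let be0 : 0 < kept_scale. Proof. by rewrite expn_gt0 N0. Qed.
Let cp0 v : 0 < cp v. Proof. exact: truncate_gt0. Qed.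

Lemma mods_le l : (forall x, count_mem x l <= count_mem x (edges G)) ->
  st_mods (run l) <= 3 * W ^ 2 * N ^ 26 * mu.
Proof.
move=> lG; have [_ pot cH _ _] := run_kept R patience extra_room store_all cp0 be0 l.
have HG x : count_mem x [seq unorient o | o <- st_kept (run l)] <= count_mem x (edges Gc).
  exact: leq_trans (cH x) (lG x).
have := le_trans pot (potential_le MGc R be0 HG W_gt0).
have b0 : (0 < (kept_scale%:R : R) ^+ 2)%R by rewrite exprn_gt0 // ltr0n.
rewrite ler_pdivrMr // -!natrX -!natrM ler_nat => /leq_trans; apply.
by rewrite /kept_scale -expnM [X in _ <= X]mulnAC.
Qed.

Lemma kept_size_le l : (forall x, count_mem x l <= count_mem x (edges G)) ->
  size (st_kept (run l)) <= (9 + 4 * (N ^ 13 * W)) * mu.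
Proof.
move=> lG; have [ov _ cH _ _] := run_kept R patience extra_room store_all cp0 be0 l.
have HG x : count_mem x [seq unorient o | o <- st_kept (run l)] <= count_mem x (edges Gc).
  exact: leq_trans (cH x) (lG x).
have := size_kept MGc be0 HG ov.
have -> : (1 + 4 * (kept_scale%:R * W%:R + 2) = (9 + 4 * (N ^ 13 * W))%:R :> R)%R.
  by rewrite natrD !natrM /kept_scale; ring.
by rewrite -natrM ler_nat.
Qed.

Lemma size_extra_le l : size (st_extra (run l)) <= extra_room (st_mods (run l)).
Proof.
have [l0 [l1 [l2 [_ _ _ _]]]] := run_history R patience extra_room store_all cp be0 l.
by case: (st_late _) => [[_ [_ ->]]|[_ -> _ _]] //; rewrite size_take; case: ltnP.
Qed.

(** At most 3 * W^2 * N^26 * mu insertions give a room of order N^34 * mu, the dominant term; the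
    spare powers of N absorb numerical factors. *)
Lemma size_code_le l : 0 < n -> (forall x, count_mem x l <= count_mem x (edges G)) ->
  size (code (run l)) <= N ^ 40 * maxn mu n.
Proof.
move=> n0 lG; rewrite size_code.
have hH := kept_size_le lG; have hU := size_extra_le l; have hj := mods_le lG.
set P := maxn mu n; have muP : mu <= P by exact: leq_maxl.
have nP : n <= P by exact: leq_maxr.
have P0 : 0 < P by apply: leq_trans nP.
have pow a b : a <= b -> N ^ a <= N ^ b by move=> ab; rewrite leq_exp2l //; apply: leq_trans N100.
have eN k : 100 * N ^ k <= N ^ k.+1 by rewrite expnS leq_mul2r N100 orbT.
have H1 : size (st_kept (run l)) <= N ^ 38 * P.
  apply: leq_trans hH _; apply: leq_mul => //.
  apply: leq_trans (_ : 100 * N ^ 14 <= _); last by apply: leq_trans (eN 14) _; apply: pow.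
  have : N ^ 13 * W <= N ^ 14 by rewrite (expnSr N 13) leq_mul2l WN orbT.
  have : 0 < N ^ 14 by rewrite expn_gt0 N0.
  by move: (N ^ 13 * W) (N ^ 14) => x y; lia.
have H2 : size (st_extra (run l)) <= N ^ 38 * P.
  apply: leq_trans hU _; rewrite /extra_room; case: ifP => [small|_].
    apply: leq_trans small _; rewrite mulnC leq_mul //; exact: pow.
  apply: leq_trans (_ : 10 * N * N ^ 5 * (4 * N ^ 28 * P) <= _).
    rewrite leq_mul //.
    have hj' : st_mods (run l) <= 3 * (N ^ 28 * P).
      apply: leq_trans hj _; rewrite mulnA leq_mul // -mulnA leq_mul2l /=.
      by rewrite (expnD N 2 26) leq_mul2r leq_sqr WN orbT.
    have : 0 < N ^ 28 * P by rewrite muln_gt0 expn_gt0 N0.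
    by rewrite -mulnA; move: (N ^ 28 * P) hj' => y hj'; lia.
  have -> : 10 * N * N ^ 5 * (4 * N ^ 28 * P) = 40 * N ^ 34 * P.
    rewrite -[34]/(1 + 5 + 28) !expnD expn1; ring.
  rewrite leq_mul //; apply: leq_trans (_ : 100 * N ^ 34 <= _); first by rewrite leq_mul2r orbT.
  by apply: leq_trans (eN 34) _; apply: pow.
have h5 : n + 4 <= 5 * P by move: (P) nP P0; clear; lia.
have x0 : 0 < N ^ 38 by rewrite expn_gt0 N0.
have xy : 100 * N ^ 38 <= N ^ 40 by apply: leq_trans (eN 38) _; apply: pow.
apply: leq_trans (leq_mul xy (leqnn P)).
rewrite -mulnA; move: (N ^ 38 * P) (leq_mul x0 (leqnn P)) H1 H2 h5 => y.
move: (size _) (size _) (P); clear; lia.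
Qed.

Let edge (i : 'I_m) : wedge n := tnth (edges G) i.
Let arr (s : 'S_m) : seq (wedge n) := arrival G s.
Let stage s t := run (take t (arr s)).
Let pick H e := pick_underfull R cp kept_scale H e.
Let hits (st : state n) := [set x : 'I_m | pick (st_kept st) (edge x) != None].

Let ids := enum 'I_m.

Lemma arrE s : arr s = [seq edge (s i) | i <- ids].
Proof. by []. Qed.

Lemma take_ids t : perm_eq (take t ids) [seq i : 'I_m <- ids | i < t].
Proof.
have uids : uniq ids by exact: enum_uniq.
apply: uniq_perm => [||i]; [exact: take_uniq|exact: filter_uniq|].
have iids : i \in ids by rewrite mem_enum.
by rewrite mem_filter in_take // /ids index_enum_ord iids andbT.
Qed.

Lemma count_ids (P : pred 'I_m) : count P ids = #|[set i | P i]|.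
Proof. by rewrite -sum1_card -sum1_count big_enum_cond; apply: eq_bigl => i; rewrite inE. Qed.

Lemma count_take_arr s t P :
  count P (take t (arr s)) = #|[set i : 'I_m | (i < t) && P (edge (s i))]|.
Proof.
rewrite arrE -map_take count_map (seq.permP (take_ids t)) count_filter -count_ids.
by apply: eq_count => i /=; rewrite andbC.
Qed.

Lemma count_arr s P : count P (arr s) = #|[set i : 'I_m | P (edge i)]|.
Proof.
rewrite arrE count_map count_ids -[RHS](card_preimset _ (@perm_inj _ s)).
by apply: eq_card => i; rewrite !inE.
Qed.

(* After t arrivals and j insertions the patience j runs out, although at least
   extra_room j of the edges still to come are underfull. *)
Definition missed t j : {set 'S_m} := [set s : 'S_m |
  [&& st_mods (stage s t) == j,
      extra_room j + #|[set i : 'I_m | (i < t) && (s i \in hits (stage s t))]|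
        <= #|hits (stage s t)| &
      [forall i : 'I_m, (t <= i < t + patience j) ==> (s i \notin hits (stage s t))]]].

Lemma card_missed t j : ~~ store_all -> 0 < patience j -> t + patience j <= m ->
  #|missed t j| * m ^ 5 <= m`!.
Proof.
move=> big a0 tam.
pose Q := [set s : 'S_m | (st_mods (stage s t) == j) &&
  (extra_room j + #|[set i : 'I_m | (i < t) && (s i \in hits (stage s t))]|
        <= #|hits (stage s t)|)].
have prefix (s s' : 'S_m) : (forall i : 'I_m, i < t -> s i = s' i) -> stage s t = stage s' t.
  move=> ss; rewrite /stage; congr run; apply: (@eq_from_nth _ (set0, 0)).
    by rewrite !size_take !size_tuple.
  move=> i; rewrite size_take size_tuple => it.
  have im : i < m by case: (ltnP t m) it => // tm it; exact: ltn_trans it tm.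
  have it' : i < t by case: (ltnP t m) it => // mt it; exact: leq_trans it mt.
  have nthE z : nth (set0, 0) (arr z) i = edge (z (Ordinal im)).
    by rewrite -[i]/(val (Ordinal im)) -tnth_nth tnth_mktuple.
  by rewrite !nth_take // !nthE ss.
have := @card_misses m (extra_room j) t (patience j) Q (fun s => hits (stage s t)) tam.
have -> : [set s in Q | [forall i : 'I_m, (t <= i < t + patience j) ==> (s i \notin hits (stage s t))]]
    = missed t j.
  by apply/setP => z; rewrite !inE -andbA.
move=> H.
have m0 : 0 < m by apply: leq_trans a0 (leq_trans (leq_addl _ _) tam).
have tail := @miss_tail R m (extra_room j) (patience j) N a0 (ltnW mN).
have ma0 : 0 < m ^ patience j by rewrite expn_gt0 m0.
rewrite -(leq_pmul2r ma0) mulnAC.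
apply: leq_trans (leq_mul (H _ _) (leqnn _)) _.
- move=> s s' ss; split; last by rewrite (prefix _ _ ss).
  rewrite !inE (prefix _ _ ss); congr (_ && (_ + _ <= _)); apply: eq_card => i; rewrite !inE.
  by case: ltnP => //= /ss ->.
- move=> s; rewrite inE => /andP[_ room].
  have hE : #|hits (stage s t)| = #|[set i : 'I_m | s i \in hits (stage s t)]|.
    rewrite -(card_preimset _ (@perm_inj _ s)); apply: eq_card => i.
    by rewrite !inE.
  rewrite -(leq_add2r #|[set i : 'I_m | (i < t) && (s i \in hits (stage s t))]|).
  apply: leq_trans room _; rewrite hE -cardsUI.
  apply: leq_trans (leq_addr _ _); apply/subset_leq_card/subsetP => i; rewrite !inE => ->.
  by rewrite !andbT leqNgt orbC orbN.
rewrite -mulnA leq_mul2l; apply/orP; right; apply: tail.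
rewrite /extra_room (negPf big) /patience.
have := ltn_ceil m (_ : 0 < wait_scale * j.+1); rewrite muln_gt0 expn_gt0 N0 /= => /(_ isT).
move: a0; rewrite /patience; move: (m %/ _) => a a0.
have -> : 10 * N * wait_scale * j.+1 = 10 * N * (wait_scale * j.+1) by rewrite mulnA.
move: (wait_scale * j.+1) => y my.
have : m <= 2 * (a * y).
  apply: ltnW; apply: leq_trans my _; rewrite mulSn mulSn mul1n leq_add2r.
  by rewrite leq_pmull.
move=> h; have := leq_mul (leqnn (5 * N)) h; move/leq_trans; apply.
by rewrite leq_eqVlt; apply/orP; left; apply/eqP; ring.
Qed.

Variable K : {set 'I_m}.
Hypothesis MGK : perm_eq MG [seq edge x | x <- enum K].
Hypothesis n0 : 0 < n.

(* An upper bound on the time at which the first phase stops. *)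
Definition prefix_len := (m %/ wait_scale) * N.+1.
(** Losing mu / N^2 edges of weight at most W <= N costs at most mu / N, hence a fraction 1 / N of
    the weight of [MG], whose edges weigh at least 1. *)
Definition loss_len := (mu %/ N ^ 2).+1.
Definition lost : {set 'S_m} :=
  [set s : 'S_m | loss_len <= #|[set i : 'I_m | (i < prefix_len) && (s i \in K)]|].

(** From n * N^5 < m <= mu * (2 n + 1) <= 3 n * mu. The tail bound on early edges needs mu / N^2 >=
    3 * N. *)
Lemma big_mu : ~~ store_all -> 3 * N * N ^ 2 <= mu.
Proof.
rewrite /store_all -ltnNge => big; have := edges_le MGc; rewrite -/mu => le_m.
have h : n * N ^ 5 < n * (3 * mu).
  apply: leq_trans big (leq_trans le_m _); rewrite mulnC mulnCA mulnA leq_mul2r.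
  by rewrite [_ <= _](_ : _ = true) ?orbT //; move: n0; clear; lia.
move: h; rewrite ltn_pmul2l // => h.
have : 9 * N ^ 3 <= N ^ 5.
  by rewrite (expnD N 2 3) leq_mul2r (leq_trans (leq_trans _ N100)) ?orbT //; rewrite expnS leq_pmulr ?expn_gt0 ?N0.
have -> : 3 * N * N ^ 2 = 3 * N ^ 3 by rewrite -mulnA -expnS.
by move: (N ^ 3) (N ^ 5) h => x y; lia.
Qed.

Lemma prefix_small : ~~ store_all -> 8 * N ^ 2 * prefix_len <= m /\ prefix_len < m.
Proof.
move=> big; have m0 : 0 < m by move: big; rewrite /store_all -ltnNge; apply: leq_ltn_trans.
have h : 8 * N ^ 2 * prefix_len <= m.
  apply: leq_trans (leq_trunc_div m wait_scale); rewrite /prefix_len mulnCA leq_mul2l.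
  apply/orP; right; rewrite /wait_scale (expnD N 2 3) -mulnA mulnCA leq_mul2l.
  apply/orP; right; apply: leq_trans (_ : 100 * N <= _); first by move: N100; clear; lia.
  by rewrite (expnSr N 2) leq_mul // (leq_trans N100) // (expnSr N 1) expn1 leq_pmulr.
split=> //; have [->//|q0] := posnP prefix_len.
apply: leq_trans h; rewrite -[X in X < _]mul1n ltn_pmul2r //.
by rewrite (@leq_trans (8 * 1)) // leq_mul // expn_gt0 N0.
Qed.

Lemma size_K : #|K| = mu.
Proof. by rewrite /mu (perm_size MGK) size_map cardE. Qed.

Lemma card_lost : ~~ store_all -> #|lost| * m ^ 3 <= m`!.
Proof.
move=> big; have [pm qm] := prefix_small big.
have m0 : 0 < m by apply: leq_ltn_trans qm.
have early := card_early loss_len K (ltnW qm); rewrite size_K in early.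
have tail : 'C(mu, loss_len) * prefix_len ^ loss_len * m ^ 3 <= m ^ loss_len.
  apply: (@early_tail _ _ _ N) => //; last 1 first.
  - apply: leq_trans (leq_mul (leqnn _) pm).
    have muN : mu <= loss_len * N ^ 2 by rewrite ltnW // /loss_len ltn_ceil // expn_gt0 N0.
    have -> : loss_len * (8 * N ^ 2 * prefix_len) = 8 * (loss_len * N ^ 2) * prefix_len.
      by move: (N ^ 2) => y; ring.
    by rewrite leq_mul // leq_mul.
  - by rewrite /loss_len leqW // leq_divRL ?expn_gt0 ?N0 // big_mu.
  - exact: ltnW.
have mc0 : 0 < m ^ loss_len by rewrite expn_gt0 m0.
rewrite -(leq_pmul2r mc0) mulnAC; apply: leq_trans (leq_mul early (leqnn _)) _.
by rewrite mulnCA -!mulnA leq_mul2l mulnA tail orbT.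
Qed.

(** Outside the failure events all is deterministic. Late edges fit into the room, since an overflow
    would put s into [missed] at the end of [l0]; the part of [MG] within l0 ++ l1 is light, and
    [late_matching] handles the rest. *)
Lemma success s :
  store_all \/ (s \notin lost /\
    forall t j : 'I_m, 0 < patience j -> t + patience j <= m -> s \notin missed t j) ->
  exists M, [/\ subseq M [seq unorient o | o <- st_kept (run (arr s)) ++ st_extra (run (arr s))],
    respects cp M &
    ((1 - 4 / N%:R) * (weight MG)%:R <= (2 - (2 * (W%:R + N%:R^-1))^-1) * (weight M)%:R :> R)%R].
Proof.
move=> ev; have [l0 [l1 [l2 [lE [l1s l1u] [kE mE] l0s IH]]]] :=
  run_history R patience extra_room store_all cp be0 (arr s).
set st := run (arr s) in lE l1s l1u kE mE l0s IH *.
set T := size (l0 ++ l1).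
have sE : size (arr s) = m by rewrite size_tuple.
have Tq : ~~ store_all -> T <= prefix_len.
  move=> big; have wl : st_wait st <= patience (st_mods st).
    by case: (st_late st) IH => [[[->//|[sa]]]|[_ _ _ /ltnW //]]; rewrite sa in big.
  apply: leq_trans (_ : \sum_(i < (st_mods st).+1) patience i <= _).
    by rewrite /T size_cat l1s big_ord_recr leq_add.
  rewrite /prefix_len; under eq_bigr do rewrite /patience divnMA.
  by apply: sum_divn_le; apply: leq_ltn_trans (leq_div _ _) mN.
have [small_pre extraE] : (store_all -> l0 ++ l1 = [::]) /\
   st_extra st = take (extra_room (st_mods st)) (pmap (pick (st_kept st)) l2).
  case: (st_late st) IH => [[_ []] //|[l2E _ big _]].
  have [_] := prefix_small big; rewrite ltnNge => /negP[].
  by apply: leq_trans (Tq big); rewrite -sE lE catA l2E cats0.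
have l2m : size (pmap (pick (st_kept st)) l2) <= m.
  rewrite size_pmap; apply: leq_trans (count_size _ _) _.
  by rewrite -sE lE !size_cat addnA leq_addl.
have room : size (pmap (pick (st_kept st)) l2) <= extra_room (st_mods st).
  have [small|big] := boolP store_all; first by rewrite /extra_room small.
  have [a0|a0] := posnP (patience (st_mods st)).
    apply: leq_trans l2m _; rewrite /extra_room (negPf big).
    have ws0 : 0 < wait_scale * (st_mods st).+1 by rewrite muln_gt0 expn_gt0 N0.
    have := ltn_ceil m ws0; rewrite -/(patience _) a0 mul1n => /ltnW /leq_trans; apply.
    by rewrite -mulnA leq_pmull // muln_gt0 N0.
  rewrite leqNgt; apply/negP => over.
  case: ev => [sm|[_ ev]]; first by rewrite sm in big.
  have wE : st_wait st = patience (st_mods st).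
    case: (st_late st) IH => [[[->//|[sa]]]|[l2E _ _ _]]; first by rewrite sa in big.
    by move: over; rewrite l2E ltn0.
  have T0 : size l0 + patience (st_mods st) + size l2 = m.
    by rewrite -sE lE !size_cat addnA l1s wE.
  have t0m : size l0 < m by rewrite -T0 -addnA -[X in X < _]addn0 ltn_add2l ltn_addr.
  have [_ _ _ _ [jl _]] := run_kept R patience extra_room store_all cp0 be0 l0.
  have jm : st_mods st < m by rewrite -mE; apply: leq_ltn_trans jl t0m.
  have := ev (Ordinal t0m) (Ordinal jm) a0; rewrite /= => /(_ _)/negP[].
    by rewrite -T0 leq_addr.
  have stE : stage s (size l0) = run l0 by rewrite /stage lE take_size_cat.
  have hE : hits (stage s (size l0)) = [set x | pick (st_kept st) (edge x) != None].
    by rewrite stE /hits kE.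
  rewrite inE hE stE mE eqxx /=; apply/andP; split.
    have hc := count_arr s (fun e => pick (st_kept st) e != None).
    rewrite -hc lE !count_cat addnC.
    have -> : #|[set i : 'I_m | (i < size l0) & s i \in [set x | pick (st_kept st) (edge x) != None]]| =
        count (fun e => pick (st_kept st) e != None) l0.
      rewrite -[in RHS](take_size_cat (l1 ++ l2) (erefl (size l0))) -lE count_take_arr.
      by apply: eq_card => i; rewrite !inE.
    rewrite leq_add2l; apply: leq_trans (leq_addl _ _); apply: ltnW.
    have -> : count (fun e => pick (st_kept st) e != None) l2 = size (pmap (pick (st_kept st)) l2).
      by rewrite size_pmap; apply: eq_count => e /=; case: (pick _ e).
    exact: over.
  apply/forallP => i; apply/implyP => /andP[ti ia]; rewrite inE negbK.
  have : edge (s i) \in l1.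
    have -> : edge (s i) = nth (set0, 0) (arr s) i by rewrite -tnth_nth tnth_mktuple.
    rewrite lE nth_cat ltnNge ti /= nth_cat l1s wE.
    have ia' : i - size l0 < patience (st_mods st) by rewrite ltn_subLR.
    by rewrite ia' mem_nth // l1s wE.
  by move/(allP l1u).
rewrite take_oversize // in extraE.
pose EL := [seq edge (s i) | i <- take T ids & s i \in K].
pose ML := [seq edge (s i) | i <- drop T ids & s i \in K].
have MGE : perm_eq MG (EL ++ ML).
  apply: (perm_trans MGK); rewrite /EL /ML -map_cat -filter_cat cat_take_drop (map_comp edge s).
  apply: perm_map; apply: uniq_perm => [||x]; first exact: enum_uniq.
    by rewrite map_inj_uniq; [exact: (filter_uniq _ (enum_uniq 'I_m))|exact: perm_inj].
  rewrite mem_enum; apply/idP/mapP => [xK|[i + ->]]; last by rewrite mem_filter => /andP[].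
  exists ((s^-1)%g x); last by rewrite permKV.
  by rewrite mem_filter permKV xK /= mem_enum.
have l2E : l2 = drop T (arr s) by rewrite lE catA drop_size_cat.
have subML : subseq ML l2 by rewrite l2E arrE -map_drop map_subseq // filter_subseq.
have wE : weight MG = weight EL + weight ML.
  by rewrite /weight (perm_big _ MGE) big_cat.
have edgesE : val (edges G) = [seq edge i | i <- ids] by rewrite map_tnth_enum.
have inG (i : 'I_m) : edge i \in edges G by exact: mem_tnth.
have [/andP[/submultisetP MGsub /forallP MGcap] _] := MGc.
have ELsmall : N * weight EL <= weight MG.
  have weightW (L : seq (wedge n)) : {subset L <= edges G} -> weight L <= W * size L /\ size L <= weight L.
    move=> LG; rewrite /weight -sum1_size big_distrr /= !big_seq.
    by split; apply: leq_sum => e /LG/(@edges_weight _ _ _ G)/andP[]; rewrite ?muln1.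
  have [small|big] := boolP store_all.
    by rewrite /EL /T small_pre //= take0 /weight big_nil muln0.
  have ELG : {subset EL <= edges G} by move=> e /mapP[i _ ->].
  have MGG : {subset MG <= edges G} by move=> e; rewrite (perm_mem MGK) => /mapP[i _ ->].
  have [ELW _] := weightW EL ELG; have [_ muW] := weightW MG MGG.
  have ELs : size EL <= mu %/ N ^ 2.
    case: ev => [sm|[slost _]]; first by rewrite sm in big.
    move: slost; rewrite inE -ltnNge /loss_len ltnS; apply: leq_trans.
    rewrite /EL size_map size_filter (seq.permP (take_ids T)) count_filter count_ids.
    apply/subset_leq_card/subsetP => i; rewrite !inE andbC => /andP[iT ->].
    by rewrite andbT (leq_trans iT) // Tq.
  apply: leq_trans muW; apply: leq_trans (leq_trunc_div mu (N ^ 2)).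
  apply: leq_trans (leq_mul (leqnn N) ELW) _; rewrite mulnA mulnC leq_mul //.
  by rewrite expnS expn1 leq_mul.
have MLG : {subset ML <= edges G} by move=> e /mapP[i _ ->].
have MLcap : respects cp ML.
  apply/forallP => v; apply: leq_trans (MGcap v).
  by rewrite (seq.permP MGE) count_cat leq_addl.
have [ov _ cH _ _] := run_kept R patience extra_room store_all cp0 be0 l0.
rewrite -/(run l0) kE in ov cH.
have HG x : count_mem x [seq unorient o | o <- st_kept st] <= count_mem x (edges Gc).
  apply: leq_trans (cH x) _; apply: leq_trans (_ : count_mem x (arr s) <= _).
    by rewrite lE count_cat leq_addr.
  by rewrite count_arr /= edgesE count_map count_ids.
have NR : (0 < N%:R :> R)%R by rewrite ltr0n N0.
have xP : (0 < (N%:R^-1 : R) <= 1 / 100)%R.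
  by rewrite invr_gt0 NR /= div1r lef_pV2 ?posrE ?ltr0n // ler_nat.
have wx : (W%:R * N%:R^-1 <= 1 :> R)%R by rewrite ler_pdivrMr // mul1r ler_nat.
have [c1 c2 c3] := numeric_conditions xP (ler0n R W) wx.
have beE : (2 / kept_scale%:R = 2 * N%:R^-1 ^+ 13 :> R)%R by rewrite /kept_scale natrX exprVn.
have [||||M [sM capM wM]] := @late_matching R W n m Gc kept_scale (st_kept st) l2 ML
  (N%:R^-1 ^+ 3)%R (N%:R^-1)%R (N%:R^-1)%R W_gt0 be0 _ _ _ _ HG ov subML MLG MLcap.
- by rewrite exprn_gt0 // invr_gt0.
- by rewrite invr_gt0.
- by rewrite beE.
- rewrite beE c2 /=; case/andP: xP; lra.
exists M; split=> //; first by rewrite map_cat extraE.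
apply: le_trans wM; rewrite beE.
have -> : (kept_scale%:R = N%:R^-1 ^- 13 :> R)%R by rewrite /kept_scale natrX exprVn invrK.
apply: (@combine_losses _ _ _ _ (weight EL)%:R _ xP c3 (ler0n _ _)).
  by rewrite mulrC ler_pdivlMr // mulrC -natrM ler_nat.
by rewrite wE natrD addrAC subrr add0r.
Qed.

End Stream.

(** * Correctness *)

Definition matching_algo (R : realType) (W n m N : nat) : stream_algo W n m :=
  StreamAlgo
    (fun cap => to_words n m W (code (start (patience m N) (store_all n m N) (truncate m cap))))
    (fun ws e => to_words n m W (code (advance R (kept_scale N) (patience m N) (extra_room n m N)
                                      (decode n (of_words ws)) e)))
    (fun ws => let st := decode n (of_words ws) in
       best_bmatching (st_cap st) [seq unorient o | o <- st_kept st ++ st_extra st]).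

Section Correctness.
Variables (R : realType) (W n m N : nat) (G : wmultigraph W n m).
Hypothesis n0 : 0 < n.
Hypothesis W0 : 0 < W.
Hypothesis N0 : 0 < N.

Let cp := truncate m (cap G).
Let run l := foldl (advance R (kept_scale N) (patience m N) (extra_room n m N))
  (start (patience m N) (store_all n m N) cp) l.

Let be0 : 0 < kept_scale N. Proof. by rewrite expn_gt0 N0. Qed.
Let cp0 v : 0 < cp v. Proof. exact: truncate_gt0. Qed.

(** Kept and late edges come from the disjoint parts [l0] and [l2] of the stream, so no copy is
    stored twice. *)
Lemma count_stored l x :
  count_mem x [seq unorient o | o <- st_kept (run l) ++ st_extra (run l)] <= count_mem x l.
Proof.
have [l0 [l1 [l2 [lE _ [kE mE] _ IH]]]] :=
  run_history R (patience m N) (extra_room n m N) (store_all n m N) cp be0 l.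
have [_ _ cH _ _] := run_kept R (patience m N) (extra_room n m N) (store_all n m N) cp0 be0 l0.
rewrite kE in cH.
have -> : count_mem x l = count_mem x (l0 ++ l1) + count_mem x l2 by rewrite lE catA count_cat.
rewrite map_cat count_cat leq_add //.
  by apply: leq_trans (cH x) _; rewrite count_cat leq_addr.
case: (st_late _) IH => [[_ [_ ->]]|[_ -> _ _] //].
set g := extra_room _ _ _ _; set H := st_kept _.
apply: leq_trans (_ : count_mem x [seq unorient o | o <- pmap (pick_underfull R cp (kept_scale N) H) l2] <= _).
  by apply/leq_count_subseq/map_subseq/take_subseq.
elim: (l2) => //= e s IHs; case E: pick_underfull => [o|] /=; last by rewrite (leq_trans IHs) ?leq_addl.
by rewrite (pick_underfullP E).1 leq_add2l.
Qed.

Lemma run_words l : size l <= m -> {subset l <= edges G} ->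
  all (fun x => x <= n + m + W) (code (run l)).
Proof.
move=> lm lG.
have [_ _ _ sH [jl wl]] := run_kept R (patience m N) (extra_room n m N) (store_all n m N) cp0 be0 l.
apply: code_words => //; try by apply: leq_trans lm.
- move=> v; have -> : st_cap (run l) = cp := run_cap _ _ _ _ _ _ _.
  by rewrite ffunE; apply: leq_trans (geq_minr _ _) _; move: n0; clear; lia.
apply/allP => o oS; apply: (andP (@edges_weight _ _ _ G (unorient o) _)).2.
apply: lG; rewrite -has_pred1 has_count; apply: leq_trans (count_stored l (unorient o)).
by rewrite -has_count has_pred1 map_f.
Qed.

Lemma memory_words l : size l <= m -> {subset l <= edges G} ->
  foldl (step (matching_algo R W n m N)) (init (matching_algo R W n m N) (cap G)) l
    = to_words n m W (code (run l)).
Proof.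
elim/last_ind: l => [|l e IHl] // lm lG.
have lm' : size l <= m by apply: leq_trans lm; rewrite size_rcons.
have lG' : {subset l <= edges G} by move=> x xl; apply: lG; rewrite mem_rcons inE xl orbT.
rewrite foldl_rcons IHl // [LHS](_ : _ = to_words n m W (code (advance R (kept_scale N) (patience m N)
  (extra_room n m N) (decode n (of_words (to_words n m W (code (run l))))) e))) //.
by rewrite to_wordsK ?run_words // codeK /run foldl_rcons.
Qed.

Lemma arrival_sub s t : size (take t (arrival G s)) <= m /\ {subset take t (arrival G s) <= edges G}.
Proof.
split; first by rewrite size_take size_tuple; case: ltnP => // /ltnW.
by move=> x /mem_take/mapP[i _ ->]; exact: mem_tnth.
Qed.

Lemma memory_atE s t :
  memory_at (matching_algo R W n m N) G s t = to_words n m W (code (run (take t (arrival G s)))).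
Proof. by have [h1 h2] := arrival_sub s t; exact: memory_words. Qed.

Lemma outputE s : output (matching_algo R W n m N) G s =
  best_bmatching cp [seq unorient o | o <- st_kept (run (arrival G s)) ++ st_extra (run (arrival G s))].
Proof.
have [h1 h2] := arrival_sub s m.
have capE : st_cap (run (arrival G s)) = cp by exact: run_cap.
rewrite /output memory_atE [LHS](_ : _ = let st := decode n (of_words (to_words n m W
  (code (run (take m (arrival G s)))))) in
  best_bmatching (st_cap st) [seq unorient o | o <- st_kept st ++ st_extra st]) //.
by rewrite to_wordsK ?run_words // codeK take_oversize ?size_tuple // -capE.
Qed.

Lemma count_arrival s x : count_mem x (arrival G s) = count_mem x (edges G).
Proof.
apply/seq.permP; rewrite -[X in perm_eq _ X]map_tnth_enum.
rewrite (_ : tval (arrival G s) = [seq tnth (edges G) i | i <- map s (enum 'I_m)]); last first.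
  by rewrite -map_comp.
apply: perm_map; apply: uniq_perm => [||i]; last 1 first.
- rewrite mem_enum; apply/mapP; exists ((s^-1)%g i); rewrite ?permKV //; exact: mem_enum.
- by rewrite map_inj_uniq; [exact: enum_uniq|exact: perm_inj].
- exact: enum_uniq.
Qed.

Lemma output_bmatching s : is_bmatching G (output (matching_algo R W n m N) G s).
Proof.
rewrite outputE; set L := [seq _ | _ <- _]; have [sub /forallP resp _] := best_bmatchingP cp L.
apply/andP; split.
  apply/submultisetP => x; apply: leq_trans (leq_count_subseq _ sub) _.
  by rewrite -(count_arrival s); exact: count_stored.
by apply/forallP => v; apply: leq_trans (resp v) _; rewrite ffunE geq_minl.
Qed.

End Correctness.

(** For m = 0 the inverse is 0 by convention and the bound demands probability 1; hence the
    alternative [bad = set0]. *)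
Lemma prob_perm_ge (R : realType) (m : nat) (P : pred 'S_m) (bad : {set 'S_m}) :
  (forall s, s \notin bad -> P s) -> bad = set0 \/ 0 < m /\ #|bad| * m ^ 3 <= 2 * m`! ->
  (1 - 2 * m%:R ^- 3 <= prob_perm R P)%R.
Proof.
move=> Pgood badm; rewrite /prob_perm.
have f0 : (0 < (m`!)%:R :> R)%R by rewrite ltr0n fact_gt0.
have cardP : m`! <= #|[set s | P s]| + #|bad|.
  rewrite -card_Sn -cardsT -cardsUI; apply: leq_trans (leq_addr _ _).
  apply/subset_leq_card/subsetP => s _; rewrite !inE orbC.
  by case: (boolP (s \in bad)) => // /Pgood.
rewrite ler_pdivlMr //; move: cardP; rewrite -(ler_nat R) natrD => cardP.
have badR : ((#|bad|)%:R <= 2 * (m`!)%:R * m%:R ^- 3 :> R)%R.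
  case: badm => [->|[m0 badm]]; first by rewrite cards0 !mulr_ge0 ?invr_ge0 ?exprn_ge0.
  by rewrite ler_pdivlMr ?exprn_gt0 ?ltr0n // -natrX -!natrM ler_nat.
by rewrite mulrBl mul1r -mulrA [(_ ^- 3 * _)%R]mulrC mulrA; lra.
Qed.

(** ln 2 >= 1/2, from exp (- 1/2) >= 1/2. *)
Lemma trunc_log_le_ln (R : realType) (m : nat) : ((trunc_log 2 m)%:R <= 2 * ln m%:R :> R)%R.
Proof.
have [->|m0] := posnP m; first by rewrite trunc_log0 ln0 ?mulr0.
have ln2 : (1 / 2 <= ln 2 :> R)%R.
  rewrite -ler_expR lnK ?posrE ?ltr0n //.
  have := expR_ge1Dx (- (1 / 2) : R)%R; rewrite expRN => h.
  have e0 : (0 < expR (1 / 2) :> R)%R by exact: expR_gt0.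
  have : ((1 + - (1 / 2)) * expR (1 / 2) <= 1 :> R)%R.
    by rewrite -[leRHS](mulVf (lt0r_neq0 e0)) ler_wpM2r // ltW.
  lra.
have : (ln (2 ^ trunc_log 2 m)%:R <= ln m%:R :> R)%R.
  by rewrite ler_ln ?posrE ?ltr0n ?expn_gt0 // ler_nat trunc_logP.
rewrite natrX lnXn ?ltr0n // => h.
have : ((trunc_log 2 m)%:R * (1 / 2) <= (trunc_log 2 m)%:R * ln 2 :> R)%R by rewrite ler_wpM2l.
by move: h; rewrite -mulr_natl; lra.
Qed.

(** With x = 1 / N, replacing W + x by W costs at most x and dividing by 1 - 4 x about 8 x; 100 x <=
    eps covers both. *)
Lemma ratio_bound (R : realType) (W N : nat) (eps : R) (a o o' : nat) :
  (100 <= N)%N -> (1 <= W)%N -> (100 <= eps * N%:R)%R -> o <= o' ->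
  ((1 - 4 / N%:R) * a%:R <= (2 - (2 * (W%:R + N%:R^-1))^-1) * o%:R :> R)%R ->
  (a%:R <= (2 - (2 * W%:R)^-1 + eps) * o'%:R :> R)%R.
Proof.
move=> N100 W1 epsN oo' h.
have NR : (100 <= N%:R :> R)%R by rewrite ler_nat.
have WR : (1 <= W%:R :> R)%R by rewrite ler1n.
have o'0 : (0 <= o'%:R :> R)%R by rewrite ler0n.
have epsx : (100 * N%:R^-1 <= eps)%R by rewrite ler_pdivrMr //; lra.
have x0 : (0 < N%:R^-1 :> R)%R by rewrite invr_gt0; lra.
have x1 : (N%:R^-1 <= 1 / 100 :> R)%R by rewrite div1r lef_pV2 ?posrE //; lra.
move: (N%:R^-1)%R epsx x0 x1 h => x epsx x0 x1 h.
have inv_le : ((2 * W%:R)^-1 - x <= (2 * (W%:R + x))^-1 :> R)%R.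
  rewrite lerBlDr -subr_ge0.
  have -> : ((2 * (W%:R + x))^-1 + x - (2 * W%:R)^-1 =
     x * (1 - (2 * W%:R * (W%:R + x))^-1) :> R)%R by field; lra.
  rewrite mulr_ge0 ?(ltW x0) // subr_ge0 invf_le1; nra.
have inv1 : (0 <= ((2 * W%:R)^-1 : R) <= 1)%R.
  by rewrite invr_ge0 invf_le1; lra.
have x4 : (0 < 1 - 4 * x)%R by lra.
rewrite -(ler_pM2l x4); apply: le_trans h _.
apply: (@le_trans _ _ ((2 - (2 * W%:R)^-1 + x) * o'%:R))%R.
  apply: ler_pM; rewrite ?ler_nat //; first last.
  - lra.
  - rewrite subr_ge0; apply: le_trans (_ : 1 <= _)%R; last lra.
    by rewrite invf_le1; lra.
rewrite mulrA ler_wpM2r //.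
move: inv1 => /andP[i0 i1]; move: ((2 * W%:R)^-1)%R i0 i1 => i i0 i1.
have : (0 <= x * (1 - i))%R by rewrite mulr_ge0; lra.
have : (x * i >= 0)%R by rewrite mulr_ge0; lra.
have : (x * eps <= eps / 100)%R by rewrite mulrC ler_wpM2l; lra.
by rewrite mulrDr mulrDr mulrBl; lra.
Qed.

(** The random order permutes positions, so the optimum has to be located as a set of positions. *)
Lemma bmatching_positions (W n m : nat) (G : wmultigraph W n m) (M : seq (wedge n)) :
  is_bmatching G M -> exists K : {set 'I_m}, perm_eq M [seq tnth (edges G) x | x <- enum K].
Proof.
move=> /andP[/submultisetP/count_subseqP[M' /subseqP[mk _ M'E] MM'] _].
exists [set i : 'I_m | nth false mk i]; apply: (perm_trans MM').
rewrite M'E -[X in mask mk X]map_tnth_enum -map_mask mask_enum_ord.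
apply/perm_map/uniq_perm => [||i]; [exact: (filter_uniq _ (enum_uniq 'I_m))|exact: enum_uniq|].
by rewrite mem_filter [in RHS]mem_enum inE [i \in enum _](mem_enum 'I_m) andbT.
Qed.

(** Union bound: [lost] has probability at most m^-3, and each of the at most m^2 events [missed] at
    most m^-5. *)
Lemma matching_algo_correct (R : realType) (eps : R) (W n m N : nat)
    (G : wmultigraph W n m) (MG : seq (wedge n)) :
  0 < n -> 0 < W -> W <= N -> 100 <= N -> m < 2 ^ N -> (100 <= eps * N%:R)%R ->
  is_max_bmatching G MG ->
  (1 - 2 * m%:R ^- 3 <= prob_perm R (fun s : 'S_m =>
        is_bmatching G (output (matching_algo R W n m N) G s) &&
        ((weight MG)%:R <= (2 - (2 * W%:R)^-1 + eps) *
           (weight (output (matching_algo R W n m N) G s))%:R :> R)))%R.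
Proof.
move=> n0 W0 WN N100 mN epsN MGmax.
have N0 : 0 < N by apply: leq_trans N100.
have [K MGK] := bmatching_positions MGmax.1.
pose bad : {set 'S_m} := if store_all n m N then set0 else
  lost N MG K :|: \bigcup_(tj : 'I_m * 'I_m |
     (0 < patience m N tj.2) && (tj.1 + patience m N tj.2 <= m)) missed R N G tj.1 tj.2.
apply: (@prob_perm_ge _ _ _ bad) => [s sgood|].
  rewrite output_bmatching // andTb.
  have [|M [subM capM wM]] := @success R W n m N G MG N100 W0 WN mN MGmax K MGK s.
    move: sgood; rewrite /bad; case: ifP => [small _|_ sgood']; [by left|right].
    move: sgood'; rewrite in_setU negb_or => /andP[nl nm]; split=> // t j a0 ta.
    by apply: contra nm => ms; apply/bigcupP; exists (t, j); rewrite //= a0.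
  apply: (ratio_bound N100 W0 epsN _ wM); rewrite outputE //.
  set L := [seq unorient o | o <- _].
  by have [_ _ best] := best_bmatchingP (truncate m (cap G)) L; exact: best.
rewrite /bad; case: ifP => [_|/negbT big]; [by left|right].
have m0 : 0 < m by move: big; rewrite /store_all -ltnNge; apply: leq_ltn_trans.
split=> //; apply: leq_trans (leq_mul (leq_card_setU _ _) (leqnn _)) _.
rewrite mulnDl mul2n -addnn leq_add //; first exact: (card_lost N100 W0 WN mN MGmax MGK n0 big).
apply: leq_trans (leq_mul (card_bigcup_le _ _) (leqnn _)) _.
have m2 : 0 < m ^ 2 by rewrite expn_gt0 m0.
rewrite -(leq_pmul2r m2) -mulnA -expnD big_distrl /=.
apply: leq_trans (_ : \sum_(tj : 'I_m * 'I_m) m`! <= _).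
  rewrite big_mkcond; apply: leq_sum => tj _; case: ifP => // /andP[a0 ta].
  exact: card_missed.
by rewrite sum_nat_const card_prod card_ord mulnC.
Qed.

(* For n = 0 the memory bound is 0, so that not even counters can be kept. *)
Definition idle_algo (W n m : nat) : stream_algo W n m :=
  StreamAlgo (fun=> [::]) (fun _ _ => [::]) (fun=> [::]).

Local Open Scope ring_scope.

(* C * (1 + ln m + W + 1/eps) ^ k, with C and k absolute, is the general form
   of an O(poly(log m, W, 1/eps)) bound; it comes before eps and W so that it
   cannot depend on them. *)
Theorem theorem5 (R : realType) :
  exists C k : nat,
  forall (eps : R) (W : nat), 0 < eps < 1 / 2%:R -> (1 <= W)%N ->
  exists A : forall n m : nat, stream_algo W n m,
  forall (n m : nat) (G : wmultigraph W n m) (MG : seq (wedge n)),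
    is_max_bmatching G MG ->
    (forall (s : 'S_m) (t : nat), (t <= m)%N ->
       (size (memory_at (A n m) G s t))%:R <=
         C%:R * (maxn (size MG) n)%:R *
         (1 + ln m%:R + W%:R + eps^-1) ^+ k :> R) /\
    prob_perm R (fun s : 'S_m =>
        is_bmatching G (output (A n m) G s) &&
        ((weight MG)%:R <=
           (2%:R - (2%:R * W%:R)^-1 + eps) *
           (weight (output (A n m) G s))%:R :> R))
      >= 1 - 2%:R * m%:R ^- 3.
Proof.
(* The memory is at most N^40 * max(|MG|, n), and N <= 200 (1 + ln m + W + 1 / eps): the factor 100
   ensures eps * N >= 100, the factor 2 covers log_2 m <= 2 ln m and rounding. *)
have [C CE] : exists C, C = (200 ^ 40)%N by eexists.
exists C, 40%N => eps W /andP[eps0 _] W0.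
pose E := (Num.truncn eps^-1).+1.
pose N m := (100 * (trunc_log 2 m + 1 + W + E))%N.
exists (fun n m => if n == 0%N then idle_algo W n m else matching_algo R W n m (N m)).
move=> n m G MG MGmax.
have ln0' : 0 <= ln m%:R :> R.
  have [->|m0] := posnP m; first by rewrite ln0.
  by rewrite ln_ge0 // ler1n.
have ieps0 : 0 < eps^-1 by rewrite invr_gt0.
have [n0|n0] := eqVneq n 0%N.
  have noedge : tval (edges G) = [::].
    case E0 : (tval (edges G)) => [//|e l].
    have eG : e \in edges G by rewrite -[_ \in _]/(e \in tval (edges G)) E0 mem_head.
    have n2 : (2 <= n)%N by have := max_card (mem e.1); rewrite (edges_loopless eG) card_ord.
    by suff : False by []; move: n2; rewrite n0.
  have idle_mem l : foldl (step (idle_algo W n m)) [::] l = [::].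
    by elim/last_ind: l => [|l e IHl] //; rewrite foldl_rcons.
  have MG0 : MG = [::].
    case: MGmax => /andP[/submultisetP/leq_size_count sub _] _.
    by apply/size0nil/eqP; move: sub; rewrite noedge leqn0.
  split=> [s t _|].
    rewrite /memory_at idle_mem; apply: mulr_ge0; first by apply: mulr_ge0; apply: ler0n.
    by apply: exprn_ge0; rewrite !addr_ge0 ?ler0n ?(ltW ieps0).
  apply: (@prob_perm_ge _ _ _ set0) => [s _|]; last by left.
  have -> : output (idle_algo W n m) G s = [::] by [].
  rewrite MG0 /weight big_nil mulr0 lexx andbT; apply/andP; split=> //.
  by apply/forallP => v.
have {}n0 : (0 < n)%N by rewrite lt0n.
have EP : eps^-1 < E%:R by rewrite /E; have /andP[] := truncn_itv (ltW ieps0).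
have EP' : E%:R <= eps^-1 + 1.
  by rewrite /E -natr1 lerD2r truncn_le ltW.
have N100 : (100 <= N m)%N by rewrite /N leq_pmulr // addnS.
have NX : (N m)%:R <= 200 * (1 + ln m%:R + W%:R + eps^-1) :> R.
  by rewrite /N natrM !natrD; have := trunc_log_le_ln R m; have := ler0n R W; lra.
have WN : (W <= N m)%N by rewrite /N; move: (trunc_log 2 m) (E) => a b; clear; lia.
have mN : (m < 2 ^ N m)%N.
  apply: leq_trans (trunc_log_ltn m (isT : (1 < 2)%N)) _.
  by rewrite leq_exp2l // /N; move: (trunc_log 2 m) (E) => a b; clear; lia.
split; last first.
  apply: matching_algo_correct => //.
  rewrite /N natrM mulrCA -[leLHS]mulr1 ler_wpM2l // mulrC.
  apply: (@le_trans _ _ (E%:R * eps)).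
    by rewrite -[leLHS](mulVf (lt0r_neq0 eps0)) ler_wpM2r // ltW.
  by rewrite ler_wpM2r ?(ltW eps0) // ler_nat leq_addl.
move=> s t tm; rewrite memory_atE //; last by apply: leq_trans N100.
rewrite size_map.
apply: (@le_trans _ _ ((N m ^ 40 * maxn (size MG) n)%:R)).
  rewrite ler_nat; apply: size_code_le => // x.
  rewrite -(count_arrival G s x) -[X in (_ <= count_mem x X)%N](cat_take_drop t) count_cat.
  exact: leq_addr.
rewrite natrM natrX CE natrX -mulrA mulrCA mulrC -exprMn ler_wpM2l ?ler0n //.
by rewrite lerXn2r ?nnegrE ?ler0n //; have := ler0n R W; lra.
Qed.
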